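(* Let $\varphi:\mathbb{C}_+\to\mathbb{C}_+$ be analytic such that the composition operator $C_\varphi$ is bounded on the Zen space $A^2_\nu$, with corresponding weight $w$ on $(0,\infty)$, and let $L=\angle\lim_{z\to\infty}z/\varphi(z)$. Then the spectral radius $\rho(C_\varphi)$ satisfies $$L\,\limsup_{n\to\infty}\left(\inf_{t>0}\frac{w(t)}{w(L^nt)}\right)^{1/n}\;\le\;\rho(C_\varphi)^2\;\le\;L\,\liminf_{n\to\infty}\left(\sup_{t>0}\frac{w(t)}{w(L^nt)}\right)^{1/n}.$$
   Context: $\mathbb{C}_+=\{z\in\mathbb{C}:\operatorname{Re}z>0\}$ is the right half-plane. Let $\nu$ be a positive regular Borel measure on $[0,\infty)$ satisfying the doubling condition $\sup_{t>0}\nu[0,2t)/\nu[0,t)<\infty$. The Zen space $A^2_\nu$ consists of all analytic $F:\mathbb{C}_+\to\mathbb{C}$ such that $$\|F\|^2=\sup_{\epsilon>0}\int_{\overline{\mathbb{C}_+}}|F(s+\epsilon)|^2\,d\nu(x)\,dy<\infty ,\qquad s=x+iy .$$ The weight corresponding to $\nu$ is $w(t)=2\pi\int_0^\infty e^{-2rt}\,d\nu(r)$ for $t>0$ (the integral being over $[0,\infty)$, including any atom of $\nu$ at $0$). The Laplace transform is an isometric isomorphism from $L^2(0,\infty,w(t)\,dt)$ onto $A^2_\nu$. The composition operator is $C_\varphi f=f\circ\varphi$. $\angle\lim_{z\to\infty}$ denotes the non-tangential limit at infinity in $\mathbb{C}_+$ (limit as $|z|\to\infty$ within every sector $|\arg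 z|\le\theta$, $\theta<\pi/2$). It is known that $C_\varphi$ is bounded on $A^2_\nu$ if and only if $L=\angle\lim_{z\to\infty}z/\varphi(z)$ exists and is finite and nonzero (it is then a positive real number). *)

(* Defs.v *)
From HB Require Import structures.
From mathcomp Require Import all_boot all_order all_algebra complex.
From mathcomp Require Import all_classical all_reals all_analysis.
Set Implicit Arguments.
Unset Strict Implicit.
Unset Printing Implicit Defensive.
Import Order.TTheory GRing.Theory Num.Theory numFieldNormedType.Exports.
Import Normc.
Local Open Scope classical_set_scope.
Local Open Scope ring_scope.
Local Open Scope complex_scope.

(* Bounded linear operators on a normed space given as the subspace [H] of an
   ambient vector space [V], with norm [N]. *)
Section operators.
Context {R : realType} {V : lmodType R[i]}.
Variables (H : set V) (N : V -> R).
Implicit Types T S : V -> V.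

Definition bounded_operator T : Prop :=
  [/\ forall v, H v -> H (T v),
      forall (a : R[i]) u v, H u -> H v -> T (a *: u + v) = a *: T u + T v
    & exists M : R, forall v, H v -> N (T v) <= M * N v].

Definition resolvent_set T : set R[i] :=
  [set l | exists2 S, bounded_operator S &
     forall v, H v -> S (T v - l *: v) = v /\ T (S v) - l *: S v = v].

Definition spectrum T : set R[i] := ~` resolvent_set T.

Definition spectral_radius T : \bar R :=
  ereal_sup [set (normc l)%:E | l in spectrum T].

End operators.

Section halfplane.
Context {R : realType}.

Definition halfplane : Type := {z : R[i] | 0 < complex.Re z}.

Definition ext0 (F : halfplane -> R[i]) (z : R[i]) : R[i] :=
  oapp F 0 (insub z).

(* The value of the extension off the open half-plane is immaterial here. *)
Definition analytic (F : halfplane -> R[i]) : Prop :=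
  forall z : halfplane, derivable (ext0 F : R[i]^o -> R[i]^o) (val z) 1.

(* On the right half-plane the principal argument is arctan (Im z / Re z). *)
Definition arg (z : halfplane) : R :=
  atan (complex.Im (val z) / complex.Re (val z)).

Definition angular_lim_infty (g : halfplane -> R[i]) (l : R[i]) : Prop :=
  forall theta : R, theta < pi / 2 -> forall e : R, 0 < e ->
  exists A : R, forall z : halfplane,
    `|arg z| <= theta -> A <= normc (val z) -> normc (g z - l) < e.

Definition composition_operator (phi : halfplane -> halfplane) (F : halfplane -> R[i]) :
  halfplane -> R[i] := F \o phi.

End halfplane.
Arguments halfplane R : clear implicits.

Section zen.
Context {R : realType}.
Variable nu : {measure set (measurableTypeR R) -> \bar R}.

(* A Borel measure on [0, oo) is represented by a Borel measure on the line
   that does not charge the negative reals. *)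
Definition regular_on_halfline : Prop :=
  [/\ nu `]-oo, 0[%classic = 0%E,
      forall K : set R, compact K -> (nu K < +oo)%E,
      forall A : set R, measurable A ->
        nu A = ereal_inf [set nu U | U in [set U : set R | open U /\ A `<=` U]]
    & forall A : set R, measurable A ->
        nu A =
        ereal_sup [set nu K | K in [set K : set R | compact K /\ K `<=` A]]].

(* The first clause makes the quotients meaningful: in [\bar R] one has
   0 / 0 = 0, so that the zero measure would satisfy the second one. *)
Definition doubling : Prop :=
  (forall t : R, 0 < t -> (0 < nu `[0%R, t[%classic)%E) /\
  (ereal_sup [set nu `[0%R, (2 * t)%R[%classic / nu `[0%R, t[%classic | t in `]0%R, +oo[%classic] < +oo)%E.

Definition zen_sqnorm (F : halfplane R -> R[i]) : \bar R :=
  ereal_sup [set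
    (\int[nu \x (@lebesgue_measure R)]_(p in `[0%R, +oo[ `*` setT)
       ((normc (ext0 F ((p.1 + eps) +i* p.2))) ^+ 2)%:E)%E | eps in `]0%R, +oo[%classic].

Definition zen_space : set (halfplane R -> R[i]) :=
  [set F | analytic F /\ (zen_sqnorm F < +oo)%E].

Definition zen_norm (F : halfplane R -> R[i]) : R :=
  Num.sqrt (fine (zen_sqnorm F)).

Definition zen_weight (t : R) : R :=
  2 * pi * \int[nu]_(r in `[0, +oo[) expR (- (2 * r * t)).

End zen.

(* Main.v *)
Require Import Defs.
From HB Require Import structures.
From mathcomp Require Import all_boot all_order all_algebra complex.
From mathcomp Require Import all_classical all_reals all_analysis.
From mathcomp Require Import measurable_realfun.
From mathcomp Require Import ring lra.
Import Order.TTheory GRing.Theory Num.Theory numFieldNormedType.Exports.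
Import Normc.
Set Implicit Arguments.
Unset Strict Implicit.
Unset Printing Implicit Defensive.
Local Open Scope classical_set_scope.
Local Open Scope ring_scope.
Local Open Scope complex_scope.


(** Two general facts about a bounded operator [T] reduce the theorem to norm
   estimates. If every [l] with [|l| >= r] lies in the resolvent set, the norms of
   the powers of [T] are [O(r ^ n)] ([resolvent_power_growth]); and if a single
   power satisfies [|| T ^ n || < |l| ^ n], then [l] lies in the resolvent set
   ([resolvent_of_small_power]). Since constants disappear under [n]-th roots, it
   remains to see that, with [lam = L ^ n], the squared norm of [T ^ n] is at most
   a constant times [lam * sup_t w t / w (lam t)] and at least a constant times
   [lam * inf_t w t / w (lam t)], where the constants do not depend on [n].

   By doubling, [w t] is comparable to the mass [V (1 / t)] of [[0, 1/t)]
   ([weight_bounds]), so the ratio of weights may be replaced by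
   [V (lam s) / V s] with [s = 1 / (lam t)]. The function [F] enters through [M_F x],
   the integral of [|F|^2] over the vertical line of abscissa [x], because the
   squared norm of [F] is the supremum over [eps] of the integrals of
   [M_F (r + eps)] against the measure.

   The upper bound. The radial limit of [z / phi_n z] is [lam]
   ([iter_radial_limit]), which forces [Re z <= lam * Re (phi_n z)] ([julia]) and
   bounds by [pi * lam] the integral along a vertical line of the Poisson kernels
   centred at the points of its image ([pker_mass]). Integrating Poisson's
   inequality for [|F|^2] along that image gives [M_(F o phi_n) x <= lam * M_F d]
   whenever [lam * d < x] ([line_sqint_comp]). As [M_F] decreases, its superlevel
   sets are initial segments, so that an inequality [V (lam s) <= K * V s] passes
   to the integrals of [M_F] ([integral_dilation_le]); this bounds the squared norm
   of the composition by [lam * K] ([zen_sq_comp]).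

   The lower bound. The function [(z + x / lam) ^ (- k)], with [k] large enough for
   the doubling constant, has a squared norm at most of order
   [(x / lam) ^ (1 - 2 k) * V (x / lam)], and for large [x] its composition with
   [phi_n] has modulus at least of order [(x / lam) ^ (- k)] at [x]. Comparing with the
   bound for point evaluations shows that [lam * V x / V (x / lam)] is at most a
   constant times the squared norm of [T ^ n] ([composition_norm_ge]).

   Point evaluations and the completeness of the space rest on the same tools:
   Goursat's theorem on rectangles yields a mean value inequality on squares
   ([square_mean]), hence boundedness on each half-plane [Re z >= x > 0]
   ([zen_bounded_right]), where Poisson's formula is then available. Finally the
   spectrum is not empty, since the ratios of weights decay at most
   geometrically ([spectrum_neq0]); this is what makes the supremum defining the
   spectral radius meaningful. *)

(** * Bisection of rectangles *)


Section bisection.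
Context {R : realType}.
Variable P : R -> R -> R -> R -> Prop.

(** Cousin's principle in the plane: a property that a rectangle inherits from its
   four quarters, and that holds for all small rectangles around each point, holds
   for the whole rectangle, since otherwise nested quarters on which it fails would
   shrink to a point. It serves both Goursat's theorem and the compactness of a
   disc of spectral parameters. *)
Lemma bisection a0 b0 c0 d0 : a0 <= b0 -> c0 <= d0 ->
  (forall a b c d, let m := (a + b) / 2 in let k := (c + d) / 2 in
     P a m c k -> P m b c k -> P a m k d -> P m b k d -> P a b c d) ->
  (forall x y, a0 <= x <= b0 -> c0 <= y <= d0 -> exists2 e, 0 < e &
     forall a b c d, a0 <= a <= x -> x <= b <= b0 -> c0 <= c <= y ->
       y <= d <= d0 -> b - a <= e -> d - c <= e -> P a b c d) ->
  P a0 b0 c0 d0.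
Proof.
move=> ab0 cd0 Psub Ploc; apply: contrapT => nP0.
pose bad (q : R * R * R * R) := ~ P q.1.1.1 q.1.1.2 q.1.2 q.2.
pose half (q q' : R * R * R * R) :=
  [/\ q.1.1.1 <= q'.1.1.1, q'.1.1.1 <= q'.1.1.2, q'.1.1.2 <= q.1.1.2 &
      q'.1.1.2 - q'.1.1.1 = (q.1.1.2 - q.1.1.1) / 2] /\
  [/\ q.1.2 <= q'.1.2, q'.1.2 <= q'.2, q'.2 <= q.2 & q'.2 - q'.1.2 = (q.2 - q.1.2) / 2].
pose wf (q : R * R * R * R) := q.1.1.1 <= q.1.1.2 /\ q.1.2 <= q.2.
have child q : {q' | wf q -> bad q -> bad q' /\ half q q'}.
  apply: cid; case: q => [[[a b] c] d].
  have [[[/= ab cd] bq]|h] := pselect (wf (a, b, c, d) /\ bad (a, b, c, d)); last first.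
    by exists (a, b, c, d) => w v; exfalso; apply: h.
  apply: contrapT => hno; apply: bq => /=.
  have key a' b' c' d' : half (a, b, c, d) (a', b', c', d') -> P a' b' c' d'.
    move=> hq; apply: contrapT => bb; apply: hno.
    by exists (a', b', c', d').
  by apply: Psub; apply: key; split; split => /=; lra.
pose q := fix q n := if n is n'.+1 then sval (child (q n')) else (a0, b0, c0, d0).
have qS n : q n.+1 = sval (child (q n)) by [].
have wfbad n : wf (q n) /\ bad (q n).
  elim: n => [//|n [w b]]; rewrite qS; case: (child (q n)) => q' /= /(_ w b)[b' [[]]].
  by move=> ? ? ? ? [? ? ? ?]; split.
have hq n : half (q n) (q n.+1).
  have [w b] := wfbad n; rewrite qS; case: (child (q n)) => q' /= /(_ w b)[b' h].
  exact: h.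
have pw n : (0 : R) < 2 ^- n by rewrite invr_gt0 exprn_gt0.
have lenx n : (q n).1.1.2 - (q n).1.1.1 = (b0 - a0) * 2 ^- n.
  elim: n => [|n ih]; first by rewrite expr0 invr1 mulr1.
  have [[_ _ _ ->] _] := hq n; rewrite ih exprS invfM; ring.
have leny n : (q n).2 - (q n).1.2 = (d0 - c0) * 2 ^- n.
  elim: n => [|n ih]; first by rewrite expr0 invr1 mulr1.
  have [_ [_ _ _ ->]] := hq n; rewrite ih exprS invfM; ring.
have lim_in (u v : nat -> R) : (forall n, u n <= u n.+1) -> (forall n, v n.+1 <= v n) ->
    (forall n, u n <= v n) -> exists x, forall n, u n <= x <= v n.
  move=> hu hv huv.
  have ndu : nondecreasing_seq u by apply/nondecreasing_seqP.
  have niv : nonincreasing_seq v by apply/nonincreasing_seqP.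
  have uv m n : u m <= v n.
    rewrite (le_trans (ndu _ _ (leq_maxl m n)))// (le_trans (huv _))//.
    exact: niv (leq_maxr m n).
  have ubu n : ubound (range u) (v n) by move=> _ [m _ <-]; exact: uv.
  exists (sup (range u)) => n; apply/andP; split.
    by apply: ub_le_sup; [exists (v 0); exact: ubu|exists n].
  by apply: ge_sup => //; exists (u 0), 0%N.
have [x hx] := lim_in (fun n => (q n).1.1.1) (fun n => (q n).1.1.2)
   (fun n => let: conj (And4 h _ _ _) _ := hq n in h)
   (fun n => let: conj (And4 _ _ h _) _ := hq n in h)
   (fun n => let: conj (conj h _) _ := wfbad n in h).
have [y hy] := lim_in (fun n => (q n).1.2) (fun n => (q n).2)
   (fun n => let: conj _ (And4 h _ _ _) := hq n in h)
   (fun n => let: conj _ (And4 _ _ h _) := hq n in h)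
   (fun n => let: conj (conj _ h) _ := wfbad n in h).
have [e e0 he] := Ploc x y (hx 0) (hy 0).
have bnd n : [/\ a0 <= (q n).1.1.1, (q n).1.1.2 <= b0, c0 <= (q n).1.2 & (q n).2 <= d0].
  elim: n => [//|n [h1 h2 h3 h4]]; have [[? ? ? _] [? ? ? _]] := hq n.
  by split; [apply: le_trans h1 _|apply: le_trans h2|apply: le_trans h3 _|apply: le_trans h4].
have [n hn] : exists n : nat, (b0 - a0 + (d0 - c0)) * 2 ^- n <= e.
  have hb : 0 <= b0 - a0 + (d0 - c0) by lra.
  pose K := Num.bound ((b0 - a0 + (d0 - c0)) / e).
  exists K; rewrite ler_pdivrMr ?exprn_gt0//.
  have : (b0 - a0 + (d0 - c0)) / e < K%:R by exact: archi_boundP (divr_ge0 hb (ltW e0)).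
  rewrite ltr_pdivrMr// => h1.
  rewrite (le_trans (ltW h1))// mulrC ler_wpM2l ?(ltW e0)//.
  by rewrite -natrX ler_nat ltnW// ltn_expl.
have [_] := wfbad n; apply; have [h1 h2 h3 h4] := bnd n.
move: (hx n) (hy n) => /andP[? ?] /andP[? ?].
have wx : 0 <= (b0 - a0) * 2 ^- n by rewrite mulr_ge0 ?subr_ge0// ltW.
have wy : 0 <= (d0 - c0) * 2 ^- n by rewrite mulr_ge0 ?subr_ge0// ltW.
by apply: he; rewrite ?lenx ?leny; try (apply/andP; split=> //); move: hn; rewrite mulrDl; lra.
Qed.

End bisection.

(** * Spectral theory of a bounded operator *)


Section normc.
Context {R : realType}.
Implicit Types z w : R[i].

Lemma normc_ge0 z : 0 <= normc z.
Proof. by case: z => a b; rewrite /normc sqrtr_ge0. Qed.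

Lemma sqr_normc_Re_Im z : normc z ^+ 2 = complex.Re z ^+ 2 + complex.Im z ^+ 2.
Proof. by case: z => a b /=; rewrite sqr_sqrtr// addr_ge0 ?sqr_ge0. Qed.

Lemma normc_Re_le z : `|complex.Re z| <= normc z.
Proof.
by rewrite -(ler_pXn2r (n := 2))// ?nnegrE ?normc_ge0// real_normK ?num_real// sqr_normc_Re_Im lerDl sqr_ge0.
Qed.

Lemma normc_Im_le z : `|complex.Im z| <= normc z.
Proof.
by rewrite -(ler_pXn2r (n := 2))// ?nnegrE ?normc_ge0// real_normK ?num_real// sqr_normc_Re_Im lerDr sqr_ge0.
Qed.

Lemma normc_le_Re_Im z : normc z <= `|complex.Re z| + `|complex.Im z|.
Proof.
rewrite -(ler_pXn2r (n := 2))// ?nnegrE ?normc_ge0 ?addr_ge0// sqr_normc_Re_Im.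
rewrite -(real_normK (num_real (complex.Re z))) -(real_normK (num_real (complex.Im z))).
have := normr_ge0 (complex.Re z); have := normr_ge0 (complex.Im z); nra.
Qed.

Lemma normc_real (x : R) : normc x%:C = `|x|.
Proof. by rewrite /normc /= expr0n /= addr0 sqrtr_sqr. Qed.

Lemma normcX z n : normc (z ^+ n) = normc z ^+ n.
Proof. by elim: n => [|n ih]; rewrite ?expr0 ?normc1// !exprS normcM ih. Qed.

Lemma normc_eq0 z : (normc z == 0) = (z == 0).
Proof. by apply/eqP/eqP => [/eq0_normc//|->]; rewrite normc0. Qed.

Lemma normc_gt0 z : (0 < normc z) = (z != 0).
Proof. by rewrite lt_def normc_eq0 normc_ge0 andbT. Qed.

Lemma le_normcB z w : normc (z - w) <= normc z + normc w.
Proof. by rewrite (le_trans (le_normcD _ _))// normcN. Qed.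

Lemma le_normc_sub z w : normc z <= normc w + normc (z - w).
Proof. by rewrite (le_trans _ (le_normcD _ _))// addrCA subrr addr0. Qed.

(** Iterated square roots give such a root; halving the exponent in this way is
   what makes powers of two convenient below. *)
Lemma exists_root_N1 k : exists2 z : R[i], normc z = 1 & z ^+ (2 ^ k) = -1.
Proof.
have [z hz] : exists z : R[i], z ^+ (2 ^ k) = -1.
  elim: k => [|k [z hz]]; first by exists (-1).
  by exists (sqrtc z); rewrite expnS exprM sqr_sqrtc.
exists z => //; have h : normc z ^+ (2 ^ k) = 1 by rewrite -normcX hz normcN normc1.
by apply/eqP; rewrite -(pexpr_eq1 (n := 2 ^ k)) ?expn_gt0// ?normc_ge0// h.
Qed.

End normc.

(** The subspace [H] carries a seminorm [N]; that it is a norm and complete comes in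
   only with the Neumann series at the end. *)
Section gelfand.
Context {R : realType} {V : lmodType R[i]}.
Variables (H : set V) (N : V -> R).
Hypothesis H0 : H 0.
Hypothesis HL : forall (a : R[i]) u v, H u -> H v -> H (a *: u + v).
Hypothesis N0 : forall v, H v -> 0 <= N v.
Hypothesis ND : forall u v, H u -> H v -> N (u + v) <= N u + N v.
Hypothesis NZ : forall (a : R[i]) u, H u -> N (a *: u) = normc a * N u.

Lemma subspaceZ a u : H u -> H (a *: u).
Proof. by move=> hu; rewrite -[_ *: _]addr0; exact: HL. Qed.

Lemma subspaceD u v : H u -> H v -> H (u + v).
Proof. by move=> hu hv; rewrite -[u]scale1r; exact: HL. Qed.

Lemma subspaceB u v : H u -> H v -> H (u - v).
Proof. by move=> hu hv; rewrite -scaleN1r addrC; exact: HL. Qed.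

Lemma seminormN u : H u -> N (- u) = N u.
Proof. by move=> hu; rewrite -scaleN1r NZ// normcN normc1 mul1r. Qed.

Lemma seminormB u v : H u -> H v -> N (u - v) <= N u + N v.
Proof.
by move=> hu hv; rewrite (le_trans (ND hu _))// ?seminormN// -scaleN1r; exact: subspaceZ.
Qed.

Lemma seminorm0 : N 0 = 0.
Proof. by have := NZ 0 H0; rewrite scale0r normc0 mul0r. Qed.

Section operator.
Variable T : V -> V.
Hypothesis bT : bounded_operator H N T.

Lemma operatorH v : H v -> H (T v). Proof. by case: bT => h _ _; exact: h. Qed.

Lemma operatorD u v : H u -> H v -> T (u + v) = T u + T v.
Proof. by move=> hu hv; case: bT => _ h _; have := h 1 u v hu hv; rewrite !scale1r. Qed.

Lemma operator0 : T 0 = 0.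
Proof. by have := operatorD H0 H0; rewrite addr0 -[LHS]addr0 => /addrI. Qed.

Lemma operatorZ a u : H u -> T (a *: u) = a *: T u.
Proof. by move=> hu; case: bT => _ h _; have := h a u 0 hu H0; rewrite !addr0 operator0 addr0. Qed.

Lemma operatorB u v : H u -> H v -> T (u - v) = T u - T v.
Proof.
move=> hu hv; rewrite -[in LHS](scaleN1r v) operatorD ?operatorZ ?scaleN1r//.
by rewrite -scaleN1r; exact: subspaceZ.
Qed.

Lemma operator_bound : exists2 B, 0 <= B & forall v, H v -> N (T v) <= B * N v.
Proof.
case: bT => _ _ [M hM]; exists (Num.max 0 M); first by rewrite le_max lexx.
move=> v hv; apply: le_trans (hM v hv) _; apply: ler_wpM2r; first exact: N0.
by rewrite le_max lexx orbT.
Qed.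

End operator.

Lemma bounded_operator_iter T n : bounded_operator H N T ->
  bounded_operator H N (iter n T).
Proof.
move=> bT; elim: n => [|n [h1 h2 [M hM]]].
  by split => //; exists 1 => v _; rewrite mul1r.
have [B B0 hB] := operator_bound bT.
split.
- by move=> v /h1 hv; exact: (operatorH bT hv).
- move=> a u v hu hv; rewrite /= h2// (operatorD bT); first by rewrite (operatorZ bT)//; exact: h1.
  + by apply: subspaceZ; exact: h1.
  + exact: h1.
- exists (B * M) => v hv /=; rewrite (le_trans (hB _ (h1 _ hv)))// -mulrA.
  by rewrite ler_wpM2l// hM.
Qed.

Section spectral.
Variable T : V -> V.
Hypothesis bT : bounded_operator H N T.

Let bTn n := bounded_operator_iter n bT.

Let bdd s M := forall u, H u -> N u <= M * N (u - s *: T u).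
Let srj s := forall v, H v -> exists2 u, H u & u - s *: T u = v.

Let resolventP r s : 0 < r -> (forall l, r <= normc l -> resolvent_set H N T l) ->
  normc s <= r^-1 -> srj s /\ exists2 M, 0 <= M & bdd s M.
Proof.
move=> r0 hres hs; have [->|s0] := eqVneq s 0.
  split; first by move=> v hv; exists v => //; rewrite scale0r subr0.
  by exists 1 => // u hu; rewrite scale0r subr0 mul1r.
have s0' : 0 < normc s by rewrite normc_gt0.
have [S bS hS] : resolvent_set H N T s^-1.
  by apply: hres; rewrite normcV -[r]invrK lef_pV2 ?posrE ?invr_gt0.
split.
  move=> v hv; exists (- s^-1 *: S v); first exact/subspaceZ/(operatorH bS).
  have [_ h2] := hS v hv.
  rewrite (operatorZ bT); last exact: (operatorH bS).
  by rewrite scalerA mulrN mulfV// scaleN1r opprK addrC scaleNr.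
have [B B0 hB] := operator_bound bS.
exists (B * normc s^-1); first by rewrite mulr_ge0 ?normc_ge0.
move=> u hu; have [h1 _] := hS u hu.
rewrite -{1}h1 (le_trans (hB _ _))//.
  by apply: subspaceB; [exact: (operatorH bT)|exact: subspaceZ].
rewrite -mulrA ler_wpM2l// -NZ; last by apply: subspaceB => //; apply/subspaceZ/(operatorH bT).
rewrite scalerBr scalerA mulVf// scale1r -opprB seminormN//.
by apply: subspaceB; [exact: subspaceZ|exact: (operatorH bT)].
Qed.

(** The inverses of [1 - s T] are uniformly bounded on the disc [|s| <= 1 / r]:
   each is bounded near a given point of the disc, and [bisection] replaces
   compactness. *)
Let uniform_bound r : 0 < r -> (forall l, r <= normc l -> resolvent_set H N T l) ->
  exists2 M, 0 <= M & forall s, normc s <= r^-1 -> bdd s M.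
Proof.
move=> r0 hres; have [B B0 hB] := operator_bound bT.
pose P a b c d := exists2 M, 0 <= M & forall x y, a <= x <= b -> c <= y <= d ->
  normc (x +i* y) <= r^-1 -> bdd (x +i* y) M.
have s0 : 0 <= r^-1 by rewrite invr_ge0 ltW.
suff [M M0 hM] : P (- r^-1) r^-1 (- r^-1) r^-1.
  exists M => // -[x y] hs; apply: hM => //; rewrite -ler_norml.
    exact: le_trans (normc_Re_le (x +i* y)) hs.
  exact: le_trans (normc_Im_le (x +i* y)) hs.
apply: bisection; [lra|lra| |].
  move=> a b c d m k [M1 p1 h1] [M2 p2 h2] [M3 p3 h3] [M4 p4 h4].
  exists (M1 + M2 + (M3 + M4)); first by rewrite !addr_ge0.
  move=> x y /andP[ax xb] /andP[cy yd] hs u hu.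
  have hd : H (u - (x +i* y) *: T u).
    by apply: subspaceB => //; apply/subspaceZ/(operatorH bT).
  have mono M : M <= M1 + M2 + (M3 + M4) -> bdd (x +i* y) M ->
      N u <= (M1 + M2 + (M3 + M4)) * N (u - (x +i* y) *: T u).
    by move=> hM /(_ u hu) h; rewrite (le_trans h)// ler_wpM2r// N0.
  have [xm|mx] := leP x m; have [yk|ky] := leP y k.
  - by apply: (mono M1); [lra|apply: h1 => //; apply/andP; split].
  - by apply: (mono M3); [lra|apply: h3 => //; apply/andP; split=> //; exact: ltW].
  - by apply: (mono M2); [lra|apply: h2 => //; apply/andP; split=> //; exact: ltW].
  - by apply: (mono M4); [lra|apply: h4 => //; apply/andP; split=> //; exact: ltW].
move=> x y _ _.
have dist a b c d e x' y' : a <= x -> x <= b -> c <= y -> y <= d -> b - a <= e -> d - c <= e ->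
    a <= x' <= b -> c <= y' <= d -> normc ((x +i* y) - (x' +i* y')) <= 2 * e.
  move=> ? ? ? ? ? ? /andP[? ?] /andP[? ?].
  rewrite (le_trans (normc_le_Re_Im _))//=.
  have : `|x - x'| <= e by rewrite ler_norml; lra.
  have : `|y - y'| <= e by rewrite ler_norml; lra.
  lra.
have [hs|hs] := leP (normc (x +i* y)) r^-1; last first.
  exists ((normc (x +i* y) - r^-1) / 4); first by rewrite divr_gt0// subr_gt0.
  move=> a b c d /andP[_ ax] /andP[xb _] /andP[_ cy] /andP[yd _] hab hcd.
  exists 0 => // x' y' hx' hy' hs'.
  have := le_normc_sub (x +i* y) (x' +i* y').
  have := dist a b c d _ x' y' ax xb cy yd hab hcd hx' hy'.
  lra.
have [_ [M M0 hM]] := resolventP r0 hres hs.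
exists (4^-1 / ((M + 1) * (B + 1))); first by rewrite divr_gt0// mulr_gt0; lra.
move=> a b c d /andP[_ ax] /andP[xb _] /andP[_ cy] /andP[yd _] hab hcd.
exists (2 * M); first lra.
move=> x' y' hx' hy' hs' u hu.
have h2 := dist a b c d _ x' y' ax xb cy yd hab hcd hx' hy'.
set s := x +i* y in hM h2 *; set s' := x' +i* y' in h2 *.
have hTu := operatorH bT hu.
have e1 : u - s *: T u = (u - s' *: T u) - (s - s') *: T u.
  by rewrite scalerBl opprB addrA subrK.
have h3 : N (u - s *: T u) <= N (u - s' *: T u) + normc (s - s') * (B * N u).
  rewrite e1 (le_trans (seminormB _ _))//.
  - by apply: subspaceB => //; exact: subspaceZ.
  - exact: subspaceZ.
  by rewrite NZ// lerD2l ler_wpM2l ?normc_ge0// hB.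
have h4 : M * (normc (s - s') * (B * N u)) <= N u / 2.
  have MB : 0 < (M + 1) * (B + 1) by rewrite mulr_gt0; lra.
  have h5 : (M + 1) * (B + 1) * normc (s - s') <= 2^-1.
    rewrite -ler_pdivlMl// (le_trans h2)//; lra.
  have h6 : M * B * normc (s - s') <= 2^-1.
    rewrite (le_trans _ h5)// ler_wpM2r ?normc_ge0//; nra.
  have := ler_wpM2r (N0 hu) h6; lra.
have := le_trans (hM u hu) (ler_wpM2l M0 h3); rewrite mulrDr; lra.
Qed.

(** The power [(s T) ^ (2 ^ k)]. Everything about [1 - Y k.+1 s] is obtained from
   [1 - Y k.+1 s = (1 - Y k s) (1 + Y k s)], where [1 + Y k s = 1 - Y k (z * s)] for
   a unimodular [z]: the inverse of [1 - Y k.+1 s] is the mean of the inverses of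
   [1 - Y k s] and [1 - Y k (z * s)]. *)
Let Y k s u := s ^+ (2 ^ k) *: iter (2 ^ k) T u.

Let YH k s u : H u -> H (Y k s u).
Proof. by move=> hu; apply/subspaceZ/(operatorH (bTn _)). Qed.

Let YS k s u : H u -> Y k s (Y k s u) = Y k.+1 s u.
Proof.
move=> hu; rewrite /Y (operatorZ (bTn _)); last exact: (operatorH (bTn _)).
by rewrite scalerA -exprD -iterD addnn -muln2 expnSr.
Qed.

Let YD k s u v : H u -> H v -> Y k s (u + v) = Y k s u + Y k s v.
Proof. by move=> hu hv; rewrite /Y (operatorD (bTn _))// scalerDr. Qed.

Let YB k s u v : H u -> H v -> Y k s (u - v) = Y k s u - Y k s v.
Proof. by move=> hu hv; rewrite /Y (operatorB (bTn _))// scalerBr. Qed.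

Let YN k : exists2 z : R[i], normc z = 1 & forall s u, Y k (z * s) u = - Y k s u.
Proof.
have [z z1 hz] := @exists_root_N1 R k.
by exists z => // s u; rewrite /Y exprMn hz mulN1r scaleNr.
Qed.

Let halfsum (u v : V) : u = 2^-1 *: ((u + v) + (u - v)).
Proof.
by rewrite addrACA subrr addr0 -mulr2n -(scaler_nat 2 u) scalerA mulVf ?pnatr_eq0// scale1r.
Qed.

Let half_bound (u v : V) c : H u -> H v -> N u <= c -> N v <= c -> N (2^-1 *: (u + v)) <= c.
Proof.
move=> hu hv uc vc; rewrite NZ; last exact: subspaceD.
have -> : normc (2^-1 : R[i]) = 2^-1.
  by rewrite normcV (_ : 2 = (2 : R)%:C) ?normc_real ?ger0_norm// rmorph_nat.
have := ND hu hv; lra.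
Qed.

(** Being means of inverses at the previous stage, the inverses of
   [1 - (s T) ^ (2 ^ k)] obey the same bound [M] for all [k]. *)
Let power_bound M r : (forall s, normc s <= r -> srj s) -> (forall s, normc s <= r -> bdd s M) ->
  forall k s, normc s <= r ->
   (forall v, H v -> exists2 u, H u & u - Y k s u = v) /\
   (forall u, H u -> N u <= M * N (u - Y k s u)).
Proof.
move=> hsrj hbdd; elim=> [|k ih] s hs.
  by split; [exact: hsrj|exact: hbdd].
have [z z1 hz] := YN k.
have hzs : normc (z * s) <= r by rewrite normcM z1 mul1r.
have [s1 b1] := ih s hs; have [s2 b2] := ih _ hzs.
split=> [v /s1[a ha <-]|u hu]; last have hY : H (Y k s u) by exact: YH.
  have [u hu <-] := s2 a ha; exists u => //; have hY : H (Y k s u) by exact: YH.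
  by rewrite hz opprK YD// YS// opprD addrA addrK.
rewrite (halfsum u (Y k s u)).
have hp : H (u + Y k s u) by exact: subspaceD.
have hm : H (u - Y k s u) by exact: subspaceB.
apply: half_bound => //.
  rewrite (le_trans (b1 _ hp))// YD// YS// opprD addrA addrK.
  by rewrite -halfsum.
rewrite (le_trans (b2 _ hm))// hz opprK YB// YS// addrA subrK.
by rewrite -halfsum.
Qed.

(** In the same way, the distance [d] between the inverses of [1 - s T] and
   [1 - t s T] is inherited by the inverses of [1 - Y k s] and [1 - Y k (t * s)]. *)
Let power_diff M r d t : 0 <= M -> (forall s, normc s <= r -> srj s) ->
  (forall s, normc s <= r -> bdd s M) ->
  (forall s u u' , normc s <= r -> normc (t * s) <= r -> H u -> H u' ->
     u - s *: T u = u' - (t * s) *: T u' -> N (u - u') <= d * N (u - s *: T u)) ->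
  forall k s u u', normc s <= r -> normc (t * s) <= r -> H u -> H u' ->
    u - Y k s u = u' - Y k (t * s) u' -> N (u - u') <= d * N (u - Y k s u).
Proof.
move=> M0 hsrj hbdd h0; elim=> [|k ih] s u u' hs hts hu hu' e; first exact: h0.
have [z z1 hz] := YN k.
have hzs : normc (z * s) <= r by rewrite normcM z1 mul1r.
have hzts : normc (t * (z * s)) <= r by rewrite mulrCA normcM z1 mul1r.
have hY : H (Y k s u) by exact: YH.
have hY' : H (Y k (t * s) u') by exact: YH.
have hz' : Y k (t * (z * s)) (u' - Y k (t * s) u') = - Y k (t * s) (u' - Y k (t * s) u').
  by rewrite mulrCA hz.
rewrite {1}(halfsum u (Y k s u)) {1}(halfsum u' (Y k (t * s) u')) -scalerBr opprD addrACA.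
have hp : H (u + Y k s u) by exact: subspaceD.
have hm : H (u - Y k s u) by exact: subspaceB.
have hp' : H (u' + Y k (t * s) u') by exact: subspaceD.
have hm' : H (u' - Y k (t * s) u') by exact: subspaceB.
have ep : u + Y k s u - Y k s (u + Y k s u) = u - Y k.+1 s u.
  by rewrite YD// YS// opprD addrA addrK.
have ep' : u' + Y k (t * s) u' - Y k (t * s) (u' + Y k (t * s) u') = u' - Y k.+1 (t * s) u'.
  by rewrite YD// YS// opprD addrA addrK.
have em : u - Y k s u - Y k (z * s) (u - Y k s u) = u - Y k.+1 s u.
  by rewrite hz opprK YB// YS// addrA subrK.
have em' : u' - Y k (t * s) u' - Y k (t * (z * s)) (u' - Y k (t * s) u') = u' - Y k.+1 (t * s) u'.
  by rewrite hz' opprK YB// YS// addrA subrK.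
apply: half_bound; [exact: subspaceB|exact: subspaceB| |].
  by rewrite -ep; apply: ih => //; rewrite ep ep'.
by rewrite -em; apply: ih => //; rewrite em em'.
Qed.

(** A step along a ray: if a high power of [t s T] is small, then so is a high power
   of [s T], since the inverses of [1 - Y k (t * s)] and [1 - Y k s] are close
   uniformly in [k]. *)
Let contraction_step M r d s t k : 0 <= M -> (forall s, normc s <= r -> srj s) ->
  (forall s, normc s <= r -> bdd s M) -> 0 <= d <= 1 / 8 ->
  (forall s u u' , normc s <= r -> normc (t * s) <= r -> H u -> H u' ->
     u - s *: T u = u' - (t * s) *: T u' -> N (u - u') <= d * N (u - s *: T u)) ->
  normc s <= r -> normc (t * s) <= r ->
  (forall u, H u -> N (Y k (t * s) u) <= 1 / 2 * N u) ->
  exists k', forall u, H u -> N (Y k' s u) <= 1 / 2 * N u.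
Proof.
move=> M0 hsrj hbdd /andP[d0 d8] h0 hs hts hk.
have sq k1 c : 0 <= c -> (forall u, H u -> N (Y k1 (t * s) u) <= c * N u) ->
    forall u, H u -> N (Y k1.+1 (t * s) u) <= (c * c) * N u.
  move=> c0 hc u hu; rewrite -YS// (le_trans (hc _ (YH _ _ hu)))// -mulrA ler_wpM2l//.
  exact: hc.
(* squaring twice makes the contraction factor [1 / 16], which leaves room for the
   perturbation [d <= 1 / 8] *)
have h4 := sq _ _ _ (sq _ _ _ hk).
exists k.+2 => x hx.
pose v := x - Y k.+2 s x.
have hv : H v by apply: subspaceB => //; exact: YH.
have [srjk _] := power_bound hsrj hbdd k.+2 hts.
have [u hu huv] := srjk v hv.
have h1 : N (x - u) <= d * N v by apply: (power_diff M0 hsrj hbdd h0) => //; rewrite huv.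
have h2 : N (u - v) <= 1 / 2 * (1 / 2) * (1 / 2 * (1 / 2)) * N u.
  rewrite -huv opprB addrC subrK; apply: h4 => //; lra.
have e : Y k.+2 s x = (x - u) + (u - v) by rewrite addrA subrK /v opprB addrC subrK.
have h3 : N (Y k.+2 s x) <= N (x - u) + N (u - v).
  by rewrite {1}e ND//; exact: subspaceB.
have h5 : N v <= N x + N (Y k.+2 s x) by apply: seminormB => //; exact: YH.
have h6 : N u <= N v + N (u - v).
  by rewrite -{1}(subrK v u) addrC ND//; exact: subspaceB.
have := N0 hv; have := N0 hx; have := N0 hu; have := N0 (YH k.+2 s hx); nra.
Qed.

(** This is the half of Gelfand's formula that bounds powers by the spectral
   radius, proved by Rickart's method. One goes from [s = 0],
   where all powers vanish, to [s = 1 / r] in finitely many steps of equal length,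
   each covered by [contraction_step]; the uniform bound on the inverses keeps the
   step length fixed. *)
Lemma resolvent_power_growth r : 0 < r ->
  (forall l, r <= normc l -> resolvent_set H N T l) ->
  exists2 C, 0 <= C & forall n v, H v -> N (iter n T v) <= C * r ^+ n * N v.
Proof.
move=> r0 hres; have [B B0 hB] := operator_bound bT.
have [M M0 hbdd] := uniform_bound r0 hres.
have hsrj s : normc s <= r^-1 -> srj s by move=> hs; case: (resolventP r0 hres hs).
have s0 : 0 < r^-1 by rewrite invr_gt0.
(* inverses at consecutive points of the subdivision differ by at most [1 / 8] *)
pose J := (Num.bound (8 * (M * M * B * r^-1))).+1.
have J0 : (0 : R) < J%:R by rewrite ltr0n.
have hJ : M * M * B * (r^-1 / J%:R) <= 1 / 8.
  rewrite mulrA ler_pdivrMr//.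
  have : 8 * (M * M * B * r^-1) < J%:R.
    rewrite (lt_le_trans (archi_boundP _))// ?ler_nat//.
    by rewrite mulr_ge0// !mulr_ge0// ltW.
  by lra.
clearbody J.
pose sj j : R[i] := (j%:R * (r^-1 / J%:R))%:C.
have nsj j : normc (sj j) = j%:R * (r^-1 / J%:R).
  by rewrite normc_real ger0_norm//; apply: mulr_ge0 => //; apply: divr_ge0 => //; exact: ltW.
have nsjr j : (j <= J)%N -> normc (sj j) <= r^-1.
  by move=> jJ; rewrite nsj mulrCA ler_piMr ?(ltW s0)// ler_pdivrMr// mul1r ler_nat.
have main j : (j <= J)%N -> exists k, forall u, H u -> N (Y k (sj j) u) <= 1 / 2 * N u.
  elim: j => [_|j ih jJ].
    exists 0%N => u hu; rewrite /Y /sj mul0r expr1 scale0r seminorm0.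
    by have := N0 hu; lra.
  have [k hk] := ih (ltnW jJ).
  pose t : R[i] := (j%:R / j.+1%:R)%:C.
  have hst : t * sj j.+1 = sj j.
    rewrite /t /sj -rmorphM/=; congr (_%:C).
    by rewrite -mulrA mulKf// pnatr_eq0.
  apply: (@contraction_step M (normc (sj j.+1)) (M * M * B * (r^-1 / J%:R)) (sj j.+1) t k).
  - exact: M0.
  - by move=> s hs; apply: hsrj; rewrite (le_trans hs)// nsjr.
  - by move=> s hs; apply: hbdd; rewrite (le_trans hs)// nsjr.
  - by apply/andP; split=> //; rewrite !mulr_ge0// ?invr_ge0// ltW.
  - move=> s u u' hs hts hu hu' e.
    have hD : H (u - u') by exact: subspaceB.
    have hT : H (T u') by exact: (operatorH bT).
    have e1 : (u - u') - s *: T (u - u') = (s - t * s) *: T u'.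
      rewrite (operatorB bT)// scalerBr scalerBl opprB.
      rewrite [s *: T u' - _]addrC addrACA e addrACA subrr add0r addrC //.
    have hs' : normc s <= r^-1 by rewrite (le_trans hs)// nsjr.
    have hts' : normc (t * s) <= r^-1 by rewrite (le_trans hts)// nsjr.
    have h1 := hbdd _ hs' _ hD; rewrite e1 NZ// in h1.
    have h2 := hbdd _ hts' _ hu'.
    have h3 : normc (s - t * s) <= r^-1 / J%:R.
      have -> : s - t * s = (1 - t) * s by rewrite mulrBl mul1r.
      have -> : 1 - t = (j.+1%:R^-1 : R)%:C.
        rewrite /t -[1]/(1%:C) -rmorphB/=; congr (_%:C).
        have h : j.+1%:R != 0 :> R by rewrite pnatr_eq0.
        by apply: (mulIf h); rewrite mulVf// mulrBl divfK// mul1r -natr1 addrC addKr.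
      rewrite normcM normc_real ger0_norm ?invr_ge0// ler_pdivrMl ?ltr0n//.
      by rewrite (le_trans hs)// nsj.
    rewrite (le_trans h1)// e -!mulrA ler_wpM2l// mulrCA.
    have h4 := le_trans (hB _ hu') (ler_wpM2l B0 h2).
    rewrite (le_trans (ler_pM _ _ h3 h4))// ?normc_ge0 ?N0//.
    by rewrite le_eqVlt; apply/orP; left; apply/eqP; ring.
  - exact: lexx.
  - by rewrite hst !nsj; apply: ler_wpM2r; [apply: divr_ge0; exact: ltW|rewrite ler_nat].
  - by rewrite hst.
have [k hk] := main J (leqnn _).
have hsJ : sj J = (r^-1)%:C.
  by rewrite /sj; congr (_%:C); field; rewrite !lt0r_neq0.
pose n := (2 ^ k)%N; have n0 : (0 < n)%N by rewrite expn_gt0.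
have rn m : 0 <= r ^+ m by rewrite exprn_ge0// ltW.
have hn u : H u -> N (iter n T u) <= r ^+ n * N u.
  move=> hu; have := hk u hu; rewrite hsJ /Y NZ; last exact: (operatorH (bTn _)).
  rewrite normcX normc_real ger0_norm; last exact: ltW.
  rewrite -/n exprVn ler_pdivrMl ?exprn_gt0//.
  move/le_trans; apply; rewrite ler_wpM2l//.
  by have := N0 hu; lra.
have hna a u : H u -> N (iter (a * n) T u) <= r ^+ (a * n) * N u.
  move=> hu; elim: a => [|a ih]; first by rewrite mul0n expr0 mul1r.
  rewrite mulSn iterD (le_trans (hn _ _))//; first exact: (operatorH (bTn _)).
  by rewrite exprD -mulrA ler_wpM2l.
have hb b u : H u -> N (iter b T u) <= B ^+ b * N u.
  move=> hu; elim: b => [|b ih]; first by rewrite expr0 mul1r.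
  rewrite iterS (le_trans (hB _ _))//; first exact: (operatorH (bTn _)).
  by rewrite exprS -mulrA ler_wpM2l.
exists ((1 + B * r^-1) ^+ n).
  by rewrite exprn_ge0// addr_ge0// mulr_ge0// ltW.
move=> m v hv; rewrite {1}(divn_eq m n) addnC iterD.
rewrite (le_trans (hb _ _ _))//; first exact: (operatorH (bTn _)).
rewrite (le_trans (ler_wpM2l _ (hna _ _ hv)))// ?exprn_ge0//.
rewrite mulrA ler_wpM2r ?N0//.
rewrite [in X in _ <= X](divn_eq m n) [(_ + m %% n)%N]addnC exprD mulrA.
rewrite ler_wpM2r// -ler_pdivrMr ?exprn_gt0// -exprVn -exprMn.
apply: (@le_trans _ _ ((1 + B * r^-1) ^+ (m %% n))).
  by apply: lerXn2r; rewrite ?nnegrE ?addr_ge0 ?mulr_ge0// ?lerDr// ltW.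
apply: ler_weXn2l; first by rewrite lerDl mulr_ge0// ltW.
by rewrite ltnW// ltn_mod.
Qed.

Hypothesis Ndef : forall v, H v -> N v = 0 -> v = 0.
Hypothesis Hcomplete : forall (u : nat -> V) c q, 0 <= q < 1 -> (forall n, H (u n)) ->
  (forall n, N (u n.+1 - u n) <= c * q ^+ n) ->
  exists2 x, H x & forall n, N (x - u n) <= c * q ^+ n / (1 - q).

Let resolvent_of_bijective l C :
  (forall w, H w -> exists2 x, H x & T x - l *: x = w /\ N x <= C * N w) ->
  (forall v, H v -> T v = l *: v -> v = 0) -> resolvent_set H N T l.
Proof.
move=> hsrj hinj.
have hS w : {x | H w -> H x /\ T x - l *: x = w /\ N x <= C * N w}.
  apply: cid; have [hw|hw] := pselect (H w); last by exists 0 => /hw.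
  by have [x hx [h1 h2]] := hsrj w hw; exists x.
pose S w := sval (hS w).
have SP w : H w -> [/\ H (S w), T (S w) - l *: S w = w & N (S w) <= C * N w].
  by move=> hw; rewrite /S; case: (hS w) => x /= /(_ hw)[? [? ?]].
have uniq x y : H x -> H y -> T x - l *: x = T y - l *: y -> x = y.
  move=> hx hy e; apply/eqP; rewrite -subr_eq0; apply/eqP/hinj; first exact: subspaceB.
  have -> : T (x - y) = T y - l *: y + l *: x - T y by rewrite (operatorB bT)// -e subrK.
  by rewrite addrAC [T y - _]addrC addrK addrC scalerBr.
have hTl v : H v -> H (T v - l *: v).
  by move=> hv; apply: subspaceB; [exact: (operatorH bT)|exact: subspaceZ].
exists S.
  split; [by move=> w /SP[]| |by exists C => w /SP[]].
  move=> a u v hu hv; have [hu1 hu2 _] := SP u hu; have [hv1 hv2 _] := SP v hv.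
  have hw : H (a *: u + v) by exact: HL.
  have [hw1 hw2 _] := SP _ hw.
  apply: uniq => //; first exact: HL.
  rewrite hw2 (operatorD bT)//; last exact: subspaceZ.
  rewrite (operatorZ bT)// scalerDr opprD addrACA hv2; congr (_ + _).
  by rewrite scalerA mulrC -scalerA -scalerBr hu2.
move=> v hv; split; last by have [] := SP v hv.
by have [h1 h2 _] := SP _ (hTl v hv); exact: uniq.
Qed.

(** Write [A = T ^ n / l ^ n], a strict contraction. The Neumann series inverts
   [1 - A], and [T ^ n - l ^ n] factors through [T - l]; the other factor is
   [P n] below. *)
Lemma resolvent_of_small_power l n q : 0 <= q < 1 -> l != 0 ->
  (forall v, H v -> N (iter n T v) <= q * normc l ^+ n * N v) -> resolvent_set H N T l.
Proof.
move=> q01 l0 hq; have [q0 q1] := andP q01.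
have nl0 : 0 < normc l by rewrite normc_gt0.
pose A v := l ^- n *: iter n T v.
have AH v : H v -> H (A v) by move=> hv; apply/subspaceZ/(operatorH (bTn _)).
have AB u v : H u -> H v -> A (u - v) = A u - A v.
  by move=> hu hv; rewrite /A (operatorB (bTn _))// scalerBr.
have NA v : H v -> N (A v) <= q * N v.
  move=> hv; rewrite NZ; last exact: (operatorH (bTn _)).
  rewrite normcV normcX ler_pdivrMl ?exprn_gt0//.
  by rewrite (le_trans (hq _ hv))// le_eqVlt; apply/orP; left; apply/eqP; ring.
have solve v : H v -> exists2 x, H x & x - A x = v /\ N x <= (1 - q)^-1 * N v.
  move=> hv; pose p := fix p k := if k is k'.+1 then v + A (p k') else 0.
  have pH k : H (p k) by elim: k => //= k ih; apply: subspaceD => //; exact: AH.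
  have hp k : N (p k.+1 - p k) <= N v * q ^+ k.
    elim: k => [|k ih].
      by rewrite /= /A (operator0 (bTn _)) scaler0 addr0 subr0 mulr1.
    rewrite [p k.+2]/= [X in _ - X]/= opprD addrACA subrr add0r -(AB _ _ (pH k.+1) (pH k)).
    apply: le_trans (NA _ (subspaceB (pH k.+1) (pH k))) _.
    by rewrite exprS mulrCA ler_wpM2l.
  have [x hx hxp] := Hcomplete q01 pH hp.
  exists x => //; split; last first.
    have := hxp 0%N; rewrite /= subr0 expr0 mulr1 => h.
    by rewrite mulrC.
  have hd : H (x - A x - v) by apply: subspaceB => //; apply: subspaceB => //; exact: AH.
  apply/eqP; rewrite -subr_eq0; apply/eqP/Ndef => //.
  apply/eqP; rewrite eq_le N0// andbT.
  have bound k : N (x - A x - v) <= (2 * N v / (1 - q)) * q ^+ k.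
    have e : x - A x - v = (x - p k.+1) - A (x - p k).
      by rewrite AB// /= opprB opprD !addrA subrK addrAC.
    rewrite e (le_trans (seminormB _ _))//.
    - exact: subspaceB.
    - by apply: AH; exact: subspaceB.
    have h1 := hxp k.+1; have h2 := NA _ (subspaceB hx (pH k)); have h3 := hxp k.
    have h4 : N v * q ^+ k.+1 / (1 - q) <= N v * q ^+ k / (1 - q).
      rewrite ler_wpM2r ?invr_ge0 ?subr_ge0 ?(ltW q1)// ler_wpM2l ?N0// exprS.
      by rewrite ler_piMl ?exprn_ge0// ltW.
    have h5 : q * N (x - p k) <= N (x - p k).
      by rewrite ler_piMl ?N0 ?(ltW q1)//; exact: subspaceB.
    rewrite (_ : 2 * _ / _ * _ = N v * q ^+ k / (1 - q) + N v * q ^+ k / (1 - q)); last by ring.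
    lra.
  apply/ler_addgt0Pr => e e0; rewrite add0r.
  have cv : (fun k => (2 * N v / (1 - q)) * q ^+ k) @ \oo --> (0 : R).
    by apply: cvg_geometric; rewrite ger0_norm.
  have /cvgrPdist_le/(_ e e0)[k _ /(_ k (leqnn _))] := cv.
  rewrite sub0r normrN => h; rewrite (le_trans (bound k))//.
  exact: le_trans (ler_norm _) h.
pose P := fix P k y := if k is k'.+1 then T (P k' y) + l ^+ k' *: y else 0.
have PH k y : H y -> H (P k y).
  move=> hy; elim: k => //= k ih; apply: subspaceD; first exact: (operatorH bT).
  exact: subspaceZ.
have Pfactor k y : H y -> T (P k y) - l *: P k y = iter k T y - l ^+ k *: y.
  move=> hy; elim: k => [|k ih]; first by rewrite /= (operator0 bT) scaler0 scale1r !subrr.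
  have hP := PH k y hy; have hTP : H (T (P k y)) by exact: (operatorH bT).
  have hly : H (l ^+ k *: y) by exact: subspaceZ.
  rewrite [P k.+1 y]/= (operatorD bT)// (operatorZ bT)// scalerDr opprD addrACA.
  rewrite -(operatorZ bT l hP) -(operatorB bT hTP (subspaceZ l hP)).
  rewrite ih (operatorB bT)//; last exact: (operatorH (bTn _)).
  rewrite (operatorZ bT)// scalerA -exprS addrA subrK//.
have [B B0 hB] := operator_bound bT.
have Pbound k : exists2 c, 0 <= c & forall y, H y -> N (P k y) <= c * N y.
  elim: k => [|k [c c0 hc]]; first by exists 0 => // y _; rewrite /= seminorm0 mul0r.
  exists (B * c + normc l ^+ k); first by rewrite addr_ge0 ?mulr_ge0// exprn_ge0 ?ltW.
  move=> y hy; have hP := PH k y hy.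
  rewrite /= (le_trans (ND _ _))//; [exact: (operatorH bT)|exact: subspaceZ|].
  rewrite NZ// normcX mulrDl lerD2r (le_trans (hB _ hP))// -mulrA ler_wpM2l// hc//.
have [c c0 hc] := Pbound n.
have ln0 : l ^+ n != 0 by rewrite expf_neq0.
apply: (@resolvent_of_bijective l (c * ((1 - q)^-1 * normc (l ^- n)))) => [w hw|v hv hTv].
  have hw' : H (- l ^- n *: w) by exact: subspaceZ.
  have [y hy [hAy Ny]] := solve _ hw'.
  exists (P n y); first exact: PH.
  split.
    rewrite Pfactor//; have -> : iter n T y = l ^+ n *: A y.
      by rewrite /A scalerA mulfV// scale1r.
    by rewrite -scalerBr -opprB hAy scalerN scaleNr scalerN opprK scalerA mulfV// scale1r.
  rewrite (le_trans (hc _ hy))// -!mulrA ler_wpM2l// (le_trans Ny)//.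
  by rewrite NZ// normcN.
have hAv : A v = v.
  rewrite /A; have -> : iter n T v = l ^+ n *: v.
    elim: (n) => [|k ih]; first by rewrite scale1r.
    by rewrite iterS ih (operatorZ bT)// hTv scalerA -exprSr.
  by rewrite scalerA mulVf// scale1r.
apply: Ndef => //; apply/eqP; rewrite eq_le N0// andbT.
have := NA v hv; rewrite hAv => h; have := N0 hv; nra.
Qed.

End spectral.
End gelfand.

(** * Calculus for functions of a complex variable *)


Section complex_calculus.
Context {R : realType}.
Implicit Types (F G : R[i] -> R[i]) (z s : R[i]).

Definition ccont F z := {for z, continuous (F : R[i]^o -> R[i]^o)}.
(** Over the field [R[i]], a derivative in the direction [1] is a complex derivative. *)
Definition cdiff F z := derivable (F : R[i]^o -> R[i]^o) z 1.

Lemma normc_norm z : `|z| = (normc z)%:C. Proof. by case: z. Qed.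

Lemma nbhsC_P (P : R[i] -> Prop) z :
  (\forall s \near (z : R[i]^o), P s) <->
  exists2 d : R, 0 < d & forall s, normc (s - z) < d -> P s.
Proof.
split=> [/nbhs_ballP[[d ?] /=] |[d d0 hd]].
  rewrite ltcE /= => /andP[/eqP ? d0] h; subst; exists d => // s hs; apply: h.
  by rewrite /ball /= normc_norm -normcN opprB ltcR.
apply/nbhs_ballP; exists d%:C => /=; first by rewrite ltcR.
by move=> s; rewrite /ball /= normc_norm -normcN opprB ltcR => hs; exact: hd.
Qed.

Lemma ccontP F z : ccont F z <-> forall e : R, 0 < e -> exists2 d : R, 0 < d &
  forall s, normc (s - z) < d -> normc (F s - F z) < e.
Proof.
have FF := @nbhs_filter (R[i]^o) z.
split=> [/(@cvgrPdist_lt _ _ _ _ FF) h e e0|h].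
  have /nbhsC_P[d d0 hd] := h e%:C ltac:(by rewrite ltcR).
  exists d => // s /hd; by rewrite normc_norm ltcR -normcN opprB.
apply/(@cvgrPdist_lt _ (R[i]^o) _ _ FF) => -[e e'] /=; rewrite ltcE /= => /andP[/eqP -> e0].
have [d d0 hd] := h e e0; apply/nbhsC_P; exists d => // s /hd.
by rewrite normc_norm ltcR -normcN opprB.
Qed.

Lemma cdiffP F z : cdiff F z <-> exists l, forall e : R, 0 < e -> exists2 d : R, 0 < d &
  forall s, normc (s - z) < d -> normc (F s - F z - l * (s - z)) <= e * normc (s - z).
Proof.
have FF := @dnbhs_filter (R[i]^o) 0.
split=> [/cvg_ex[l /(@cvgrPdist_le _ _ _ _ FF) h]|[l h]].
  exists l => e e0; have := h e%:C ltac:(by rewrite ltcR).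
  move=> /nbhs_ballP[[d ?] /=]; rewrite ltcE /= => /andP[/eqP ? d0] {}h; subst.
  exists d => // s hs; have [->|sz] := eqVneq s z.
    by rewrite !subrr mulr0 subrr normc0 mulr0.
  have := h (s - z); rewrite /ball /= sub0r normc_norm normcN ltcR subr_eq0 => /(_ hs sz).
  rewrite /GRing.scale /= mulr1 subrK normc_norm lecR => {}h.
  have sz0 : 0 < normc (s - z) by rewrite normc_gt0 subr_eq0.
  have -> : F s - F z - l * (s - z) = - ((s - z) * (l - (s - z)^-1 * (F s - F z))).
    have w0 : s - z != 0 by rewrite subr_eq0.
    by move: (s - z) (F s - F z) w0 => w A w0; field.
  by rewrite normcN normcM mulrC ler_pM2r.
apply/cvg_ex; exists l; apply/(@cvgrPdist_le _ (R[i]^o) _ _ FF) => -[e e'] /=.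
rewrite ltcE /= => /andP[/eqP -> e0].
have [d d0 hd] := h e e0; apply/nbhs_ballP; exists d%:C => /=; first by rewrite ltcR.
move=> s; rewrite /ball /= sub0r normc_norm normcN ltcR => hs s0.
have := hd (z + s); rewrite [z + s]addrC addrK => /(_ hs).
rewrite normc_norm lecR /GRing.scale /= mulr1.
have s0' : 0 < normc s by rewrite normc_gt0.
move=> hA; have -> : l - s^-1 * (F (s + z) - F z) = - (s^-1 * (F (s + z) - F z - l * s)).
  by move: (F (s + z) - F z) => A; field.
by rewrite normcN normcM normcV ler_pdivrMl// [X in _ <= X]mulrC.
Qed.

Lemma cdiff_ccont F z : cdiff F z -> ccont F z.
Proof. by move=> /derivable1_diffP /differentiable_continuous. Qed.

Lemma cdiff_near F G z (d : R) : 0 < d -> (forall s, normc (s - z) < d -> F s = G s) ->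
  cdiff F z -> cdiff G z.
Proof.
move=> d0 h; apply: near_eq_derivable.
by apply/nbhsC_P; exists d => // s /h.
Qed.

Lemma cdiff_cst (c : R[i]) z : cdiff (fun=> c) z. Proof. exact: derivable_cst. Qed.

Lemma cdiff_id z : cdiff id z. Proof. exact: derivable_id. Qed.

Lemma cdiffD F G z : cdiff F z -> cdiff G z -> cdiff (fun s => F s + G s) z.
Proof. exact: derivableD. Qed.

Lemma cdiffB F G z : cdiff F z -> cdiff G z -> cdiff (fun s => F s - G s) z.
Proof. exact: derivableB. Qed.

Lemma cdiffM F G z : cdiff F z -> cdiff G z -> cdiff (fun s => F s * G s) z.
Proof. exact: derivableM. Qed.

Lemma cdiffV F z : F z != 0 -> cdiff F z -> cdiff (fun s => (F s)^-1) z.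
Proof. exact: derivableV. Qed.

Lemma cdiffX F n z : cdiff F z -> cdiff (fun s => F s ^+ n) z.
Proof.
move=> h; elim: n => [|n ih]; first exact: cdiff_cst.
by under [X in cdiff X]eq_fun do rewrite exprS; exact: cdiffM.
Qed.

Lemma cdiff_comp F G z : cdiff F z -> cdiff G (F z) -> cdiff (fun s => G (F s)) z.
Proof.
move=> /derivable1_diffP hF /derivable1_diffP hG; apply/derivable1_diffP.
exact: (differentiable_comp hF hG).
Qed.

Lemma ccontB F G z : ccont F z -> ccont G z -> ccont (fun s => F s - G s) z.
Proof. exact: continuousB. Qed.

Lemma ccontM F G z : ccont F z -> ccont G z -> ccont (fun s => F s * G s) z.
Proof. exact: continuousM. Qed.

Opaque cdiff ccont.

(** Caratheodory's form of differentiability, which prepares Cauchy kernels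
   [(F s - F z) / (s - z)] for [goursat_punctured]. *)
Lemma difference_quotient F z : cdiff F z -> exists g : R[i] -> R[i],
  [/\ ccont g z, forall s, F s = F z + g s * (s - z) &
      forall s, s != z -> cdiff F s -> cdiff g s].
Proof.
move=> /cdiffP[l hl].
pose q s := (F s - F z) / (s - z).
exists (fun s => if s == z then l else q s); split.
- apply/ccontP => e e0; have [d d0 hd] := hl _ (divr_gt0 e0 (ltr0n R 2)).
  exists d => // s /hd; rewrite eqxx; case: eqVneq => [->|sz] h.
    by rewrite subrr normc0.
  have sz0 : 0 < normc (s - z) by rewrite normc_gt0 subr_eq0.
  have e1 : q s - l = (F s - F z - l * (s - z)) / (s - z).
    by rewrite /q [in RHS]mulrBl mulfK ?subr_eq0.
  rewrite e1 normcM normcV ltr_pdivrMr// (le_lt_trans h)// ltr_pM2r//; lra.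
- move=> s; case: eqVneq => [->|sz]; first by rewrite subrr mulr0 addr0.
  by rewrite /q divfK ?subr_eq0// addrC subrK.
- move=> s sz hs.
  have sz0 : 0 < normc (s - z) by rewrite normc_gt0 subr_eq0.
  apply: (@cdiff_near q _ _ _ sz0).
    move=> t ht; case: eqVneq => // tz.
    by move: ht; rewrite tz -normcN opprB ltxx.
  have hd := cdiffB (@cdiff_id s) (@cdiff_cst z s).
  have sz' : (fun t => id t - z) s != 0 by rewrite subr_eq0.
  exact: (cdiffM (cdiffB hs (@cdiff_cst (F z) s)) (@cdiffV (fun t => t - z) s sz' hd)).
Qed.

Definition rcont (f : R -> R) x := {for x, continuous f}.

Lemma rcontP (f : R -> R) x : rcont f x <-> forall e : R, 0 < e -> exists2 d : R, 0 < d &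
  forall y, `|y - x| < d -> `|f y - f x| < e.
Proof.
split=> [/cvgrPdist_lt h e e0|h].
  have /nbhs_ballP[d /= d0 hd] := h e e0; exists d => // y hy.
  by rewrite distrC; apply: hd; rewrite /ball /= distrC.
apply/cvgrPdist_lt => e e0; have [d d0 hd] := h e e0.
apply/nbhs_ballP; exists d => //= y; rewrite /ball /= distrC => /hd.
by rewrite distrC.
Qed.

Let normc_vert (x y y' : R) : normc ((x +i* y) - (x +i* y')) = `|y - y'|.
Proof. by rewrite /normc /= subrr expr0n /= add0r sqrtr_sqr. Qed.

Let normc_hor (x x' y : R) : normc ((x +i* y) - (x' +i* y)) = `|x - x'|.
Proof. by rewrite /normc /= subrr expr0n /= addr0 sqrtr_sqr. Qed.

Lemma ReB z s : complex.Re (z - s) = complex.Re z - complex.Re s.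
Proof. by case: z => ? ?; case: s. Qed.

Lemma ImB z s : complex.Im (z - s) = complex.Im z - complex.Im s.
Proof. by case: z => ? ?; case: s. Qed.

Lemma ccont_Re_vert F x y : ccont F (x +i* y) -> rcont (fun t => complex.Re (F (x +i* t))) y.
Proof.
move=> /ccontP h; apply/rcontP => e /h[d d0 hd]; exists d => // t ht.
by rewrite -ReB (le_lt_trans (normc_Re_le _))// hd// normc_vert.
Qed.

Lemma ccont_Im_vert F x y : ccont F (x +i* y) -> rcont (fun t => complex.Im (F (x +i* t))) y.
Proof.
move=> /ccontP h; apply/rcontP => e /h[d d0 hd]; exists d => // t ht.
by rewrite -ImB (le_lt_trans (normc_Im_le _))// hd// normc_vert.
Qed.

Lemma ccont_Re_hor F x y : ccont F (x +i* y) -> rcont (fun t => complex.Re (F (t +i* y))) x.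
Proof.
move=> /ccontP h; apply/rcontP => e /h[d d0 hd]; exists d => // t ht.
by rewrite -ReB (le_lt_trans (normc_Re_le _))// hd// normc_hor.
Qed.

Lemma le_normc_normc z s : `|normc z - normc s| <= normc (z - s).
Proof.
rewrite ler_norml; have := le_normc_sub z s; have := le_normc_sub s z.
by rewrite -[normc (s - z)]normcN opprB; lra.
Qed.

Lemma ccont_normc F x y : ccont F (x +i* y) -> rcont (fun t => normc (F (x +i* t))) y.
Proof.
move=> /ccontP h; apply/rcontP => e /h[d d0 hd]; exists d => // t ht.
by rewrite (le_lt_trans (le_normc_normc _ _))// hd// normc_vert.
Qed.

Lemma ccont_normc_hor F x y : ccont F (x +i* y) -> rcont (fun t => normc (F (t +i* y))) x.
Proof.
move=> /ccontP h; apply/rcontP => e /h[d d0 hd]; exists d => // t ht.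
by rewrite (le_lt_trans (le_normc_normc _ _))// hd// normc_hor.
Qed.

End complex_calculus.
#[global] Opaque cdiff ccont.

Section interval_integral.
Context {R : realType}.
Notation mu := (@lebesgue_measure R).
Implicit Types f g : R -> R.

Definition rint f a b := \int[mu]_(x in `[a, b]) f x.
Definition contitv f a b := forall x, a <= x <= b -> rcont f x.

Lemma contitv_integrable f a b : contitv f a b -> mu.-integrable `[a, b] (EFin \o f).
Proof.
move=> h; apply: continuous_compact_integrable; first exact: segment_compact.
apply: continuous_in_subspaceT => x; rewrite inE/= in_itv/=; exact: h.
Qed.

Lemma contitvB f g a b : contitv f a b -> contitv g a b -> contitv (fun x => f x - g x) a b.
Proof. by move=> hf hg x hx; apply: cvgB; [exact: hf|exact: hg]. Qed.

Lemma rint_split f a m b : a <= m -> m <= b -> contitv f a b ->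
  rint f a b = rint f a m + rint f m b.
Proof.
move=> am mb h.
have h1 := contitv_integrable h.
have e := @itv_bndbnd_setU _ R (BLeft a) (BRight m) (BRight b).
rewrite /rint e ?bnd_simp// Rintegral_setU//=; last 2 first.
- by rewrite -e ?bnd_simp.
- apply/disj_setPS => x /= []; rewrite !in_itv/= => /andP[_ xm] /andP[mx _].
  by have := lt_le_trans mx xm; rewrite ltxx.
congr (_ + _); rewrite Rintegral_itv_obnd_cbnd//.
apply: integrableS h1 => //; apply: subset_itv; by rewrite bnd_simp.
Qed.

Lemma rintB f g a b : contitv f a b -> contitv g a b ->
  rint (fun x => f x - g x) a b = rint f a b - rint g a b.
Proof. by move=> hf hg; apply: RintegralB => //; exact: contitv_integrable. Qed.

Lemma rint_bounds f a b k e : a <= b -> contitv f a b ->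
  (forall x, a <= x <= b -> `|f x - k| <= e) -> `|rint f a b - k * (b - a)| <= e * (b - a).
Proof.
move=> ab cf h.
have cst r : rint (fun=> r) a b = r * (b - a).
  rewrite /rint Rintegral_cst// /= lebesgue_measure_itv/= lte_fin; case: ltP => //= ba.
  by congr (_ * _); lra.
have ccst r : contitv (fun=> r) a b by move=> x _; exact: cvg_cst.
have ci r := contitv_integrable (ccst r).
have cfi := contitv_integrable cf.
have h1 : rint f a b <= rint (fun=> k + e) a b.
  apply: le_Rintegral => // x; rewrite /= in_itv/= => /h; rewrite ler_norml; lra.
have h2 : rint (fun=> k - e) a b <= rint f a b.
  apply: le_Rintegral => // x; rewrite /= in_itv/= => /h; rewrite ler_norml; lra.
by move: h1 h2; rewrite !cst ler_norml; lra.
Qed.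

End interval_integral.

(** * Goursat's theorem on rectangles *)


Section goursat.
Context {R : realType}.
Implicit Types (F G : R[i] -> R[i]) (z s : R[i]).

(** The real part of the integral of [F] along the boundary of the rectangle
   [[a, b] x [c, d]], oriented counterclockwise. *)
Definition rect_integral F (a b c d : R) :=
  rint (fun x => complex.Re (F (x +i* c)) - complex.Re (F (x +i* d))) a b -
  rint (fun y => complex.Im (F (b +i* y)) - complex.Im (F (a +i* y))) c d.

Definition cont_on_rect F a b c d :=
  forall x y, a <= x <= b -> c <= y <= d -> ccont F (x +i* y).

Lemma sub_cont_on_rect F a b c d a' b' c' d' : a <= a' -> b' <= b -> c <= c' -> d' <= d ->
  cont_on_rect F a b c d -> cont_on_rect F a' b' c' d'.
Proof.
move=> aa bb cc dd h x y /andP[? ?] /andP[? ?]; apply: h; apply/andP; split.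
all: by [apply: le_trans; eassumption|apply: le_trans bb|apply: le_trans dd|
  apply: le_trans aa _|apply: le_trans cc _].
Qed.

Let Re_hor F a b c d y : c <= y <= d -> cont_on_rect F a b c d ->
  contitv (fun x => complex.Re (F (x +i* y))) a b.
Proof. by move=> hy h x hx; apply: ccont_Re_hor; exact: h. Qed.

Let Im_vert F a b c d x : a <= x <= b -> cont_on_rect F a b c d ->
  contitv (fun y => complex.Im (F (x +i* y))) c d.
Proof. by move=> hx h y hy; apply: ccont_Im_vert; exact: h. Qed.

Let rect_integralE F a b c d : a <= b -> c <= d -> cont_on_rect F a b c d ->
  rect_integral F a b c d =
  rint (fun x => complex.Re (F (x +i* c))) a b - rint (fun x => complex.Re (F (x +i* d))) a b
  - (rint (fun y => complex.Im (F (b +i* y))) c d - rint (fun y => complex.Im (F (a +i* y))) c d).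
Proof.
move=> ab cd h; rewrite /rect_integral !rintB//.
- by apply: (Im_vert _ h); rewrite ab lexx.
- by apply: (Im_vert _ h); rewrite ab lexx.
- by apply: (Re_hor _ h); rewrite cd lexx.
- by apply: (Re_hor _ h); rewrite cd lexx.
Qed.

Lemma rect_integral_splitx F a m b c d : a <= m -> m <= b -> c <= d ->
  cont_on_rect F a b c d ->
  rect_integral F a b c d = rect_integral F a m c d + rect_integral F m b c d.
Proof.
move=> am mb cd h; have ab := le_trans am mb.
rewrite !rect_integralE//; try exact: sub_cont_on_rect h.
rewrite (rint_split am mb (Re_hor (y := c) _ h)) ?lexx//.
rewrite (rint_split am mb (Re_hor (y := d) _ h)) ?lexx ?andbT//.
by ring.
Qed.

Lemma rect_integral_splity F a b c m d : a <= b -> c <= m -> m <= d ->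
  cont_on_rect F a b c d ->
  rect_integral F a b c d = rect_integral F a b c m + rect_integral F a b m d.
Proof.
move=> ab cm md h; have cd := le_trans cm md.
rewrite !rect_integralE//; try exact: sub_cont_on_rect h.
rewrite (rint_split cm md (Im_vert (x := a) _ h)) ?lexx//.
rewrite (rint_split cm md (Im_vert (x := b) _ h)) ?lexx ?andbT//.
by ring.
Qed.

Let normc_rect (a b c d x y x' y' : R) : a <= x <= b -> c <= y <= d ->
  a <= x' <= b -> c <= y' <= d -> normc ((x +i* y) - (x' +i* y')) <= b - a + (d - c).
Proof.
move=> /andP[? ?] /andP[? ?] /andP[? ?] /andP[? ?].
rewrite (le_trans (normc_le_Re_Im _))//= lerD// ler_norml; lra.
Qed.

(** A function that is within [e] of the affine function [A + B (s - z)] on a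
   rectangle has a small boundary integral, because affine functions have none. *)
Lemma rect_integral_affine F (A B : R[i]) z a b c d e : a <= b -> c <= d -> 0 <= e ->
  cont_on_rect F a b c d ->
  (forall x y, a <= x <= b -> c <= y <= d ->
    normc (F (x +i* y) - A - B * ((x +i* y) - z)) <= e) ->
  `|rect_integral F a b c d| <= 2 * e * (b - a + (d - c)).
Proof.
move=> ab cd e0 h hF.
have hab : a <= a <= b by rewrite lexx.
have hba : a <= b <= b by rewrite lexx ab.
have hcd : c <= c <= d by rewrite lexx.
have hdc : c <= d <= d by rewrite lexx cd.
have h1 x : a <= x <= b -> `|complex.Re (F (x +i* c)) - complex.Re (F (x +i* d))
    - complex.Im B * (d - c)| <= 2 * e.
  move=> hx.
  have := le_trans (normc_Re_le _) (hF x c hx hcd).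
  have := le_trans (normc_Re_le _) (hF x d hx hdc).
  case: (F (x +i* c)) => ? ?; case: (F (x +i* d)) => ? ?; case: A B z {hF} => ? ? [? ?] [? ?] /=.
  rewrite !ler_norml; nra.
have h2 y : c <= y <= d -> `|complex.Im (F (b +i* y)) - complex.Im (F (a +i* y))
    - complex.Im B * (b - a)| <= 2 * e.
  move=> hy.
  have := le_trans (normc_Im_le _) (hF a y hab hy).
  have := le_trans (normc_Im_le _) (hF b y hba hy).
  case: (F (a +i* y)) => ? ?; case: (F (b +i* y)) => ? ?; case: A B z {hF h1} => ? ? [? ?] [? ?] /=.
  rewrite !ler_norml; nra.
have := rint_bounds ab (contitvB (Re_hor hcd h) (Re_hor hdc h)) h1.
have := rint_bounds cd (contitvB (Im_vert hba h) (Im_vert hab h)) h2.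
by rewrite /rect_integral !ler_norml; lra.
Qed.

(** The bound [e * (half-perimeter) ^ 2] is the sum of the same bounds for the four
   quarters, and holds on small rectangles around each point by
   differentiability at that point; [bisection] does the rest. *)
Lemma goursat F a b c d : a <= b -> c <= d ->
  (forall x y, a <= x <= b -> c <= y <= d -> cdiff F (x +i* y)) ->
  rect_integral F a b c d = 0.
Proof.
move=> ab cd h.
have hc : cont_on_rect F a b c d by move=> x y hx hy; exact/cdiff_ccont/h.
suff key e : 0 < e -> `|rect_integral F a b c d| <= e * (b - a + (d - c)) ^+ 2.
  apply/eqP; rewrite -normr_le0; apply/ler_addgt0Pr => e e0; rewrite add0r.
  have W : 0 < (b - a + (d - c)) ^+ 2 + 1 by rewrite ltr_wpDl ?sqr_ge0.
  rewrite (le_trans (key _ (divr_gt0 e0 W)))// mulrAC ler_pdivrMr//.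
  by rewrite ler_pM2l// lerDl.
move=> e0.
pose P a' b' c' d' := a <= a' -> a' <= b' -> b' <= b -> c <= c' -> c' <= d' -> d' <= d ->
  `|rect_integral F a' b' c' d'| <= e * (b' - a' + (d' - c')) ^+ 2.
suff : P a b c d by apply.
apply: bisection => //.
  move=> a' b' c' d' m k h1 h2 h3 h4 aa ab' bb cc cd' dd.
  have ? : a' <= m by rewrite /m; lra.
  have ? : m <= b' by rewrite /m; lra.
  have ? : c' <= k by rewrite /k; lra.
  have ? : k <= d' by rewrite /k; lra.
  have hc' : cont_on_rect F a' b' c' d' by exact: sub_cont_on_rect hc.
  rewrite (@rect_integral_splitx _ _ m)//.
  rewrite (@rect_integral_splity _ _ _ _ k)//; last exact: sub_cont_on_rect hc'.
  rewrite (@rect_integral_splity _ m _ _ k)//; last exact: sub_cont_on_rect hc'.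
  have := h1 aa ltac:(by []) ltac:(lra) cc ltac:(by []) ltac:(lra).
  have := h2 ltac:(lra) ltac:(by []) bb cc ltac:(by []) ltac:(lra).
  have := h3 aa ltac:(by []) ltac:(lra) ltac:(lra) ltac:(by []) dd.
  have := h4 ltac:(lra) ltac:(by []) bb ltac:(lra) ltac:(by []) dd.
  rewrite !ler_norml /m /k.
  have e2 (D : R) : e * D ^+ 2 = 4 * (e * (D / 2) ^+ 2) by field.
  rewrite (e2 (b' - a' + (d' - c'))).
  have -> : (a' + b') / 2 - a' + ((c' + d') / 2 - c') = (b' - a' + (d' - c')) / 2 by field.
  have -> : b' - (a' + b') / 2 + ((c' + d') / 2 - c') = (b' - a' + (d' - c')) / 2 by field.
  have -> : (a' + b') / 2 - a' + (d' - (c' + d') / 2) = (b' - a' + (d' - c')) / 2 by field.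
  have -> : b' - (a' + b') / 2 + (d' - (c' + d') / 2) = (b' - a' + (d' - c')) / 2 by field.
  lra.
move=> x y hx hy.
have /cdiffP[l hl] := h x y hx hy.
have [r r0 hr] := hl _ (divr_gt0 e0 (ltr0n R 2)).
exists (r / 3); first by rewrite divr_gt0.
move=> a' b' c' d' /andP[aa ax] /andP[xb bb] /andP[cc cy] /andP[yd dd] hab hcd _ ab' _ _ cd' _.
have W0 : 0 <= b' - a' + (d' - c') by lra.
have := @rect_integral_affine F (F (x +i* y)) l (x +i* y) a' b' c' d'
  (e / 2 * (b' - a' + (d' - c'))).
rewrite (_ : 2 * _ * _ = e * (b' - a' + (d' - c')) ^+ 2); last by field.
apply => //; first by rewrite mulr_ge0// ltW// divr_gt0.
  exact: sub_cont_on_rect hc.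
move=> x' y' hx' hy'.
have hn := @normc_rect a' b' c' d' x' y' x y hx' hy'.
have {}hn := hn ltac:(by apply/andP) ltac:(by apply/andP).
rewrite (le_trans (hr _ _))//; first by rewrite (le_lt_trans hn)//; lra.
by rewrite ler_wpM2l// ltW// divr_gt0.
Qed.

(** Continuity at a single point suffices there: a rectangle shrinking to that
   point carries the whole integral. *)
Lemma goursat_punctured F a b c d x0 y0 : a < x0 < b -> c < y0 < d ->
  (forall x y, a <= x <= b -> c <= y <= d -> x +i* y != x0 +i* y0 -> cdiff F (x +i* y)) ->
  ccont F (x0 +i* y0) ->
  rect_integral F a b c d = 0.
Proof.
move=> /andP[ax xb] /andP[cy yd] h h0.
have hc : cont_on_rect F a b c d.
  move=> x y hx hy; have [->//|ne] := eqVneq (x +i* y) (x0 +i* y0).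
  by apply: cdiff_ccont; exact: h.
have ne x y : x != x0 \/ y != y0 -> x +i* y != x0 +i* y0.
  by move=> hxy; apply/eqP => -[ex ey]; move: hxy; rewrite ex ey !eqxx => -[].
have small r : 0 < r -> a <= x0 - r -> x0 + r <= b -> c <= y0 - r -> y0 + r <= d ->
    rect_integral F a b c d = rect_integral F (x0 - r) (x0 + r) (y0 - r) (y0 + r).
  move=> r0 h1 h2 h3 h4.
  have ab : a <= b by lra.
  have cd : c <= d by lra.
  have h5 : x0 - r <= b by lra.
  have h6 : x0 - r <= x0 + r by lra.
  have h7 : y0 - r <= y0 + r by lra.
  have h8 : y0 - r <= d by lra.
  have hc' := sub_cont_on_rect h1 (lexx b) (lexx c) (lexx d) hc.
  have hc'' := sub_cont_on_rect (lexx _) h2 (lexx _) (lexx _) hc'.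
  have hc3 := sub_cont_on_rect (lexx _) (lexx _) h3 (lexx _) hc''.
  have away a' b' c' d' : a <= a' -> a' <= b' -> b' <= b -> c <= c' -> c' <= d' -> d' <= d ->
      b' < x0 \/ x0 < a' \/ d' < y0 \/ y0 < c' -> rect_integral F a' b' c' d' = 0.
    move=> q1 q2 q3 q4 q5 q6 hout; apply: (goursat q2 q5) => x y /andP[q7 q8] /andP[q9 q10].
    apply: h; first by apply/andP; split; lra.
      by apply/andP; split; lra.
    apply: ne; move: hout => [|[|[|]]] hout.
    - by left; apply/negP => /eqP ?; lra.
    - by left; apply/negP => /eqP ?; lra.
    - by right; apply/negP => /eqP ?; lra.
    - by right; apply/negP => /eqP ?; lra.
  rewrite (@rect_integral_splitx F a (x0 - r) b c d h1 h5 cd hc).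
  rewrite (@rect_integral_splitx F (x0 - r) (x0 + r) b c d h6 h2 cd hc').
  rewrite (@rect_integral_splity F (x0 - r) (x0 + r) c (y0 - r) d h6 h3 h8 hc'').
  rewrite (@rect_integral_splity F (x0 - r) (x0 + r) (y0 - r) (y0 + r) d h6 h7 h4 hc3).
  rewrite (away a (x0 - r) c d); [|by lra..|by left; lra].
  rewrite (away (x0 + r) b c d); [|by lra..|by right; left; lra].
  rewrite (away (x0 - r) (x0 + r) c (y0 - r)); [|by lra..|by right; right; left; lra].
  rewrite (away (x0 - r) (x0 + r) (y0 + r) d); [|by lra..|by right; right; right; lra].
  by rewrite !add0r !addr0.
apply/eqP; rewrite -normr_le0; apply/ler_addgt0Pr => e e0; rewrite add0r.
have /ccontP/(_ 1 ltr01)[r r0 hr] := h0.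
(* on the square of half-side [m] the integral is at most [8 m] in modulus, by
   [rect_integral_affine] with slope zero and error one *)
pose m := Num.min (Num.min (r / 5) (e / 8)) (Num.min (Num.min (x0 - a) (b - x0)) (Num.min (y0 - c) (d - y0))).
have m0 : 0 < m by rewrite !lt_min !subr_gt0 ax xb cy yd !divr_gt0.
have [[m1 m2] [m3 m4] [m5 m6]] : [/\ m <= r / 5 /\ m <= e / 8, m <= x0 - a /\ m <= b - x0 &
    m <= y0 - c /\ m <= d - y0].
  have hmin (u v : R) : Num.min u v <= u /\ Num.min u v <= v by rewrite !ge_min !lexx orbT.
  have [p1 p2] := hmin (Num.min (r / 5) (e / 8)) (Num.min (Num.min (x0 - a) (b - x0)) (Num.min (y0 - c) (d - y0))).
  have [p3 p4] := hmin (r / 5) (e / 8).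
  have [p5 p6] := hmin (Num.min (x0 - a) (b - x0)) (Num.min (y0 - c) (d - y0)).
  have [p7 p8] := hmin (x0 - a) (b - x0); have [p9 p10] := hmin (y0 - c) (d - y0).
  split; split; [exact: le_trans p1 p3|exact: le_trans p1 p4|
    exact: le_trans p2 (le_trans p5 p7)|exact: le_trans p2 (le_trans p5 p8)|
    exact: le_trans p2 (le_trans p6 p9)|exact: le_trans p2 (le_trans p6 p10)].
rewrite (small m m0); [|by lra..].
have hm : cont_on_rect F (x0 - m) (x0 + m) (y0 - m) (y0 + m).
  by apply: sub_cont_on_rect hc; lra.
have hF x y : x0 - m <= x <= x0 + m -> y0 - m <= y <= y0 + m ->
    normc (F (x +i* y) - F (x0 +i* y0) - 0 * (x +i* y - 0)) <= 1.
  move=> hx hy; rewrite mul0r subr0; apply/ltW/hr.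
  apply: (@le_lt_trans _ _ (4 * m)); last by lra.
  have hx0 : x0 - m <= x0 <= x0 + m by apply/andP; split; lra.
  have hy0 : y0 - m <= y0 <= y0 + m by apply/andP; split; lra.
  by apply: (le_trans (normc_rect hx hy hx0 hy0)); lra.
have h1 : x0 - m <= x0 + m by lra.
have h2 : y0 - m <= y0 + m by lra.
by apply: (le_trans (rect_integral_affine h1 h2 ler01 hm hF)); lra.
Qed.

End goursat.

(** * Poisson's formula on a half-plane *)


Section poisson.
Context {R : realType}.
Notation mu := (@lebesgue_measure R).
Implicit Types (F G : R[i] -> R[i]) (z s : R[i]) (t q x y : R).

(** The Poisson kernel of the half-plane, up to the factor [pi^-1]. *)
Definition pker t y := t / (t ^+ 2 + y ^+ 2).

Lemma pker_den_gt0 t y : 0 < t -> 0 < t ^+ 2 + y ^+ 2.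
Proof. by move=> t0; rewrite ltr_pwDl ?exprn_gt0 ?sqr_ge0. Qed.

Lemma pker_ge0 t y : 0 < t -> 0 <= pker t y.
Proof. by move=> t0; rewrite divr_ge0 ?ltW ?pker_den_gt0. Qed.

Lemma pker_le t y : 0 < t -> pker t y <= t^-1.
Proof.
move=> t0; rewrite /pker ler_pdivrMr ?pker_den_gt0// mulrDr expr2 mulKf ?gt_eqF//.
by rewrite lerDl mulr_ge0 ?sqr_ge0// invr_ge0 ltW.
Qed.

Lemma rcont_pker t q y : 0 < t -> rcont (fun x => pker t (x - q)) y.
Proof.
move=> t0; apply: cvgM; first exact: cvg_cst.
apply: cvgV; first by rewrite gt_eqF ?pker_den_gt0.
apply: cvgD; first exact: cvg_cst.
have h : (x - q) @[x --> y] --> y - q by apply: cvgB; [exact: cvg_id|exact: cvg_cst].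
by under eq_fun do rewrite expr2; rewrite expr2; apply: cvgM.
Qed.

Let bounded_quotient F z z' s (K A S : R) : 0 < A -> 0 < S ->
  normc (F s) <= K -> normc (F z) <= K -> A <= normc (s - z) -> S <= normc (s - z') ->
  normc ((F s - F z) * ((s - z)^-1 - (s - z')^-1)) <= 2 * K * (normc (z - z') / (A * S)).
Proof.
move=> A0 S0 hs hz hA hS.
have nz : 0 < normc (s - z) by apply: lt_le_trans hA.
have nz' : 0 < normc (s - z') by apply: lt_le_trans hS.
have n1 : s - z != 0 by rewrite -normc_gt0.
have n2 : s - z' != 0 by rewrite -normc_gt0.
have -> : (s - z)^-1 - (s - z')^-1 = (z - z') * ((s - z) * (s - z'))^-1.
  by field; rewrite n1 n2.
rewrite !normcM normcV normcM; apply: ler_pM; rewrite ?mulr_ge0 ?invr_ge0 ?mulr_ge0 ?normc_ge0//.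
  by rewrite (le_trans (le_normcB _ _))// mulr_natl mulr2n lerD.
rewrite ler_wpM2l ?normc_ge0// lef_pV2 ?posrE ?mulr_gt0//.
by apply: ler_pM => //; exact: ltW.
Qed.

Let kernel_left t y : 0 < t ->
  ((- t +i* y)^-1 - (t +i* y)^-1 : R[i]) = (- 2 * pker t y)%:C.
Proof.
move=> t0; have h : t ^+ 2 + y ^+ 2 != 0 by rewrite gt_eqF ?pker_den_gt0.
apply/eqP; rewrite eq_complex /= /pker !sqrrN; apply/andP; split; apply/eqP.
all: by field.
Qed.

Let ImM_real (w : R[i]) (r : R) : complex.Im (w * r%:C) = r * complex.Im w.
Proof. by case: w => a b /=; rewrite mulr0 add0r mulrC. Qed.

(** Cauchy's theorem for [(G s - G z) (1 / (s - z) - 1 / (s - z'))], with [z'] the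
   reflection of [z] in the line [Re s = x0]: the kernel is real on that line
   and [O(|s|^-2)] at infinity. *)
Lemma poisson_rect G a x0 K t q S : a < x0 ->
  (forall z, a < complex.Re z -> cdiff G z) ->
  (forall z, x0 <= complex.Re z -> normc (G z) <= K) -> 0 < t -> 2 * t <= S ->
  `|rint (fun y => pker t (y - q) *
       (complex.Im (G (x0 +i* y)) - complex.Im (G ((x0 + t) +i* q)))) (q - S) (q + S)|
  <= 12 * K * t / S.
Proof.
move=> ax hG hK t0 tS.
have S0 : 0 < S by lra.
pose z := (x0 + t) +i* q; pose z' := (x0 - t) +i* q.
have Gz : cdiff G z by apply: hG => /=; lra.
have [g [cg gE dg]] := difference_quotient Gz.
pose h s := g s - (G s - G z) * (s - z')^-1.
have nz' s : x0 <= complex.Re s -> s - z' != 0.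
  case: s => u v /= hu; rewrite eq_complex /= negb_and; apply/orP; left.
  by apply/negP => /eqP ?; lra.
have hoff s : s != z -> h s = (G s - G z) * ((s - z)^-1 - (s - z')^-1).
  move=> sz; rewrite /h mulrBr; congr (_ - _).
  by rewrite [in RHS]gE addrC addKr mulfK// subr_eq0.
have quot_diff s : x0 <= complex.Re s -> cdiff G s ->
    cdiff (fun s => (G s - G z) * (s - z')^-1) s.
  move=> hs hGs; have sz' : (fun w : R[i] => w - z') s != 0 by exact: nz'.
  exact: (cdiffM (cdiffB hGs (@cdiff_cst _ (G z) s))
    (@cdiffV _ (fun w : R[i] => w - z') s sz' (cdiffB (@cdiff_id _ s) (@cdiff_cst _ z' s)))).
have hdiff s : x0 <= complex.Re s -> s != z -> cdiff h s.
  move=> hs sz; have hGs : cdiff G s by apply: hG; apply: lt_le_trans hs.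
  exact: (cdiffB (dg s sz hGs) (quot_diff s hs hGs)).
have zx0 : x0 <= complex.Re z by rewrite /=; lra.
have hcont s : x0 <= complex.Re s -> ccont h s.
  move=> hs; have [->|sz] := eqVneq s z; last by apply: cdiff_ccont; exact: hdiff.
  exact: (ccontB cg (cdiff_ccont (quot_diff z zx0 Gz))).
have J0 : rect_integral h x0 (x0 + S) (q - S) (q + S) = 0.
  apply: (@goursat_punctured _ h _ _ _ _ (x0 + t) q).
  - by apply/andP; split; lra.
  - by apply/andP; split; lra.
  - by move=> x y /andP[hx _] _ ne; exact: hdiff.
  - by apply: hcont => /=; lra.
have hb s A : x0 <= complex.Re s -> 0 < A -> A <= normc (s - z) -> S <= normc (s - z') ->
    normc (h s) <= 2 * K * (2 * t / (A * S)).
  move=> hs A0 hA hS; have sz : s != z by rewrite -subr_eq0 -normc_gt0; apply: lt_le_trans hA.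
  rewrite hoff//; have := bounded_quotient A0 S0 (hK s hs) (hK z zx0) hA hS.
  have -> : normc (z - z') = 2 * t; last by [].
  have -> : z - z' = (2 * t)%:C.
    by apply/eqP; rewrite eq_complex /= subrr eqxx andbT; apply/eqP; ring.
  by rewrite normc_real ger0_norm//; lra.
have K0 : 0 <= K by apply: le_trans (normc_ge0 _) (hK z zx0).
have den2 : 0 < S / 2 * S by rewrite mulr_gt0// divr_gt0.
have den1 : 0 < S * S by rewrite mulr_gt0.
have hor x y : x0 <= x -> `|y - q| = S -> `|complex.Re (h (x +i* y))| <= 4 * K * t / (S * S).
  move=> hx hy; apply: le_trans (normc_Re_le _) _.
  have := hb (x +i* y) S hx S0.
  rewrite (_ : 2 * K * (2 * t / (S * S)) = 4 * K * t / (S * S)); last by field; rewrite gt_eqF.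
  apply; rewrite -hy.
    exact: le_trans _ (normc_Im_le ((x +i* y) - z)).
  exact: le_trans _ (normc_Im_le ((x +i* y) - z')).
have right y : `|complex.Im (h ((x0 + S) +i* y))| <= 8 * K * t / (S * S).
  apply: le_trans (normc_Im_le _) _.
  have := hb ((x0 + S) +i* y) (S / 2).
  rewrite (_ : 2 * K * (2 * t / (S / 2 * S)) = 8 * K * t / (S * S)); last by field; rewrite gt_eqF.
  have s1 : x0 <= x0 + S by lra.
  have s2 : 0 < S / 2 by lra.
  apply => //.
    apply: le_trans _ (normc_Re_le _) => /=; rewrite ger0_norm; lra.
  apply: le_trans _ (normc_Re_le _) => /=; rewrite ger0_norm; lra.
have xS : x0 <= x0 + S by lra.
have qS : q - S <= q + S by lra.
have chor y : contitv (fun x => complex.Re (h (x +i* y))) x0 (x0 + S).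
  by move=> x /andP[hx _]; apply: ccont_Re_hor; exact: hcont.
have cvert x : x0 <= x -> contitv (fun y => complex.Im (h (x +i* y))) (q - S) (q + S).
  by move=> hx y _; apply: ccont_Im_vert; exact: hcont.
have hT : `|rint (fun x => complex.Re (h (x +i* (q - S))) - complex.Re (h (x +i* (q + S)))) x0 (x0 + S)|
    <= 8 * K * t / S.
  have := @rint_bounds _ _ x0 (x0 + S) 0 (8 * K * t / (S * S)) xS (contitvB (chor (q - S)) (chor (q + S))).
  rewrite mul0r subr0 addrAC subrr add0r.
  rewrite (_ : 8 * K * t / (S * S) * S = 8 * K * t / S); last by field; rewrite gt_eqF.
  apply => x /andP[hx _]; rewrite subr0.
  apply: le_trans (ler_normB _ _) _.
  have h1 : `|q - S - q| = S by rewrite addrAC subrr add0r normrN ger0_norm// ltW.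
  have h2 : `|q + S - q| = S by rewrite addrAC subrr add0r ger0_norm// ltW.
  have := lerD (hor x _ hx h1) (hor x _ hx h2).
  by rewrite (_ : 4 * K * t / (S * S) + 4 * K * t / (S * S) = 8 * K * t / (S * S)); last by ring.
have hRt : `|rint (fun y => complex.Im (h ((x0 + S) +i* y))) (q - S) (q + S)| <= 16 * K * t / S.
  have := @rint_bounds _ _ (q - S) (q + S) 0 (8 * K * t / (S * S)) qS (cvert (x0 + S) xS).
  rewrite mul0r subr0.
  rewrite (_ : 8 * K * t / (S * S) * (q + S - (q - S)) = 16 * K * t / S); last first.
    by field; rewrite gt_eqF.
  by apply => y _; rewrite subr0.
set f := fun y => _.
have cf : contitv f (q - S) (q + S).
  move=> y _; apply: cvgM; first exact: rcont_pker.
  apply: cvgB; last exact: cvg_cst.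
  by apply: ccont_Im_vert; apply: cdiff_ccont; apply: hG.
have hL : rint (fun y => complex.Im (h (x0 +i* y))) (q - S) (q + S) = - 2 * rint f (q - S) (q + S).
  rewrite /rint -RintegralZl//; last exact: contitv_integrable.
  apply: eq_Rintegral => y _; rewrite hoff; last first.
    by apply/eqP => -[e _]; lra.
  have -> : x0 +i* y - z = - t +i* (y - q).
    by apply/eqP; rewrite eq_complex /= eqxx andbT; apply/eqP; ring.
  have -> : x0 +i* y - z' = t +i* (y - q).
    by apply/eqP; rewrite eq_complex /= eqxx andbT; apply/eqP; ring.
  by rewrite kernel_left// ImM_real ImB /f mulrA.
move: J0; rewrite /rect_integral (rintB (cvert _ xS) (cvert _ (lexx x0))) hL.
move: hT hRt; rewrite !ler_norml.
have -> : 16 * K * t / S = 2 * (8 * K * t / S) by ring.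
have -> : 12 * K * t / S = 3 / 2 * (8 * K * t / S) by field; rewrite gt_eqF.
lra.
Qed.

End poisson.

Section poisson_line.
Context {R : realType}.
Notation mu := (@lebesgue_measure R).
Implicit Types (G : R[i] -> R[i]) (z s : R[i]) (t q x y : R).

Lemma EFin_rint (f : R -> R) a b : contitv f a b ->
  (\int[mu]_(x in `[a, b]) (f x)%:E)%E = (rint f a b)%:E.
Proof.
move=> cf; rewrite /rint /Rintegral fineK//.
by apply: integrable_fin_num => //; exact: contitv_integrable.
Qed.

Lemma ge0_integral_exhaust (f : R -> R) q : measurable_fun setT f -> (forall x, 0 <= f x) ->
  (\int[mu]_(y in `[(q - n%:R)%R, (q + n%:R)%R]) (f y)%:E)%E @[n --> \oo] -->
  (\int[mu]_y (f y)%:E)%E.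
Proof.
move=> mf f0.
have -> : [set: R] = \bigcup_n `[q - n%:R, q + n%:R]%classic.
  apply/esym; rewrite -subTset => x _.
  exists (Num.bound `|x - q|) => //=; rewrite in_itv/=.
  have := archi_boundP (normr_ge0 (x - q)); rewrite ltr_norml; lra.
apply: (@ge0_nondecreasing_set_cvg_integral _ (measurableTypeR R) _ (fun n : nat => `[q - n%:R, q + n%:R]%classic)
   (fun y => (f y)%:E) mu) => //.
- move=> m n mn; apply/subsetPset => x /=; rewrite !in_itv/=.
  have : m%:R <= n%:R :> R by rewrite ler_nat.
  move: (m%:R : R) (n%:R : R) => u v; lra.
- by move=> n; apply/measurable_EFinP; apply: measurable_funTS.
- by move=> n x _; rewrite lee_fin.
Qed.

Lemma rcont_measurable (f : R -> R) : (forall x, rcont f x) -> measurable_fun setT f.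
Proof. by move=> h; apply: continuous_measurable_fun => x; exact: h. Qed.

Lemma cvg_rint_exhaust (f : R -> R) q : (forall x, rcont f x) -> (forall x, 0 <= f x) ->
  (rint f (q - n%:R) (q + n%:R))%:E @[n --> \oo] --> (\int[mu]_y (f y)%:E)%E.
Proof.
move=> cf f0; have := ge0_integral_exhaust q (rcont_measurable cf) f0.
rewrite (_ : (fun n => _) = (fun n => (rint f (q - n%:R) (q + n%:R))%:E))//.
by apply/funext => n; apply: EFin_rint => y _; exact: cf.
Qed.

Lemma rint_pker t q S : 0 < t -> 0 < S ->
  rint (fun y => pker t (y - q)) (q - S) (q + S) = 2 * atan (S / t).
Proof.
move=> t0 S0; have cf : contitv (fun y => pker t (y - q)) (q - S) (q + S).
  by move=> y _; exact: rcont_pker.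
pose F y := atan ((y - q) / t).
have dF y : is_derive y 1 F (pker t (y - q)).
  have d1 : is_derive y 1 (fun y : R => (y - q) / t) t^-1.
    by apply: is_derive_eq; rewrite subr0 scaler0 add0r /GRing.scale /= mulr1.
  have := @is_derive1_comp R atan (fun y : R => (y - q) / t) y _ _ (is_derive1_atan _) d1.
  rewrite /F; move/is_derive_eq; apply.
  rewrite /pker; field; rewrite !gt_eqF ?pker_den_gt0//.
have cF y : F x @[x --> y] --> F y.
  by apply: differentiable_continuous; apply/derivable1_diffP; case: (dF y).
apply: EFin_inj; rewrite -EFin_rint//.
rewrite (@continuous_FTC2 _ _ F); first last.
- by move=> y _; rewrite derive1E; case: (dF y).
- split.
  + by move=> y _; case: (dF y).
  + by apply: cvg_at_right_filter; exact: cF.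
  + by apply: cvg_at_left_filter; exact: cF.
- by apply: continuous_in_subspaceT => y; rewrite inE/= in_itv/=; exact: cf.
- by lra.
rewrite -EFinB /F; congr EFin.
have -> : q + S - q = S by ring.
have -> : q - S - q = - S by ring.
by rewrite mulNr atanN; ring.
Qed.

Lemma cvg_rint_pker t q : 0 < t ->
  rint (fun y => pker t (y - q)) (q - n%:R) (q + n%:R) @[n --> \oo] --> (pi : R).
Proof.
move=> t0; rewrite (_ : pi = 2 * (pi / 2)); last by field.
have ti : 0 < t^-1 by rewrite invr_gt0.
have h : (2 * atan (n%:R / t)) @[n --> \oo] --> (2 * (pi / 2) : R).
  apply: cvgM; first exact: cvg_cst.
  have h1 : (x * t^-1) @[x --> +oo%R] --> +oo%R by apply: gt0_cvgMly.
  exact: (cvg_comp _ _ (@cvgr_idn R) (cvg_comp _ _ h1 (@cvgy_atan R))).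
apply: cvg_trans h; apply: near_eq_cvg; near=> n.
rewrite rint_pker// ltr0n; near: n; by exists 1%N.
Unshelve. all: by end_near. Qed.

Lemma integral_pker t q : 0 < t -> (\int[mu]_y (pker t (y - q))%:E)%E = (pi : R)%:E.
Proof.
move=> t0; have c y : rcont (fun y => pker t (y - q)) y by exact: rcont_pker.
have h1 := cvg_rint_exhaust q c (fun y => pker_ge0 (y - q) t0).
apply: (cvg_unique _ h1) => //.
by apply: cvg_EFin; [exact: nearW|exact: cvg_rint_pker].
Qed.

Section representation.
Variables (G : R[i] -> R[i]) (a x0 K t q : R).
Hypotheses (ax : a < x0) (hG : forall z, a < complex.Re z -> cdiff G z).
Hypotheses (hK : forall z, x0 <= complex.Re z -> normc (G z) <= K) (t0 : 0 < t).

Let u y := complex.Im (G (x0 +i* y)).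
Let u0 := complex.Im (G ((x0 + t) +i* q)).

Let cu y : rcont u y.
Proof. by apply: ccont_Im_vert; apply/cdiff_ccont/hG. Qed.

Let cp y : rcont (fun y => pker t (y - q)) y. Proof. exact: rcont_pker. Qed.

Let A n := rint (fun y => pker t (y - q) * (u y - u0)) (q - n%:R) (q + n%:R).
Let k n := rint (fun y => pker t (y - q)) (q - n%:R) (q + n%:R).

Let A0 : A n @[n --> \oo] --> (0 : R).
Proof.
have K0 : 0 <= 12 * K * t.
  rewrite mulr_ge0 ?(ltW t0)// mulr_ge0//.
  by apply: le_trans (normc_ge0 _) (hK (z := x0%:C) _); rewrite /=.
apply/cvgrPdist_le => e e0; near=> n; rewrite sub0r normrN.
have n0 : (0 : R) < n%:R by rewrite ltr0n; near: n; exists 1%N.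
apply: le_trans (poisson_rect (S := n%:R) q ax hG hK t0 _) _.
  by near: n; exact: nbhs_infty_ger.
rewrite ler_pdivrMr// -ler_pdivrMl//.
by near: n; exact: nbhs_infty_ger.
Unshelve. all: by end_near. Qed.

(** The truncated integrals [A n] tend to zero by [poisson_rect]; for nonnegative
   boundary values monotone convergence identifies the full integral. *)
Lemma poisson_nonneg : (forall y, 0 <= u y) ->
  (\int[mu]_y (pker t (y - q) * u y)%:E)%E = (pi * u0)%:E.
Proof.
move=> u_ge0.
have c y : rcont (fun y => pker t (y - q) * u y) y by apply: cvgM; [exact: cp|exact: cu].
have h1 := cvg_rint_exhaust q c
  (fun y => mulr_ge0 (pker_ge0 (y - q) t0) (u_ge0 y)).
apply: (cvg_unique _ h1) => //.
suff hr : (fun n : nat => rint (fun y => pker t (y - q) * u y) (q - n%:R) (q + n%:R)) @ \oo -->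
    (pi * u0 : R) by apply: cvg_EFin; [exact: nearW|exact: hr].
have -> : (fun n : nat => rint (fun y => pker t (y - q) * u y) (q - n%:R) (q + n%:R)) =
    (fun n => A n + k n * u0).
  apply/funext => n; rewrite /A /k /rint -RintegralZr//; last first.
    by apply: contitv_integrable => y _; exact: cp.
  rewrite -RintegralD//.
  - by apply: eq_Rintegral => y _; rewrite /=; ring.
  - apply: contitv_integrable => y _; apply: cvgM; first exact: cp.
    by apply: cvgB; [exact: cu|exact: cvg_cst].
  - by apply: contitv_integrable => y _; apply: cvgM; [exact: cp|exact: cvg_cst].
rewrite -[pi * u0]add0r; apply: cvgD; first exact: A0.
by apply: cvgM; [exact: cvg_rint_pker|exact: cvg_cst].
Qed.

(** Jensen's inequality for the Poisson kernel, in the form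
   [u ^ 2 >= 2 u0 (u - u0) + u0 ^ 2] multiplied by the kernel and integrated. *)
Lemma poisson_sqr :
  ((pi * u0 ^+ 2)%:E <= \int[mu]_y (pker t (y - q) * u y ^+ 2)%:E)%E.
Proof.
have c y : rcont (fun y => pker t (y - q) * u y ^+ 2) y.
  apply: cvgM; first exact: cp.
  by under eq_fun do rewrite expr2; rewrite expr2; apply: cvgM; exact: cu.
have c1 y : rcont (fun y => pker t (y - q) * (u y - u0)) y.
  by apply: cvgM; [exact: cp|apply: cvgB; [exact: cu|exact: cvg_cst]].
have f0 y : 0 <= pker t (y - q) * u y ^+ 2 by rewrite mulr_ge0 ?sqr_ge0// pker_ge0.
have h1 := cvg_rint_exhaust q c f0.
have h2 : ((2 * u0 * A n + k n * u0 ^+ 2)%:E)%E @[n --> \oo] --> (pi * u0 ^+ 2)%:E.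
  suff hr : (2 * u0 * A n + k n * u0 ^+ 2) @[n --> \oo] --> (pi * u0 ^+ 2 : R).
    by apply: cvg_EFin; [exact: nearW|exact: hr].
  rewrite -[pi * _]add0r -[X in X + _](mulr0 (2 * u0)).
  by apply: cvgD; apply: cvgM; [exact: cvg_cst|exact: A0|exact: cvg_rint_pker|exact: cvg_cst].
rewrite -(cvg_lim _ h1)// -(cvg_lim _ h2)//.
apply: lee_lim; [by apply: cvgP h2|by apply: cvgP h1|apply: nearW => n].
rewrite lee_fin /A /k /rint.
rewrite -RintegralZr//; last by apply: contitv_integrable => y _; exact: cp.
rewrite -RintegralZl//; last by apply: contitv_integrable => y _; exact: c1.
have c2 y : rcont (fun y => 2 * u0 * (pker t (y - q) * (u y - u0))) y.
  by apply: cvgM; [exact: cvg_cst|exact: c1].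
have c3 y : rcont (fun y => pker t (y - q) * u0 ^+ 2) y.
  by apply: cvgM; [exact: cp|exact: cvg_cst].
rewrite -RintegralD//; [|by apply: contitv_integrable => y _; exact: c2
  |by apply: contitv_integrable => y _; exact: c3].
apply: le_Rintegral => //.
- by apply: contitv_integrable => y _; apply: cvgD; [exact: c2|exact: c3].
- by apply: contitv_integrable => y _; exact: c.
move=> y _ /=; have p0 := pker_ge0 (y - q) t0.
rewrite -subr_ge0.
have -> : pker t (y - q) * u y ^+ 2 -
   (2 * u0 * (pker t (y - q) * (u y - u0)) + pker t (y - q) * u0 ^+ 2) =
   pker t (y - q) * (u y - u0) ^+ 2 by ring.
by rewrite mulr_ge0 ?sqr_ge0.
Qed.

End representation.

Lemma Im_iM (w : R[i]) : complex.Im ('i%C * w) = complex.Re w.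
Proof. by case: w => x y /=; rewrite mul0r mul1r add0r. Qed.

Lemma normc_iM (w : R[i]) : normc ('i%C * w) = normc w.
Proof. by rewrite normcM /normc /= expr0n /= expr1n add0r sqrtr1 mul1r. Qed.

Lemma cdiff_iM G z : cdiff G z -> cdiff (fun s => 'i%C * G s) z.
Proof. by move=> h; exact: (cdiffM (@cdiff_cst _ 'i%C z) h). Qed.

Lemma poisson_normc2 G a x0 K t q : a < x0 -> (forall z, a < complex.Re z -> cdiff G z) ->
  (forall z, x0 <= complex.Re z -> normc (G z) <= K) -> 0 < t ->
  ((pi * normc (G ((x0 + t) +i* q)) ^+ 2)%:E <=
   \int[mu]_y (pker t (y - q) * normc (G (x0 +i* y)) ^+ 2)%:E)%E.
Proof.
move=> ax hG hK t0.
have h1 := poisson_sqr q ax hG hK t0.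
have hiG z : a < complex.Re z -> cdiff (fun s => 'i%C * G s) z by move=> /hG; exact: cdiff_iM.
have hiK z : x0 <= complex.Re z -> normc ('i%C * G z) <= K by rewrite normc_iM; exact: hK.
have h2 := poisson_sqr q ax hiG hiK t0.
rewrite Im_iM in h2.
have cG y : ccont G (x0 +i* y) by apply/cdiff_ccont/hG.
have m (v : R -> R) : (forall y, rcont v y) ->
    measurable_fun setT (fun y => (pker t (y - q) * v y ^+ 2)%:E).
  move=> cv; apply/measurable_EFinP; apply: rcont_measurable => y.
  apply: cvgM; first exact: rcont_pker.
  by under eq_fun do rewrite expr2; rewrite expr2; apply: cvgM; exact: cv.
have p0 y (v : R) : (0 <= (pker t (y - q) * v ^+ 2)%:E)%E.
  by rewrite lee_fin mulr_ge0 ?sqr_ge0 ?pker_ge0.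
under eq_integral do rewrite sqr_normc_Re_Im mulrDr EFinD.
rewrite ge0_integralD//; last 2 first.
- by apply: m => y; exact: ccont_Re_vert.
- by apply: m => y; exact: ccont_Im_vert.
rewrite sqr_normc_Re_Im mulrDr EFinD leeD//.
by under eq_integral do rewrite -Im_iM.
Qed.

(** By Poisson's formula, [pi * Re (g (x + t))] is the integral of [Re g] on the line
   of abscissa [x] against a kernel which, on [[- n, n]], is nearly [1 / t] for large
   [t]: multiplying by [t] bounds the mass of [[- n, n]] for every [n]. *)
Lemma mass_le_radial_limit (g : R[i] -> R[i]) (a l : R) : 0 <= a -> 0 <= l ->
  (forall z, a < complex.Re z -> cdiff g z) ->
  (forall z, a < complex.Re z -> 0 <= complex.Re (g z)) ->
  (forall x, a < x -> exists K, forall z, x <= complex.Re z -> normc (g z) <= K) ->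
  (forall e A : R, 0 < e -> exists2 X, A < X & X * complex.Re (g X%:C) <= l + e) ->
  forall x, a < x -> (\int[mu]_y (complex.Re (g (x +i* y)))%:E <= (pi * l)%:E)%E.
Proof.
move=> a0 l0 hg g0 hb hl x ax.
have [K hK] := hb x ax.
have c y : rcont (fun y => complex.Re (g (x +i* y))) y.
  by apply: ccont_Re_vert; apply/cdiff_ccont/hg.
have f0 y : 0 <= complex.Re (g (x +i* y)) by exact: g0.
have h1 := cvg_rint_exhaust 0 c f0.
rewrite -(cvg_lim _ h1)//; apply: lime_le; first by apply: cvgP h1.
apply: nearW => n; rewrite lee_fin sub0r add0r.
set I := rint _ _ _.
have n_ge0 : (0 : R) <= n%:R by [].
have I0 : 0 <= I by apply: Rintegral_ge0 => y _; exact: f0.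
have key e : 0 < e -> I <= pi * ((l + e) * (1 + e)).
  move=> e0.
  have [X hX hXl] := hl e (x + 1 + n%:R ^+ 2 / e) e0.
  pose t := X - x.
  have ne0 : 0 <= n%:R ^+ 2 / e by rewrite divr_ge0 ?sqr_ge0 ?ltW.
  have t1 : 1 < t by rewrite /t; lra.
  have t0 : 0 < t by lra.
  have tn : n%:R ^+ 2 <= e * t.
    by rewrite mulrC -ler_pdivrMr// /t; lra.
  have hiG z : a < complex.Re z -> cdiff (fun s => 'i%C * g s) z by move=> /hg; exact: cdiff_iM.
  have hiK z : x <= complex.Re z -> normc ('i%C * g z) <= K by rewrite normc_iM; exact: hK.
  have hP := poisson_nonneg 0 ax hiG hiK t0.
  have {}hP : (\int[mu]_y (pker t y * complex.Re (g (x +i* y)))%:E)%E = (pi * complex.Re (g X%:C))%:E.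
    rewrite -[complex.Re (g X%:C)]Im_iM (_ : X%:C = (x + t) +i* 0); last first.
      by rewrite /t addrC subrK.
    rewrite -hP; first by apply: eq_integral => y _; rewrite subr0 Im_iM.
    by move=> y; rewrite Im_iM; exact: f0.
  have cpk y : rcont (fun y => pker t y * complex.Re (g (x +i* y))) y.
    have hp : rcont (pker t) y.
      rewrite (_ : pker t = (fun y => pker t (y - 0))); first exact: rcont_pker.
      by apply/funext => y'; rewrite subr0.
    by apply: cvgM; [exact: hp|exact: c].
  have h2 : rint (fun y => pker t y * complex.Re (g (x +i* y))) (- n%:R) n%:R <=
      pi * complex.Re (g X%:C).
    rewrite -lee_fin -hP -(EFin_rint (fun y _ => cpk y)).
    apply: ge0_subset_integral => //.
      by apply/measurable_EFinP; exact: rcont_measurable.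
    by move=> y _; rewrite lee_fin mulr_ge0 ?pker_ge0.
  have h3 : t / (t ^+ 2 + n%:R ^+ 2) * I <= rint (fun y => pker t y * complex.Re (g (x +i* y))) (- n%:R) n%:R.
    rewrite /I /rint -RintegralZl//; last by apply: contitv_integrable => y _; exact: c.
    apply: le_Rintegral => //.
    - apply: contitv_integrable => y _; apply: cvgM; [exact: cvg_cst|exact: c].
    - by apply: contitv_integrable => y _; exact: cpk.
    move=> y; rewrite /= in_itv/= => hy; rewrite ler_wpM2r// /pker.
    rewrite ler_wpM2l ?(ltW t0)// lef_pV2 ?posrE ?pker_den_gt0// lerD2l.
    by rewrite -(real_normK (num_real y)) lerXn2r ?nnegrE// ler_norml.
  have h4 := le_trans h3 h2.
  have den := pker_den_gt0 n%:R t0.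
  rewrite mulrAC ler_pdivrMr// in h4.
  have pi0 := @pi_gt0 R.
  have X0 : 0 < X by rewrite /t in t0; lra.
  have h5 : t ^+ 2 + n%:R ^+ 2 <= (1 + e) * (t * X).
    have : t * 1 <= t * t by rewrite ler_wpM2l// ltW.
    have : 0 <= t * x by rewrite mulr_ge0 ?ltW// (le_lt_trans a0).
    have -> : X = t + x by rewrite /t subrK.
    rewrite expr2; nra.
  have gX : 0 <= complex.Re (g X%:C) by apply: g0 => /=; lra.
  have h6 : t * I <= t * (pi * ((l + e) * (1 + e))).
    apply: le_trans h4 _.
    apply: (@le_trans _ _ (pi * complex.Re (g X%:C) * ((1 + e) * (t * X)))).
      by rewrite ler_wpM2l// mulr_ge0// ltW.
    have -> : pi * complex.Re (g X%:C) * ((1 + e) * (t * X)) =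
      t * (pi * (1 + e)) * (X * complex.Re (g X%:C)) by ring.
    have -> : t * (pi * ((l + e) * (1 + e))) = t * (pi * (1 + e)) * (l + e) by ring.
    by rewrite ler_wpM2l// !mulr_ge0 ?ltW//; lra.
  by rewrite ler_pM2l in h6.
have pi0 := @pi_gt0 R.
apply/ler_addgt0Pr => d d0.
pose e := Num.min 1 (d / (pi * (l + 2))).
have C0 : 0 < pi * (l + 2) by rewrite mulr_gt0//; lra.
have e0 : 0 < e by rewrite lt_min ltr01 divr_gt0.
have e1 : e <= 1 by rewrite ge_min lexx.
have e2 : e * (pi * (l + 2)) <= d by rewrite -ler_pdivlMr// ge_min lexx orbT.
apply: le_trans (key e e0) _.
apply: (@le_trans _ _ (pi * l + e * (pi * (l + 2)))); last by lra.
have -> : pi * l + e * (pi * (l + 2)) = pi * (l + e * (l + 2)) by ring.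
by rewrite ler_wpM2l ?(ltW pi0)//; nra.
Qed.

(** Poisson's formula with the kernel bounded by its maximum [1 / t]. *)
Lemma Re_le_radial_limit (g : R[i] -> R[i]) (a l : R) : 0 <= a -> 0 <= l ->
  (forall z, a < complex.Re z -> cdiff g z) ->
  (forall z, a < complex.Re z -> 0 <= complex.Re (g z)) ->
  (forall x, a < x -> exists K, forall z, x <= complex.Re z -> normc (g z) <= K) ->
  (forall e A : R, 0 < e -> exists2 X, A < X & X * complex.Re (g X%:C) <= l + e) ->
  forall x t q, a < x -> 0 < t -> complex.Re (g ((x + t) +i* q)) <= l / t.
Proof.
move=> a0 l0 hg g0 hb hl x t q ax t0.
have hm := mass_le_radial_limit a0 l0 hg g0 hb hl ax.
have [K hK] := hb x ax.
have c y : rcont (fun y => complex.Re (g (x +i* y))) y.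
  by apply: ccont_Re_vert; apply/cdiff_ccont/hg.
have f0 y : 0 <= complex.Re (g (x +i* y)) by exact: g0.
have hiG z : a < complex.Re z -> cdiff (fun s => 'i%C * g s) z by move=> /hg; exact: cdiff_iM.
have hiK z : x <= complex.Re z -> normc ('i%C * g z) <= K by rewrite normc_iM; exact: hK.
have := poisson_nonneg q ax hiG hiK t0.
rewrite Im_iM => hP.
have pi0 := @pi_gt0 R.
rewrite -(ler_pM2l pi0) -lee_fin -hP; last by move=> y; rewrite Im_iM.
rewrite mulrA EFinM muleC.
apply: (@le_trans _ _ ((t^-1)%:E * \int[mu]_y (complex.Re (g (x +i* y)))%:E)%E); last first.
  by rewrite lee_wpmul2l// lee_fin invr_ge0 ltW.
rewrite -ge0_integralZl//; last 3 first.
- by apply/measurable_EFinP; exact: rcont_measurable.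
- by move=> y _; rewrite lee_fin.
- by rewrite lee_fin invr_ge0 ltW.
apply: ge0_le_integral => //.
- by move=> y _; rewrite lee_fin Im_iM mulr_ge0 ?pker_ge0.
- apply/measurable_EFinP; apply: rcont_measurable => y.
  by under eq_fun do rewrite Im_iM; apply: cvgM; [exact: rcont_pker|exact: c].
- apply: measurable_funeM; apply/measurable_EFinP; exact: rcont_measurable.
- by move=> y _; rewrite -EFinM lee_fin Im_iM ler_wpM2r// pker_le.
Qed.

End poisson_line.

(** * Measurability in the plane *)


Section plane_measurability.
Context {R : realType}.
Notation mR := (measurableTypeR R).
Notation mu := (@lebesgue_measure R).

Let close_via (e d q x y : R) : e < d / 2 -> x - e < q < x + e -> q - e < y < q + e ->
  `|y - x| < d.
Proof. by move=> ? /andP[? ?] /andP[? ?]; rewrite ltr_norml; lra. Qed.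

Let sym_itv (e q x : R) : x - e < q < x + e -> q - e < x < q + e.
Proof. by move=> /andP[? ?]; apply/andP; split; lra. Qed.

(** An open subset of the plane is the union of the squares with rational centres
   and radii [1 / (n + 1)] that it contains. *)
Lemma measurable_box_open (U : set (mR * mR)) :
  (forall p, U p -> exists2 d : R, 0 < d &
     forall p', `|p'.1 - p.1| < d -> `|p'.2 - p.2| < d -> U p') ->
  measurable U.
Proof.
move=> hU.
pose box (i : rat * rat * nat) : set (mR * mR) :=
  `]ratr i.1.1 - i.2.+1%:R^-1, ratr i.1.1 + i.2.+1%:R^-1[ `*`
  `]ratr i.1.2 - i.2.+1%:R^-1, ratr i.1.2 + i.2.+1%:R^-1[.
pose V i := if pselect (box i `<=` U) then box i else set0.
have -> : U = \bigcup_i V i.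
  apply/seteqP; split=> [p Up|p [i _]]; last by rewrite /V; case: pselect => // h /h.
  have [d d0 hd] := hU p Up.
  have [n hn] : exists n : nat, n.+1%:R^-1 < d / 2.
    exists (Num.bound (2 / d)); rewrite invf_plt ?posrE ?divr_gt0//.
    by rewrite invf_div (lt_le_trans (archi_boundP _))// ?ler_nat// divr_ge0// ltW.
  have e0 : 0 < n.+1%:R^-1 :> R by rewrite invr_gt0.
  set e : R := n.+1%:R^-1 in hn e0.
  have pe1 : p.1 - e < p.1 + e by lra.
  have [q1 hq1] := rat_in_itvoo pe1; rewrite in_itv/= in hq1.
  have pe2 : p.2 - e < p.2 + e by lra.
  have [q2 hq2] := rat_in_itvoo pe2; rewrite in_itv/= in hq2.
  have bU : box (q1, q2, n) `<=` U.
    move=> p' /= [] /=; rewrite !in_itv/= -/e => h1 h2.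
    by apply: hd; [exact: (close_via hn hq1 h1)|exact: (close_via hn hq2 h2)].
  exists (q1, q2, n) => //; rewrite /V; case: pselect => // hbU.
  by split => /=; rewrite in_itv/= -/e; apply: sym_itv.
apply: (@countable_bigcupT_measurable _ _ (rat * rat * nat)%type); first exact: (countableP [set: rat * rat * nat]).
move=> i; rewrite /V; case: pselect => hbU /=; [rewrite /box|exact: measurable0]; apply: measurableX; exact: measurable_itv.
Qed.

(** Applied to the modulus of a function extended by zero, which may be
   discontinuous at the boundary of the half-plane. *)
Lemma measurable_halfplane_fun (a : R) (g : mR * mR -> R) :
  (forall p, a < p.1 -> forall e, 0 < e -> exists2 d : R, 0 < d &
     forall p', `|p'.1 - p.1| < d -> `|p'.2 - p.2| < d -> `|g p' - g p| < e) ->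
  (forall p, p.1 <= a -> g p = 0) ->
  measurable_fun setT g.
Proof.
move=> hc h0 mD; apply: (measurability _ (RGenOInfty.measurableE R)) => //.
move=> _ [_ [c ->] <-]; rewrite setTI.
have mU : measurable [set p : mR * mR | a < p.1 /\ c < g p].
  apply: measurable_box_open => p /= [ap cp].
  have [d d0 hd] := hc p ap (g p - c) ltac:(lra).
  exists (Num.min d (p.1 - a)); first by rewrite lt_min d0 subr_gt0.
  move=> p'; rewrite lt_min => /andP[h1 h2]; rewrite lt_min => /andP[h3 _].
  have := hd p' h1 h3; move: h2; rewrite !ltr_norml; lra.
have [c0|c0] := leP 0 c.
  rewrite (_ : _ @^-1` _ = [set p : mR * mR | a < p.1 /\ c < g p])//.
  apply/seteqP; split=> p /=; rewrite in_itv/= andbT; last by case.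
  by move=> cp; split=> //; rewrite ltNge; apply/negP => /h0 gp; move: cp; rewrite gp; lra.
rewrite (_ : _ @^-1` _ = [set p : mR * mR | a < p.1 /\ c < g p] `|` (`]-oo, a]%classic `*` setT)).
  by apply: measurableU => //; apply: measurableX => //; exact: measurable_itv.
apply/seteqP; split=> p /=; rewrite !in_itv/= ?andbT.
  by move=> cp; have [ap|pa] := ltP a p.1; [left|right].
by move=> [[]//|[pa _]]; rewrite h0.
Qed.

Lemma lebesgue_shift (c s : R) (h : R -> \bar R) : `|s| = 1 -> measurable_fun setT h ->
  (forall x, (0 <= h x)%E) -> (\int[mu]_x h (c + s * x)%R = \int[mu]_x h x)%E.
Proof.
move=> s1 mh h0.
have mphi : measurable_fun setT (fun x : mR => c + s * x : mR).
  by apply: measurable_funD => //; apply: measurable_funM.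
have := @ge0_integral_pushforward _ _ mR mR R _ mphi mu setT h measurableT mh (fun y _ => h0 y).
rewrite preimage_setT => <-.
apply: eq_measure_integral => /= A mA _; apply/esym.
apply: (lebesgue_measure_unique (mu := pushforward mu (fun x : mR => c + s * x : mR))) => // X.
move=> [[a b] _ <-].
rewrite -[LHS]/(mu `]a, b]%classic) -[RHS]/(mu ((fun x : R => c + s * x) @^-1` `]a, b]%classic)).
have [ab|ba] := leP a b; last first.
  rewrite set_itv_ge ?preimage_set0//; by rewrite bnd_simp -leNgt ltW.
have s2 : s = 1 \/ s = -1.
  have : s ^+ 2 = 1 by rewrite -(real_normK (num_real s)) s1 expr1n.
  by move/eqP; rewrite sqrf_eq1 => /orP[/eqP|/eqP]; [left|right].
case: s2 => ->.
  rewrite [X in _ = mu X](_ : _ = `]a - c, b - c]%classic); last first.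
    by apply/seteqP; split=> x /=; rewrite !in_itv/= mul1r; lra.
  rewrite !lebesgue_measure_itv/= !lte_fin ltrD2r; case: ltP => // _.
  by congr EFin; ring.
rewrite [X in _ = mu X](_ : _ = `[c - b, c - a[%classic); last first.
  by apply/seteqP; split=> x /=; rewrite !in_itv/= mulN1r; lra.
rewrite !lebesgue_measure_itv/= !lte_fin ltrD2l ltrN2; case: ltP => // _.
by congr EFin; ring.
Qed.

End plane_measurability.

(** * The mean value inequality on squares *)


Section square_mean.
Context {R : realType}.
Implicit Types (f : R[i] -> R[i]) (t u x y m : R).

(** With [f z = m], each side of the square contributes to the vanishing integral of
   [(f s - m) / (s - z)] at least [m - (integral of |f|) / t], because the kernel
   [t / (t ^ 2 + u ^ 2)] lies between [1 / (2 t)] and [1 / t] there. *)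
Let side_bound (w : R[i]) m t u : 0 < t -> 0 <= m -> `|u| <= t ->
  m / (2 * t) - normc w / t <= - complex.Re ((w - m%:C) / (t +i* u)).
Proof.
move=> t0 m0 ut; rewrite mulrBl ReB opprB.
have u2 : u ^+ 2 <= t ^+ 2.
  by rewrite -(real_normK (num_real u)) lerXn2r ?nnegrE// ltW.
have den : 0 < t ^+ 2 + u ^+ 2 by exact: pker_den_gt0.
apply: lerB.
  have -> : complex.Re (m%:C / (t +i* u)) = m * (t / (t ^+ 2 + u ^+ 2)).
    by rewrite /=; ring.
  rewrite ler_wpM2l// -[(2 * t)^-1]mul1r ler_pdivlMr// mul1r mulrC.
  rewrite ler_pdivrMr; last by lra.
  by rewrite expr2 in u2 *; lra.
apply: le_trans (ler_norm _) _; apply: le_trans (normc_Re_le _) _.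
rewrite normcM normcV ler_wpM2l ?normc_ge0// lef_pV2 ?posrE//.
  have := normc_Re_le (t +i* u); rewrite /= (ger0_norm (ltW t0)) //.
rewrite normc_gt0; apply/eqP => -[te _]; lra.
Qed.

Let square_mean_real f x0 y0 m t : 0 < t -> 0 <= m ->
  (forall x y, x0 - t <= x <= x0 + t -> y0 - t <= y <= y0 + t -> cdiff f (x +i* y)) ->
  f (x0 +i* y0) = m%:C ->
  4 * m * t <=
  rint (fun x => normc (f (x +i* (y0 - t)))) (x0 - t) (x0 + t) +
  rint (fun x => normc (f (x +i* (y0 + t)))) (x0 - t) (x0 + t) +
  (rint (fun y => normc (f ((x0 - t) +i* y))) (y0 - t) (y0 + t) +
   rint (fun y => normc (f ((x0 + t) +i* y))) (y0 - t) (y0 + t)).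
Proof.
move=> t0 m0 hf fm; set z := x0 +i* y0 in fm.
have hx0 : x0 - t <= x0 <= x0 + t by apply/andP; split; lra.
have hy0 : y0 - t <= y0 <= y0 + t by apply/andP; split; lra.
have [g [cg gE dg]] := difference_quotient (hf x0 y0 hx0 hy0).
rewrite -/z in cg gE dg.
have dg' x y : x0 - t <= x <= x0 + t -> y0 - t <= y <= y0 + t -> x +i* y != z ->
    cdiff (fun s => 'i%C * g s) (x +i* y).
  by move=> hx hy ne; exact: (cdiff_iM (dg _ ne (hf x y hx hy))).
have ccg : ccont (fun s => 'i%C * g s) z.
  have c0 : ccont (fun=> 'i%C : R[i]) z by apply: cdiff_ccont; exact: cdiff_cst.
  exact: ccontM.
have J0 : rect_integral (fun s => 'i%C * g s) (x0 - t) (x0 + t) (y0 - t) (y0 + t) = 0.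
  apply: (@goursat_punctured _ _ _ _ _ _ x0 y0) => //; apply/andP; split; lra.
have hcont : cont_on_rect (fun s => 'i%C * g s) (x0 - t) (x0 + t) (y0 - t) (y0 + t).
  move=> x y hx hy; have [->//|ne] := eqVneq (x +i* y) z.
  by apply: cdiff_ccont; exact: dg'.
have gq x y : x +i* y != z -> g (x +i* y) = (f (x +i* y) - m%:C) / (x +i* y - z).
  by move=> ne; rewrite gE fm addrC addKr mulfK// subr_eq0.
have xt : x0 - t <= x0 + t by lra.
have yt : y0 - t <= y0 + t by lra.
have hxm : x0 - t <= x0 - t <= x0 + t by rewrite lexx.
have hxp : x0 - t <= x0 + t <= x0 + t by rewrite lexx xt.
have hym : y0 - t <= y0 - t <= y0 + t by rewrite lexx.
have hyp : y0 - t <= y0 + t <= y0 + t by rewrite lexx yt.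
have cn_hor y : y0 - t <= y <= y0 + t -> contitv (fun x => normc (f (x +i* y))) (x0 - t) (x0 + t).
  by move=> hy x hx; apply: ccont_normc_hor; apply: cdiff_ccont; exact: hf.
have cn_vert x : x0 - t <= x <= x0 + t -> contitv (fun y => normc (f (x +i* y))) (y0 - t) (y0 + t).
  by move=> hx y hy; apply: ccont_normc; apply: cdiff_ccont; exact: hf.
have cRe y : y0 - t <= y <= y0 + t ->
    contitv (fun x => complex.Re ('i%C * g (x +i* y))) (x0 - t) (x0 + t).
  by move=> hy x hx; apply: (@ccont_Re_hor _ (fun s => 'i%C * g s)); exact: hcont.
have cIm x : x0 - t <= x <= x0 + t ->
    contitv (fun y => complex.Im ('i%C * g (x +i* y))) (y0 - t) (y0 + t).
  by move=> hx y hy; apply: (@ccont_Im_vert _ (fun s => 'i%C * g s)); exact: hcont.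
pose e (w : R -> R) := fun v => m / (2 * t) - w v / t.
have int_e (w : R -> R) b : contitv w (b - t) (b + t) ->
    rint (e w) (b - t) (b + t) = m - rint w (b - t) (b + t) / t.
  move=> cw; rewrite /e rintB; last first.
  - by move=> v hv; apply: cvgM; [exact: cw|exact: cvg_cst].
  - by move=> v hv; exact: cvg_cst.
  congr (_ - _); last by rewrite /rint RintegralZr//; exact: contitv_integrable.
  rewrite /rint Rintegral_cst//= lebesgue_measure_itv/= lte_fin.
  rewrite ifT; last by lra.
  by rewrite -EFinD/=; field; rewrite gt_eqF.
have ce (w : R -> R) b : contitv w (b - t) (b + t) -> contitv (e w) (b - t) (b + t).
  move=> cw v hv; apply: cvgB; first exact: cvg_cst.
  by apply: cvgM; [exact: cw|exact: cvg_cst].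
have mono (v w : R -> R) a b : contitv v a b -> contitv w a b ->
    (forall x, a <= x <= b -> v x <= w x) -> rint v a b <= rint w a b.
  move=> cv cw h; have iv := contitv_integrable cv; have iw := contitv_integrable cw.
  by apply: le_Rintegral => // x; rewrite /= in_itv/=; exact: h.
have opp_rint (v : R -> R) a b : contitv v a b -> rint (fun x => - v x) a b = - rint v a b.
  move=> cv; rewrite /rint -[RHS]mulN1r -RintegralZl//; last exact: contitv_integrable.
  by apply: eq_Rintegral => x _; rewrite mulN1r.
have cN (v : R -> R) a b : contitv v a b -> contitv (fun x => - v x) a b.
  by move=> cv x hx; apply: cvgN; exact: cv.
have hz (x y x' y' : R) : (x +i* y) - (x' +i* y') = (x - x') +i* (y - y') by [].
have nez x y : (x != x0) || (y != y0) -> x +i* y != z.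
  by move=> h; apply/eqP => -[ex ey]; move: h; rewrite ex ey !eqxx.
have it : ('i%C : R[i]) != 0 by rewrite eq_complex /= oner_eq0 andbF.
(* on each side [s - z] is a fourth root of unity times [t + i u] *)
have bot : m - rint (fun x => normc (f (x +i* (y0 - t)))) (x0 - t) (x0 + t) / t <=
    rint (fun x => complex.Re ('i%C * g (x +i* (y0 - t)))) (x0 - t) (x0 + t).
  rewrite -int_e; last exact: cn_hor.
  apply: mono; [by apply: ce; exact: cn_hor|exact: cRe|move=> x hx].
  have ne : x +i* (y0 - t) != z by apply: nez; apply/orP; right; apply/negP => /eqP ?; lra.
  have := @side_bound (f (x +i* (y0 - t))) m t (x - x0) t0 m0 ltac:(rewrite ler_norml; lra).
  move/le_trans; apply; rewrite gq//.
  have -> : x +i* (y0 - t) - z = - 'i%C * (t +i* (x - x0)).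
    by rewrite /z hz; apply/eqP; rewrite eq_complex /=; apply/andP; split; apply/eqP; ring.
  rewrite [- 'i%C * _]mulNr invrN !mulrN invfM mulrCA mulVKf//.
  by case: (_ / _) => ? ? /=.
have top : m - rint (fun x => normc (f (x +i* (y0 + t)))) (x0 - t) (x0 + t) / t <=
    - rint (fun x => complex.Re ('i%C * g (x +i* (y0 + t)))) (x0 - t) (x0 + t).
  rewrite -int_e; last exact: cn_hor.
  rewrite -opp_rint; last exact: cRe.
  apply: mono; [by apply: ce; exact: cn_hor|by apply: cN; exact: cRe|move=> x hx].
  have ne : x +i* (y0 + t) != z by apply: nez; apply/orP; right; apply/negP => /eqP ?; lra.
  have := @side_bound (f (x +i* (y0 + t))) m t (x0 - x) t0 m0 ltac:(rewrite ler_norml; lra).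
  move/le_trans; apply; rewrite gq//.
  have -> : x +i* (y0 + t) - z = 'i%C * (t +i* (x0 - x)).
    by rewrite /z hz; apply/eqP; rewrite eq_complex /=; apply/andP; split; apply/eqP; ring.
  by rewrite invfM mulrCA mulVKf.
have right : m - rint (fun y => normc (f ((x0 + t) +i* y))) (y0 - t) (y0 + t) / t <=
    - rint (fun y => complex.Im ('i%C * g ((x0 + t) +i* y))) (y0 - t) (y0 + t).
  rewrite -int_e; last exact: cn_vert.
  rewrite -opp_rint; last exact: cIm.
  apply: mono; [by apply: ce; exact: cn_vert|by apply: cN; exact: cIm|move=> y hy].
  have ne : (x0 + t) +i* y != z by apply: nez; apply/orP; left; apply/negP => /eqP ?; lra.
  have := @side_bound (f ((x0 + t) +i* y)) m t (y - y0) t0 m0 ltac:(rewrite ler_norml; lra).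
  move/le_trans; apply; rewrite gq// Im_iM.
  have -> // : (x0 + t) +i* y - z = t +i* (y - y0).
  by rewrite /z hz; congr (_ +i* _); ring.
have left : m - rint (fun y => normc (f ((x0 - t) +i* y))) (y0 - t) (y0 + t) / t <=
    rint (fun y => complex.Im ('i%C * g ((x0 - t) +i* y))) (y0 - t) (y0 + t).
  rewrite -int_e; last exact: cn_vert.
  apply: mono; [by apply: ce; exact: cn_vert|exact: cIm|move=> y hy].
  have ne : (x0 - t) +i* y != z by apply: nez; apply/orP; left; apply/negP => /eqP ?; lra.
  have := @side_bound (f ((x0 - t) +i* y)) m t (y0 - y) t0 m0 ltac:(rewrite ler_norml; lra).
  move/le_trans; apply; rewrite gq// Im_iM.
  have -> : (x0 - t) +i* y - z = - (t +i* (y0 - y)).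
    by rewrite /z hz; apply/eqP; rewrite eq_complex /=; apply/andP; split; apply/eqP; ring.
  by rewrite invrN mulrN; case: (_ / _) => ? ? /=.
move: J0; rewrite /rect_integral rintB; [|exact: cRe|exact: cRe].
rewrite rintB; [|exact: cIm|exact: cIm].
set A1 := rint _ _ _ in bot *; set A2 := rint _ _ _ in top *.
set A3 := rint _ _ _ in right *; set A4 := rint _ _ _ in left *.
set B1 := rint _ _ _ in bot *; set B2 := rint _ _ _ in top *.
set B3 := rint _ _ _ in left *; set B4 := rint _ _ _ in right *.
move=> J0; have h : 4 * m <= (A1 + A2 + (A4 + A3)) / t.
  by rewrite !mulrDl; lra.
by rewrite ler_pdivlMr in h.
Qed.

(** Squares replace circles, so that integrals over vertical lines can be used
   directly; a rotation makes [f (x0 +i* y0)] real and nonnegative. *)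
Lemma square_mean f x0 y0 t : 0 < t ->
  (forall x y, x0 - t <= x <= x0 + t -> y0 - t <= y <= y0 + t -> cdiff f (x +i* y)) ->
  4 * normc (f (x0 +i* y0)) * t <=
  rint (fun x => normc (f (x +i* (y0 - t)))) (x0 - t) (x0 + t) +
  rint (fun x => normc (f (x +i* (y0 + t)))) (x0 - t) (x0 + t) +
  (rint (fun y => normc (f ((x0 - t) +i* y))) (y0 - t) (y0 + t) +
   rint (fun y => normc (f ((x0 + t) +i* y))) (y0 - t) (y0 + t)).
Proof.
move=> t0 hf; set w := f (x0 +i* y0).
have [c c1 cw] : exists2 c : R[i], normc c = 1 & c * w = (normc w)%:C.
  have [->|w0] := eqVneq w 0; first by exists 1; rewrite ?normc1// mulr0 normc0.
  have nw : normc w != 0 by rewrite normc_eq0.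
  exists ((normc w)%:C / w); last by rewrite divfK.
  by rewrite normcM normcV normc_real ger0_norm ?normc_ge0// mulfV.
have hcf x y : x0 - t <= x <= x0 + t -> y0 - t <= y <= y0 + t ->
    cdiff (fun s => c * f s) (x +i* y).
  by move=> hx hy; exact: (cdiffM (@cdiff_cst _ c (x +i* y)) (hf x y hx hy)).
have nc : (fun s => normc (c * f s)) = (fun s => normc (f s)).
  by apply/funext => s; rewrite normcM c1 mul1r.
have := square_mean_real t0 (normc_ge0 w) hcf cw.
have nc' s : normc (c * f s) = normc (f s) by rewrite normcM c1 mul1r.
have e (k : R -> R[i]) a b :
    rint (fun x => normc (c * f (k x))) a b = rint (fun x => normc (f (k x))) a b.
  by congr rint; apply/funext => x; rewrite nc'.
rewrite (e (fun x => x +i* (y0 - t))) (e (fun x => x +i* (y0 + t))).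
by rewrite (e (fun y => (x0 - t) +i* y)) (e (fun y => (x0 + t) +i* y)).
Qed.

End square_mean.

(** * Quadratic integrals over vertical lines *)


Lemma measurable_erestrict {R : realType} d {T : measurableType d} (D : set T)
  (f : T -> \bar R) : measurable D -> measurable_fun setT f -> measurable_fun setT (f \_ D).
Proof. by move=> mD mf; apply/(measurable_restrictT f mD); exact: measurable_funTS. Qed.

Section tonelli_rect.
Context {R : realType} d1 d2 {T1 : measurableType d1} {T2 : measurableType d2}.
Variables (m1 : {sigma_finite_measure set T1 -> \bar R})
  (m2 : {sigma_finite_measure set T2 -> \bar R}).
Variables (D1 : set T1) (D2 : set T2) (f : T1 * T2 -> \bar R).
Hypotheses (mD1 : measurable D1) (mD2 : measurable D2).
Hypotheses (mf : measurable_fun setT f) (f0 : forall p, (0 <= f p)%E).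

Let g := f \_ (D1 `*` D2).

Let mg : measurable_fun setT g.
Proof.
by apply: measurable_erestrict => //; exact: measurableX.
Qed.

Let g0 p : (0 <= g p)%E.
Proof. by apply: erestrict_ge0 => q _; exact: f0. Qed.

Let inner1 : (fun x => \int[m2]_y g (x, y))%E = (fun x => \int[m2]_(y in D2) f (x, y))%E \_ D1.
Proof.
apply/funext => x; rewrite patchE; case: ifPn => xD.
  rewrite [RHS]integral_mkcond; apply: eq_integral => y _; rewrite /g !patchE.
  rewrite (_ : ((x, y) \in _) = (y \in D2))//.
  by apply/idP/idP; rewrite !inE /=; [case|move=> ?; split=> //; exact/set_mem].
apply: integral0_eq => y _; rewrite /g patchE ifN//.
by apply/negP; rewrite inE => -[/= /mem_set]; rewrite (negbTE xD).
Qed.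

Let inner2 : (fun y => \int[m1]_x g (x, y))%E = (fun y => \int[m1]_(x in D1) f (x, y))%E \_ D2.
Proof.
apply/funext => y; rewrite patchE; case: ifPn => yD.
  rewrite [RHS]integral_mkcond; apply: eq_integral => x _; rewrite /g !patchE.
  rewrite (_ : ((x, y) \in _) = (x \in D1))//.
  by apply/idP/idP; rewrite !inE /=; [case|move=> ?; split=> //; exact/set_mem].
apply: integral0_eq => x _; rewrite /g patchE ifN//.
by apply/negP; rewrite inE => -[/= _ /mem_set]; rewrite (negbTE yD).
Qed.

Lemma tonelli_rect :
  (\int[m1]_(x in D1) \int[m2]_(y in D2) f (x, y) =
   \int[m2]_(y in D2) \int[m1]_(x in D1) f (x, y))%E.
Proof.
rewrite integral_mkcond [RHS]integral_mkcond -inner1 -inner2.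
exact: (fubini_tonelli g mg g0).
Qed.

Lemma tonelli_rect_prod :
  (\int[m1 \x m2]_(p in D1 `*` D2) f p =
   \int[m1]_(x in D1) \int[m2]_(y in D2) f (x, y))%E.
Proof.
rewrite integral_mkcond [RHS]integral_mkcond -inner1.
exact: (fubini_tonelli1 g mg g0).
Qed.

End tonelli_rect.

Section line_integrals.
Context {R : realType}.
Notation mR := (measurableTypeR R).
Notation mu := (@lebesgue_measure R).
Implicit Types (f : R[i] -> R[i]) (t x y : R).

(** Working with total functions that vanish off the right half-plane avoids the
   subtype; they are exactly the extensions by zero of the analytic functions. *)
Definition hol0 f := (forall z, 0 < complex.Re z -> cdiff f z) /\
  (forall z, complex.Re z <= 0 -> f z = 0).

Definition sqmod f (p : mR * mR) : \bar R := (normc (f (p.1 +i* p.2)) ^+ 2)%:E.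

Definition line_sqint f x : \bar R := (\int[mu]_y sqmod f (x, y))%E.

Lemma sqmod_ge0 f p : (0 <= sqmod f p)%E.
Proof. by rewrite lee_fin sqr_ge0. Qed.

Lemma line_sqint_ge0 f x : (0 <= line_sqint f x)%E.
Proof. by apply: integral_ge0 => y _; exact: sqmod_ge0. Qed.

Lemma measurable_normc f : hol0 f ->
  measurable_fun setT (fun p : mR * mR => normc (f (p.1 +i* p.2))).
Proof.
move=> [hf f0]; apply: (measurable_halfplane_fun (a := 0)) => p hp; last first.
  by rewrite f0 ?normc0.
move=> e e0; have /cdiff_ccont/ccontP := hf (p.1 +i* p.2) hp.
move=> /(_ e e0)[d d0 hd]; exists (d / 2); first by rewrite divr_gt0.
move=> p' h1 h2; apply: le_lt_trans (le_normc_normc _ _) _; apply: hd.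
by apply: le_lt_trans (normc_le_Re_Im _) _ => /=; lra.
Qed.

Lemma measurable_sqmod f : hol0 f -> measurable_fun setT (sqmod f).
Proof.
by move=> hf; apply/measurable_EFinP; apply: measurable_funX; exact: measurable_normc.
Qed.

Lemma measurable_line_sqint f : hol0 f -> measurable_fun setT (line_sqint f).
Proof.
move=> hf; apply: (measurable_fun_fubini_tonelli_F (m2 := mu) (sqmod f)).
  exact: measurable_sqmod.
by move=> p; exact: sqmod_ge0.
Qed.

Lemma measurable_sqmod_line f x : hol0 f -> measurable_fun setT (fun y => sqmod f (x, y)).
Proof. by move=> hf; apply: measurableT_comp (measurable_sqmod hf) _; exact: measurable_fun_pair. Qed.

Lemma measurable_sqmod_hor f y : hol0 f -> measurable_fun setT (fun x => sqmod f (x, y)).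
Proof. by move=> hf; apply: measurableT_comp (measurable_sqmod hf) _; exact: measurable_fun_pair. Qed.

Section bounded.
Variable (f : R[i] -> R[i]).
Hypothesis hf : hol0 f.

(** Square means averaged over the size of the square bound [f] by its
   area integral over a strip. *)
Lemma bounded_by_strip (x0 y0 d : R) (I : R) : 0 < d -> d < x0 ->
  (\int[mu]_(s in `[(x0 - d)%R, (x0 + d)%R]) line_sqint f s <= I%:E)%E ->
  normc (f (x0 +i* y0)) <= 2 + 4 * I / d ^+ 2.
Proof.
move=> d0 dx hI; set m := normc _.
pose J := `[(x0 - d)%R, (x0 + d)%R]%classic : set mR.
pose T := `[(d / 2)%R, d]%classic : set mR.
have mJ : measurable J by exact: measurable_itv.
have mT : measurable T by exact: measurable_itv.
have mL := @measurable_line_sqint f hf.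
have mLJ : measurable_fun J (line_sqint f) := measurable_funTS mL.
have I0 : 0 <= I.
  rewrite -lee_fin; apply: le_trans hI; apply: integral_ge0 => s _.
  exact: line_sqint_ge0.
have [m2|m2] := leP m 2.
  by apply: le_trans m2 _; rewrite lerDl !mulr_ge0// invr_ge0 exprn_ge0// ltW.
pose V s (t : mR) := line_sqint f (x0 + s * t).
pose H s (t : mR) := (\int[mu]_(x in J) sqmod f (x, (y0 + s * t)%R))%E.
have V0 s t : (0 <= V s t)%E by exact: line_sqint_ge0.
have H0 s t : (0 <= H s t)%E by apply: integral_ge0 => x _; exact: sqmod_ge0.
have msh (c s : R) : measurable_fun setT (fun t : mR => c + s * t : mR).
  by apply: measurable_funD => //; apply: measurable_funM.
have mV s : measurable_fun setT (V s) by exact: measurableT_comp (measurable_line_sqint hf) (msh _ _).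
have mphi s : measurable_fun setT (fun p : mR * mR => sqmod f (p.2, (y0 + s * p.1)%R)).
  apply: measurableT_comp (measurable_sqmod hf) _; apply: measurable_fun_pair => //.
  exact: measurableT_comp (msh _ _) _.
have mH s : measurable_fun setT (H s).
  have := measurable_fun_fubini_tonelli_F (m2 := mu)
    ((fun p : mR * mR => sqmod f (p.2, (y0 + s * p.1)%R)) \_ (setT `*` J)).
  have -> : fubini_F mu ((fun p : mR * mR => sqmod f (p.2, (y0 + s * p.1)%R)) \_ (setT `*` J)) = H s.
    apply/funext => t; rewrite /fubini_F /H [RHS]integral_mkcond.
    apply: eq_integral => x _; rewrite !patchE.
    by rewrite (_ : ((t, x) \in _) = (x \in J))//; apply/idP/idP; rewrite !inE /= => -[].
  apply.
    by apply: measurable_erestrict => //; exact: measurableX.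
  by move=> p; apply: erestrict_ge0 => q _; exact: sqmod_ge0.
have TV s : `|s| = 1 -> (\int[mu]_(t in T) V s t <= I%:E)%E.
  move=> s1; apply: le_trans hI; rewrite [leRHS]integral_mkcond.
  rewrite -(@lebesgue_shift R x0 s _ s1); last 2 first.
  - by apply: measurable_erestrict => //; exact: measurable_line_sqint.
  - by move=> x; apply: erestrict_ge0 => q _; exact: line_sqint_ge0.
  rewrite integral_mkcond; apply: ge0_le_integral => //.
  - by move=> x _; apply: erestrict_ge0 => q _.
  - exact: measurable_erestrict.
  - apply: measurableT_comp (msh x0 s).
    by apply: measurable_erestrict => //; exact: measurable_line_sqint.
  move=> t _; rewrite !patchE; case: ifPn => [tT|_]; last first.
    by case: ifP => // _; exact: line_sqint_ge0.
  rewrite ifT//; move: tT; rewrite !inE /T /J /= !in_itv/= => /andP[t1 t2].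
  have : `|s * t| <= d by rewrite normrM s1 mul1r ger0_norm//; lra.
  by rewrite ler_norml; lra.
have TH s : `|s| = 1 -> (\int[mu]_(t in T) H s t <= I%:E)%E.
  move=> s1; apply: le_trans hI; rewrite /H.
  have -> : (\int[mu]_(t in T) \int[mu]_(x in J) sqmod f (x, (y0 + s * t)%R) =
      \int[mu]_(x in J) \int[mu]_(t in T) sqmod f (x, (y0 + s * t)%R))%E.
    apply: (tonelli_rect mu mu
      (f := fun p : mR * mR => sqmod f (p.2, (y0 + s * p.1)%R))) => //.
    by move=> p; exact: sqmod_ge0.
  apply: ge0_le_integral => //.
  - by move=> x _; apply: integral_ge0 => t _; exact: sqmod_ge0.
  - apply: measurable_funTS.
    have := measurable_fun_fubini_tonelli_F (m2 := mu)
      ((fun p : mR * mR => sqmod f (p.1, (y0 + s * p.2)%R)) \_ (setT `*` T)).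
    have -> : fubini_F mu ((fun p : mR * mR => sqmod f (p.1, (y0 + s * p.2)%R)) \_ (setT `*` T)) =
        (fun x => \int[mu]_(t in T) sqmod f (x, (y0 + s * t)%R))%E.
      apply/funext => t; rewrite /fubini_F [RHS]integral_mkcond.
      apply: eq_integral => x _; rewrite !patchE.
      by rewrite (_ : ((t, x) \in _) = (x \in T))//; apply/idP/idP; rewrite !inE /= => -[].
    apply.
      apply: measurable_erestrict; first exact: measurableX.
      apply: measurableT_comp (measurable_sqmod hf) _.
      by apply: measurable_fun_pair => //; exact: measurableT_comp (msh _ _) _.
    by move=> p; apply: erestrict_ge0 => q _; exact: sqmod_ge0.
  move=> x _; rewrite /line_sqint -(@lebesgue_shift R y0 s _ s1); last 2 first.
  - exact: measurable_sqmod_line.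
  - by move=> y; exact: sqmod_ge0.
  apply: ge0_subset_integral => //.
    by apply: measurableT_comp (@measurable_sqmod_line f x hf) (msh _ _).
  by move=> y _; exact: sqmod_ge0.
have pt (t : R) : T t -> ((2 * d * (m - 2))%:E <= H (-1)%R t + H 1%R t + (V (-1)%R t + V 1%R t))%E.
  rewrite /T /= in_itv/= => /andP[t1 t2].
  have t0 : 0 < t by lra.
  have hsq x y : x0 - t <= x <= x0 + t -> y0 - t <= y <= y0 + t -> cdiff f (x +i* y).
    by move=> /andP[? ?] _; apply: hf.1 => /=; lra.
  have := square_mean t0 hsq.
  have le1 (k : R -> R[i]) a b : a <= b -> contitv (fun x => normc (f (k x))) a b ->
      ((rint (fun x => normc (f (k x))) a b)%:E <=
       (b - a)%:E + \int[mu]_(x in `[a, b]) (normc (f (k x)) ^+ 2)%:E)%E.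
    move=> ab ck.
    have c2 : contitv (fun x => normc (f (k x)) ^+ 2) a b.
      move=> x hx; under eq_fun do rewrite expr2.
      by rewrite /rcont /= ; apply: (@continuousM R R (fun x => normc (f (k x)))); exact: ck.
    rewrite (EFin_rint c2) -EFinD lee_fin.
    have -> : b - a = rint (fun=> 1) a b.
      rewrite /rint Rintegral_cst//= lebesgue_measure_itv/= lte_fin mul1r.
      by case: ltP => //= ba; lra.
    have c1 : contitv (fun=> 1 : R) a b by move=> x _; exact: cvg_cst.
    have i1 := contitv_integrable c1; have i2 := contitv_integrable c2.
    have ik := contitv_integrable ck.
    rewrite /rint -RintegralD//; apply: le_Rintegral => //.
      apply: contitv_integrable => x hx; apply: cvgD; [exact: c1|exact: c2].
    by move=> x _ /=; have := sqr_ge0 (normc (f (k x)) - 1); nra.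
  have ch y : contitv (fun x => normc (f (x +i* y))) (x0 - t) (x0 + t).
    by move=> x /andP[? ?]; apply: ccont_normc_hor; apply/cdiff_ccont/hf.1 => /=; lra.
  have cv x : 0 < x -> contitv (fun y => normc (f (x +i* y))) (y0 - t) (y0 + t).
    by move=> hx y _; apply: ccont_normc; apply/cdiff_ccont/hf.1.
  have xt : x0 - t <= x0 + t by lra.
  have yt : y0 - t <= y0 + t by lra.
  have hH (s y : R) : y = y0 + s * t ->
      ((rint (fun x => normc (f (x +i* y))) (x0 - t) (x0 + t))%:E <= (2 * t)%:E + H s t)%E.
    move=> ->; apply: le_trans (le1 (fun x => x +i* _) _ _ xt (ch _)) _.
    have -> : x0 + t - (x0 - t) = 2 * t by ring.
    rewrite leeD2l//; apply: ge0_subset_integral => //.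
    - exact: (measurable_funTS (@measurable_sqmod_hor f (y0 + s * t) hf)).
    - by move=> x _; rewrite lee_fin sqr_ge0.
    by move=> x; rewrite /J /= !in_itv/=; lra.
  have hV (s x : R) : 0 < x -> x = x0 + s * t ->
      ((rint (fun y => normc (f (x +i* y))) (y0 - t) (y0 + t))%:E <= (2 * t)%:E + V s t)%E.
    move=> xp ex; rewrite /V -ex; apply: le_trans (le1 (fun y => x +i* y) _ _ yt (cv x xp)) _.
    have -> : y0 + t - (y0 - t) = 2 * t by ring.
    rewrite leeD2l//; apply: ge0_subset_integral => //.
    - exact: (@measurable_sqmod_line f x hf).
    - by move=> y _; rewrite lee_fin sqr_ge0.
  rewrite -/m => hm.
  have a1 := hH (-1) (y0 - t) ltac:(by rewrite mulN1r).
  have a2 := hH 1 (y0 + t) ltac:(by rewrite mul1r).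
  have xm : 0 < x0 - t by lra.
  have xp : 0 < x0 + t by lra.
  have a3 := hV (-1) (x0 - t) xm ltac:(by rewrite mulN1r).
  have a4 := hV 1 (x0 + t) xp ltac:(by rewrite mul1r).
  have := leeD (leeD a1 a2) (leeD a3 a4).
  rewrite -!EFinD => {}a1.
  rewrite -(leeD2lE (x := (8 * t)%:E))// -EFinD.
  apply: (@le_trans _ _ (4 * m * t)%:E).
    rewrite lee_fin.
    have : 4 * t * (m - 2) = 4 * m * t - 8 * t by ring.
    have : 2 * d * (m - 2) <= 4 * t * (m - 2) by rewrite ler_wpM2r; lra.
    lra.
  move: hm; rewrite -lee_fin => hm; apply: le_trans hm _; apply: le_trans a1 _.
  have -> : 8 * t = (2 * t + 2 * t) + (2 * t + 2 * t) by ring.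
  have ac (a h1 h2 v1 v2 : \bar R) :
      (a + h1 + (a + h2) + (a + v1 + (a + v2)) = a + a + (a + a) + (h1 + h2 + (v1 + v2)))%E.
    by rewrite (addeACA a h1 a h2) (addeACA a v1 a v2) [LHS]addeACA.
  by rewrite !EFinD ac.
have hsum : ((2 * d * (m - 2) * (d / 2))%:E <= I%:E + I%:E + (I%:E + I%:E))%E.
  apply: (@le_trans _ _ (\int[mu]_(t in T) (H (-1)%R t + H 1%R t + (V (-1)%R t + V 1%R t)))%E).
    have -> : (2 * d * (m - 2) * (d / 2))%:E = (\int[mu]_(t in T) (2 * d * (m - 2))%:E)%E.
      rewrite integral_cst//= lebesgue_measure_itv/= lte_fin ifT; last by lra.
      by rewrite -EFinD -EFinM; congr EFin; field.
    apply: ge0_le_integral => //.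
    - by move=> t _; rewrite lee_fin !mulr_ge0// ?subr_ge0 ltW.
    - by apply: measurable_funTS; apply: emeasurable_funD; apply: emeasurable_funD.
  rewrite ge0_integralD//; last 4 first.
  - by move=> t _; rewrite adde_ge0.
  - by apply: measurable_funTS; exact: emeasurable_funD.
  - by move=> t _; rewrite adde_ge0.
  - by apply: measurable_funTS; exact: emeasurable_funD.
  have eH : (\int[mu]_(t in T) (H (-1)%R t + H 1%R t) =
      \int[mu]_(t in T) H (-1)%R t + \int[mu]_(t in T) H 1%R t)%E.
    by apply: ge0_integralD => //; exact: measurable_funTS.
  have eV : (\int[mu]_(t in T) (V (-1)%R t + V 1%R t) =
      \int[mu]_(t in T) V (-1)%R t + \int[mu]_(t in T) V 1%R t)%E.
    by apply: ge0_integralD => //; exact: measurable_funTS.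
  rewrite eH eV.
  have n1 : `|-1 : R| = 1 by rewrite normrN normr1.
  have n2 : `|1 : R| = 1 by rewrite normr1.
  by apply: leeD; [apply: leeD; exact: TH|apply: leeD; exact: TV].
have d2 : 0 < d ^+ 2 by rewrite exprn_gt0.
rewrite -lerBlDl ler_pdivlMr// -lee_fin.
move: hsum; rewrite -!EFinD !lee_fin; lra.
Qed.

End bounded.
End line_integrals.

Section halfplane_bounds.
Context {R : realType}.
Notation mR := (measurableTypeR R).
Notation mu := (@lebesgue_measure R).
Implicit Types (f : R[i] -> R[i]) (t x y : R).

Definition bounded_right f := forall x, 0 < x -> exists K : R,
  forall z, x <= complex.Re z -> normc (f z) <= K.

Lemma pkerN t y : pker t (- y) = pker t y.
Proof. by rewrite /pker sqrrN. Qed.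

Lemma measurable_pker t : 0 < t -> measurable_fun setT (pker t : mR -> mR).
Proof.
move=> t0; apply: rcont_measurable => y.
rewrite (_ : pker t = (fun y => pker t (y - 0))); first exact: rcont_pker.
by apply/funext => y'; rewrite subr0.
Qed.

Lemma poisson_line_sqint f x t q : hol0 f -> bounded_right f -> 0 < x -> 0 < t ->
  ((pi * normc (f ((x + t) +i* q)) ^+ 2)%:E <=
   \int[mu]_y ((pker t (y - q))%:E * sqmod f (x, y)))%E.
Proof.
move=> [hf _] hb x0 t0; have [K hK] := hb x x0.
apply: le_trans (poisson_normc2 q x0 hf hK t0) _.
by rewrite le_eqVlt; apply/orP; left; apply/eqP/eq_integral => y _; rewrite EFinM.
Qed.

(** The Poisson kernel has total mass [pi], whence the integrals of a subharmonic
   function over vertical lines decrease. *)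
Lemma line_sqint_mono f x x' : hol0 f -> bounded_right f -> 0 < x -> x < x' ->
  (line_sqint f x' <= line_sqint f x)%E.
Proof.
move=> hf hb x0 xx'; pose t := x' - x; have t0 : 0 < t by rewrite subr_gt0.
have -> : x' = x + t by rewrite addrC subrK.
have pi0 := @pi_gt0 R.
have m1 : measurable_fun setT (fun y : mR => sqmod f (x + t, y)) := @measurable_sqmod_line R f (x + t) hf.
have m2 : measurable_fun setT (fun y : mR => sqmod f (x, y)) := @measurable_sqmod_line R f x hf.
rewrite -(@lee_pmul2l _ pi%:E) ?fin_numE// ?lte_fin//.
rewrite -!ge0_integralZl//; try by [move=> y _; exact: sqmod_ge0|rewrite lee_fin ltW].
pose Phi (p : mR * mR) : \bar R := ((pker t (p.2 - p.1))%:E * sqmod f (x, p.2))%E.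
have Phi0 p : (0 <= Phi p)%E by rewrite mule_ge0 ?sqmod_ge0// lee_fin pker_ge0.
have mPhi : measurable_fun setT Phi.
  apply: emeasurable_funM; last exact: measurableT_comp m2 _.
  apply/measurable_EFinP; apply: measurableT_comp (measurable_pker t0) _.
  exact: measurable_funB.
have mk q : measurable_fun setT (fun y : mR => (pker t (y - q))%:E).
  apply/measurable_EFinP; apply: measurableT_comp (measurable_pker t0) _.
  exact: measurable_funB.
apply: (@le_trans _ _ (\int[mu]_q \int[mu]_y Phi (q, y))%E).
  apply: ge0_le_integral => //.
  - by move=> q _; rewrite -EFinM lee_fin mulr_ge0 ?sqr_ge0// ltW.
  - exact: measurable_funeM.
  - exact: (measurable_fun_fubini_tonelli_F (m2 := mu) Phi mPhi Phi0).
  - by move=> q _; rewrite -EFinM; exact: poisson_line_sqint.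
rewrite (fubini_tonelli (m1 := mu) (m2 := mu) Phi mPhi Phi0).
rewrite le_eqVlt; apply/orP; left; apply/eqP/eq_integral => y _.
have k0 q : [set: mR] q -> (0 <= (pker t (q - y))%:E)%E by rewrite lee_fin pker_ge0.
rewrite /Phi /= -(integral_pker y t0) muleC -ge0_integralZl ?sqmod_ge0//.
by apply: eq_integral => q _; rewrite muleC -[X in pker t X]opprB pkerN.
Qed.

Lemma point_le_line_sqint f x t q : hol0 f -> bounded_right f -> 0 < x -> 0 < t ->
  ((pi * t * normc (f ((x + t) +i* q)) ^+ 2)%:E <= line_sqint f x)%E.
Proof.
move=> hf hb x0 t0.
have m2 : measurable_fun setT (fun y : mR => sqmod f (x, y)) := @measurable_sqmod_line R f x hf.
have ti : 0 < t^-1 by rewrite invr_gt0.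
rewrite -(@lee_pmul2l _ (t^-1)%:E) ?fin_numE// ?lte_fin//.
rewrite -EFinM (_ : t^-1 * _ = pi * normc (f ((x + t) +i* q)) ^+ 2); last first.
  by move: (normc _ ^+ 2) => N; field; rewrite gt_eqF.
apply: le_trans (poisson_line_sqint q hf hb x0 t0) _.
have s0 y : [set: mR] y -> (0 <= sqmod f (x, y))%E by move=> _; exact: sqmod_ge0.
rewrite -ge0_integralZl//; last by rewrite lee_fin ltW.
apply: ge0_le_integral => //.
- by move=> y _; rewrite mule_ge0 ?sqmod_ge0// lee_fin pker_ge0.
- apply: emeasurable_funM; last exact: m2.
  apply/measurable_EFinP; apply: measurableT_comp (measurable_pker t0) _.
  exact: measurable_funB.
- exact: measurable_funeM.
- by move=> y _; rewrite lee_wpmul2r ?sqmod_ge0// lee_fin pker_le.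
Qed.

Let normc_Vsqr (t y : R) : 0 < t -> normc (t +i* y)^-1 ^+ 2 = pker t y / t.
Proof.
move=> t0; rewrite normcV exprVn sqr_normc_Re_Im /pker /= mulrAC mulfV ?gt_eqF// mul1r //.
Qed.

(** Two Poisson kernels differ by at most a multiple of their sum, so that the
   harmonic extension of bounded data is Lipschitz. *)
Lemma pker_lipschitz t t' y y' : 0 < t -> 0 < t' ->
  pker t y <= pker t' y' + normc ((t +i* y) - (t' +i* y')) / 2 * (pker t y / t + pker t' y' / t').
Proof.
move=> t0 t0'; set A := t +i* y; set B := t' +i* y'.
have A0 : A != 0 by rewrite eq_complex /= negb_and gt_eqF.
have B0 : B != 0 by rewrite eq_complex /= negb_and gt_eqF.
have Re_inv (u v : R) : complex.Re (u +i* v)^-1 = pker u v by [].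
rewrite -lerBlDl -!Re_inv -/A -/B -ReB.
apply: le_trans (ler_norm _) _; apply: le_trans (normc_Re_le _) _.
have -> : A^-1 - B^-1 = (B - A) * (A^-1 * B^-1) by field; rewrite A0 B0.
rewrite normcM -normcN opprB -mulrA ler_wpM2l ?normc_ge0// normcM.
rewrite !Re_inv -(normc_Vsqr y t0) -(normc_Vsqr y' t0') -/A -/B.
have := sqr_ge0 (normc A^-1 - normc B^-1); lra.
Qed.

(** Adding [i K] makes the imaginary part of [G] nonnegative; [pker_lipschitz] then
   compares its Poisson integrals at two points. The real part of [G] is the
   imaginary part of [i G]. *)
Lemma lipschitz_right (G : R[i] -> R[i]) (a x0 K d : R) : a < x0 ->
  (forall z, a < complex.Re z -> cdiff G z) ->
  (forall z, x0 <= complex.Re z -> normc (G z) <= K) -> 0 < d ->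
  forall s z, x0 + d <= complex.Re s -> x0 + d <= complex.Re z ->
    normc (G s - G z) <= 4 * K / d * normc (s - z).
Proof.
move=> ax hG hK d0.
have K0 : 0 <= K by apply: le_trans (normc_ge0 _) (hK x0%:C _).
have key (F : R[i] -> R[i]) : (forall z, a < complex.Re z -> cdiff F z) ->
    (forall z, x0 <= complex.Re z -> normc (F z) <= K) ->
    forall s z, x0 + d <= complex.Re s -> x0 + d <= complex.Re z ->
    complex.Im (F s) - complex.Im (F z) <= 2 * K / d * normc (s - z).
  move=> hF hKF [p q] [p' q'] hs hz; rewrite /= in hs hz.
  pose H s := F s + 'i%C * K%:C.
  have hH z : a < complex.Re z -> cdiff H z.
    by move=> /hF hz'; exact: (cdiffD hz' (@cdiff_cst _ ('i%C * K%:C) z)).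
  have ImH s : complex.Im (H s) = complex.Im (F s) + K.
    by rewrite /H; case: (F s) => u v /=; ring.
  have hKH z : x0 <= complex.Re z -> normc (H z) <= K + K.
    move=> /hKF hz'; apply: le_trans (le_normcD _ _) _; rewrite lerD//.
    by rewrite normc_iM normc_real ger0_norm.
  have H0 y : 0 <= complex.Im (H (x0 +i* y)).
    rewrite ImH; have := le_trans (normc_Im_le _) (hKF (x0 +i* y) (lexx _)).
    by rewrite ler_norml; lra.
  have H2 y : complex.Im (H (x0 +i* y)) <= 2 * K.
    rewrite ImH; have := le_trans (normc_Im_le _) (hKF (x0 +i* y) (lexx _)).
    by rewrite ler_norml; lra.
  pose t := p - x0; pose t' := p' - x0.
  have t0 : 0 < t by rewrite /t; lra.
  have t0' : 0 < t' by rewrite /t'; lra.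
  have := poisson_nonneg q ax hH hKH t0 H0; have := poisson_nonneg q' ax hH hKH t0' H0.
  rewrite (_ : x0 + t' = p'); last by rewrite /t'; ring.
  rewrite (_ : x0 + t = p); last by rewrite /t; ring.
  rewrite !ImH => e' e.
  have pi0 := @pi_gt0 R.
  set D := normc _.
  have D0 : 0 <= D by exact: normc_ge0.
  have cH y : rcont (fun y => complex.Im (H (x0 +i* y))) y.
    by apply: ccont_Im_vert; apply/cdiff_ccont/hH.
  have mH : measurable_fun setT (fun y : mR => complex.Im (H (x0 +i* y))) := rcont_measurable cH.
  have mk u r : 0 < u -> measurable_fun setT (fun y : mR => pker u (y - r)).
    by move=> u0; apply: measurableT_comp (measurable_pker u0) _; exact: measurable_funB.
  pose k1 (y : mR) : R := pker t (y - q); pose k2 (y : mR) : R := pker t' (y - q').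
  pose w (y : mR) : R := complex.Im (H (x0 +i* y)).
  have k10 y : 0 <= k1 y by exact: pker_ge0.
  have k20 y : 0 <= k2 y by exact: pker_ge0.
  have mk1 : measurable_fun setT k1 by exact: mk.
  have mk2 : measurable_fun setT k2 by exact: mk.
  have c1 : 0 <= K * D / t by rewrite !mulr_ge0// invr_ge0 ltW.
  have c2 : 0 <= K * D / t' by rewrite !mulr_ge0// invr_ge0 ltW.
  have h : ((pi * (complex.Im (F (p +i* q)) + K))%:E <=
      (pi * (complex.Im (F (p' +i* q')) + K))%:E + ((K * D / t)%:E * pi%:E + (K * D / t')%:E * pi%:E))%E.
    rewrite -e -e' -{1}(integral_pker q t0) -(integral_pker q' t0').
    rewrite -[X in (_ <= _ + (X + _))%E]ge0_integralZl//; last 2 first.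
    - by apply/measurable_EFinP.
    - by move=> y _; rewrite lee_fin; exact: k10.
    rewrite -[X in (_ <= _ + (_ + X))%E]ge0_integralZl//; last 2 first.
    - by apply/measurable_EFinP.
    - by move=> y _; rewrite lee_fin; exact: k20.
    have m1 : measurable_fun setT (fun y => (k1 y * w y)%:E).
      by apply/measurable_EFinP; exact: measurable_funM.
    have m2 : measurable_fun setT (fun y => (k2 y * w y)%:E).
      by apply/measurable_EFinP; exact: measurable_funM.
    have m3 : measurable_fun setT (fun y => (K * D / t)%:E * (k1 y)%:E)%E.
      by apply: measurable_funeM; apply/measurable_EFinP.
    have m4 : measurable_fun setT (fun y => (K * D / t')%:E * (k2 y)%:E)%E.
      by apply: measurable_funeM; apply/measurable_EFinP.
    have p2 y : [set: mR] y -> (0 <= (k2 y * w y)%:E)%E by move=> _; rewrite lee_fin; exact: mulr_ge0 (k20 y) (H0 y).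
    have p3 y : [set: mR] y -> (0 <= (K * D / t)%:E * (k1 y)%:E)%E.
      by move=> _; rewrite -EFinM lee_fin; exact: mulr_ge0 c1 (k10 y).
    have p4 y : [set: mR] y -> (0 <= (K * D / t')%:E * (k2 y)%:E)%E.
      by move=> _; rewrite -EFinM lee_fin; exact: mulr_ge0 c2 (k20 y).
    have e3 := ge0_integralD mu measurableT p3 m3 p4 m4.
    rewrite -e3.
    have p5 y : [set: mR] y -> (0 <= (K * D / t)%:E * (k1 y)%:E + (K * D / t')%:E * (k2 y)%:E)%E.
      by move=> yT; rewrite adde_ge0 ?p3 ?p4.
    have e4 := ge0_integralD mu measurableT p2 m2 p5 (emeasurable_funD m3 m4).
    rewrite -e4.
    apply: ge0_le_integral => //.
    - by move=> y _; rewrite lee_fin; exact: mulr_ge0 (k10 y) (H0 y).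
    - by apply: emeasurable_funD => //; exact: emeasurable_funD.
    move=> y _; rewrite -!EFinM -!EFinD lee_fin.
    have := @pker_lipschitz t t' (y - q) (y - q') t0 t0'.
    have -> : (t +i* (y - q)) - (t' +i* (y - q')) = (p - p') -i* (q - q').
      by apply/eqP; rewrite eq_complex /= /t /t'; apply/andP; split; apply/eqP; ring.
    have -> : normc ((p - p') -i* (q - q')) = D by rewrite /D /normc /= sqrrN.
    rewrite -/(k1 y) -/(k2 y) -/(w y) => hk.
    have w0 : 0 <= w y by exact: H0.
    have w2 : w y <= 2 * K by exact: H2.
    have Z0 : 0 <= D / 2 * (k1 y / t + k2 y / t').
      by rewrite mulr_ge0 ?divr_ge0// addr_ge0// divr_ge0// ltW.
    apply: le_trans (ler_wpM2r w0 hk) _; rewrite mulrDl lerD2l.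
    apply: le_trans (ler_wpM2l Z0 w2) _.
    by rewrite le_eqVlt; apply/orP; left; apply/eqP; field; rewrite !gt_eqF.
  have {}h : pi * (complex.Im (F (p +i* q)) - complex.Im (F (p' +i* q'))) <=
      pi * (K * D / t + K * D / t').
    by move: h; rewrite -!EFinM -!EFinD lee_fin; lra.
  rewrite ler_pM2l// in h; apply: le_trans h _.
  have KD : 0 <= K * D by rewrite mulr_ge0.
  have i1 : t^-1 <= d^-1 by rewrite lef_pV2 ?posrE// /t; lra.
  have i2 : t'^-1 <= d^-1 by rewrite lef_pV2 ?posrE// /t'; lra.
  have -> : 2 * K / d * D = K * D / d + K * D / d by ring.
  by rewrite lerD// ler_wpM2l.
have hiG z : a < complex.Re z -> cdiff (fun s => 'i%C * G s) z by move=> /hG; exact: cdiff_iM.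
have hiK z : x0 <= complex.Re z -> normc ('i%C * G z) <= K by rewrite normc_iM; exact: hK.
move=> s z hs hz; apply: le_trans (normc_le_Re_Im _) _.
rewrite ReB ImB (_ : 4 * K / d * normc (s - z) = 2 * K / d * normc (s - z) + 2 * K / d * normc (s - z)); last by ring.
have sz : normc (z - s) = normc (s - z) by rewrite -normcN opprB.
have a1 := key _ hG hK s z hs hz; have a2 := key _ hG hK z s hz hs.
have a3 := key _ hiG hiK s z hs hz; have a4 := key _ hiG hiK z s hz hs.
rewrite !Im_iM sz in a2 a3 a4 *.
by apply: lerD; rewrite ler_norml; lra.
Qed.

End halfplane_bounds.

(** * Doubling measures *)


Definition initial_mass {R : realType} (m : {measure set (measurableTypeR R) -> \bar R})
  (x : R) : \bar R := m `[0, x[%classic.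
Arguments initial_mass {R} m x%_R.

Section doubling_measures.
Context {R : realType}.
Notation mR := (measurableTypeR R).
Notation mu := (@lebesgue_measure R).
Variable m : {sigma_finite_measure set mR -> \bar R}.
Variable D : R.
Implicit Types (t r x s : R).

Notation V := (initial_mass m).

Hypothesis Vfin : forall x, (V x < +oo)%E.
Hypothesis Vpos : forall x, 0 < x -> (0 < V x)%E.
Hypothesis Vdbl : forall x, 0 < x -> (V (2 * x)%R <= D%:E * V x)%E.

Lemma V_fin_num x : V x \is a fin_num.
Proof. by rewrite ge0_fin_numE// measure_ge0. Qed.

Lemma V_mono x y : x <= y -> (V x <= V y)%E.
Proof.
move=> xy; apply: le_measure; rewrite ?inE//; apply: subset_itvl; by rewrite bnd_simp.
Qed.

Lemma doubling_const_ge1 : 1 <= D.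
Proof.
have h := Vdbl ltr01; have h1 : (V 1 <= V (2 * 1))%E by apply: V_mono; lra.
have := le_trans h1 h; rewrite -(fineK (V_fin_num 1)) -EFinM lee_fin.
have v0 : 0 < fine (V 1) by rewrite fine_gt0// Vpos//= Vfin.
by move=> h2; rewrite -(ler_pM2r v0) mul1r.
Qed.

Lemma doubling_iter n x : 0 < x -> (V (2 ^+ n * x)%R <= (D ^+ n)%:E * V x)%E.
Proof.
move=> x0; elim: n => [|n ih]; first by rewrite !expr0 mul1r mul1e.
rewrite exprS -mulrA; apply: le_trans (Vdbl _) _; first by rewrite mulr_gt0// exprn_gt0.
have D0 : 0 <= D by have := doubling_const_ge1; lra.
by rewrite exprS EFinM -muleA lee_wpmul2l.
Qed.

(** Dyadic annuli have measures growing at most like [D ^ n], so that a power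
   decay of exponent [p] with [2 D <= 2 ^ p] is integrable with the right scale. *)
Lemma integral_power_decay p x : 0 < x -> 2 * D <= 2 ^+ p ->
  (\int[m]_(r in `[0%R, +oo[) ((1 + r / x) ^- p)%:E <= (1 + 2 * D)%:E * V x)%E.
Proof.
move=> x0 hp; have D1 := doubling_const_ge1.
pose f (r : mR) : \bar R := ((1 + r / x) ^- p)%:E.
pose F n : set mR := `[0%R, (2 ^+ n * x)%R[%classic.
have pw n : (0 : R) < 2 ^+ n by rewrite exprn_gt0.
have den r : 0 <= r -> 1 <= 1 + r / x by move=> r0; rewrite lerDl divr_ge0// ltW.
have f0 r : 0 <= r -> (0 <= f r)%E.
  by move=> r0; rewrite lee_fin invr_ge0 exprn_ge0//; have := den r r0; lra.
pose I : set mR := `[0%R, +oo[%classic.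
have mI : measurable I by exact: measurable_itv.
have mf (E : set mR) : measurable E -> E `<=` I -> measurable_fun E f.
  move=> mE EI; apply: (measurable_funS (E := I)) => //.
  apply/measurable_EFinP.
  have -> : (fun r : mR => (1 + r / x) ^- p) = (fun r => ((1 + r / x)^-1) ^+ p).
    by apply/funext => r; rewrite exprVn.
  apply: measurable_funX; apply: subspace_continuous_measurable_fun => //.
  apply/continuous_within_itvcyP; split.
    move=> r; rewrite in_itv/= andbT => r0; apply: cvgV.
      by rewrite gt_eqF//; have := den r (ltW r0); lra.
    by apply: cvgD; [exact: cvg_cst|apply: cvgM; [exact: cvg_id|exact: cvg_cst]].
  apply: cvg_at_right_filter; apply: cvgV; first by rewrite mul0r addr0 oner_eq0.
  by apply: cvgD; [exact: cvg_cst|apply: cvgM; [exact: cvg_id|exact: cvg_cst]].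
have -> : `[0%R, +oo[%classic = \bigcup_n F n :> set mR.
  apply/seteqP; split=> r; rewrite /= in_itv/= andbT.
    move=> r0; exists (Num.bound (r / x)) => //; rewrite /F /= in_itv/= r0 /=.
    rewrite -ltr_pdivrMr//; apply: lt_trans (archi_boundP _) _; first by rewrite divr_ge0// ltW.
    by rewrite -natrX ltr_nat ltn_expl.
  by move=> [n _]; rewrite /F /= in_itv/= => /andP[].
have FI n : F n `<=` I.
  by move=> r; rewrite /F /I /= !in_itv/= andbT => /andP[].
have ndF : nondecreasing_seq F.
  apply/nondecreasing_seqP => n; apply/subsetPset; rewrite /F; apply: subset_itvl.
  rewrite bnd_simp; apply: ler_wpM2r; first exact: ltW.
  by apply: ler_weXn2l; rewrite ?ler1n.
have mF n : measurable (F n) by exact: measurable_itv.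
have cv : (\int[m]_(r in F i) f r)%E @[i --> \oo] --> (\int[m]_(r in \bigcup_i F i) f r)%E.
  apply: (@ge0_nondecreasing_set_cvg_integral _ mR _ F f m) => //.
    by move=> n; exact: mf.
  by move=> n r /FI; rewrite /I /= in_itv/= andbT; exact: f0.
rewrite -(cvg_lim _ cv)//; apply: lime_le; first by apply: cvgP cv.
apply: nearW => n.
have v0 : (0 <= V x)%E by exact: measure_ge0.
apply: (@le_trans _ _ ((1 + 2 * D * (1 - 2 ^- n))%:E * V x)%E); last first.
  apply: lee_wpmul2r => //; rewrite lee_fin lerD2l; apply: ler_piMr; first by lra.
  by rewrite lerBlDr lerDl invr_ge0 ltW.
elim: n => [|n ih].
  rewrite expr0 invr1 subrr mulr0 addr0 mul1e.
  apply: (@le_trans _ _ (\int[m]_(r in F 0%N) 1)%E).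
    apply: ge0_le_integral => //; [by move=> r /FI; rewrite /I /= in_itv/= andbT; exact: f0|exact: mf|].
    move=> r /FI; rewrite /I /= in_itv/= andbT => r0; rewrite lee_fin invf_le1; last first.
      by rewrite exprn_gt0//; have := den r r0; lra.
    by rewrite exprn_ege1// den.
  by rewrite integral_cst// mul1e /F /initial_mass expr0 mul1r.
pose A : set mR := `[(2 ^+ n * x)%R, (2 ^+ n.+1 * x)%R[%classic.
have e : F n.+1 = F n `|` A.
  have h1 : 0 <= 2 ^+ n * x by rewrite mulr_ge0// ltW.
  have h2 : 2 ^+ n * x <= 2 ^+ n.+1 * x.
    by apply: ler_wpM2r; [exact: ltW|apply: ler_weXn2l; rewrite ?ler1n].
  rewrite /F (@itv_bndbnd_setU _ R (BLeft 0) (BLeft (2 ^+ n * x)) (BLeft (2 ^+ n.+1 * x)))//.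
have mA : measurable A by exact: measurable_itv.
have mU : measurable_fun (F n `|` A) f by rewrite -e; apply: mf => //; exact: FI.
have p0 r : (F n `|` A) r -> (0 <= f r)%E.
  by rewrite -e => /FI; rewrite /I /= in_itv/= andbT; exact: f0.
have dj : [disjoint F n & A].
  apply/disj_setPS => r /= []; rewrite /F /A /= !in_itv/= => /andP[_ h1] /andP[h2 _].
  by have := lt_le_trans h1 h2; rewrite ltxx.
rewrite e ge0_integral_setU//.
have -> : 1 + 2 * D * (1 - 2 ^- n.+1) = 1 + 2 * D * (1 - 2 ^- n) + D * 2 ^- n.
  by rewrite exprS; field; rewrite gt_eqF.
rewrite EFinD ge0_muleDl ?lee_fin; last 2 first.
- have : 2 ^- n <= 1 :> R by rewrite invf_le1// exprn_ege1// ler1n.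
  by move=> ?; rewrite addr_ge0// mulr_ge0//; lra.
- by rewrite mulr_ge0// ?invr_ge0 ?ltW//; lra.
apply: leeD ih _.
have AI : A `<=` I.
  move=> r; rewrite /A /I /= !in_itv/= andbT => /andP[h _]; apply: le_trans h.
  by rewrite mulr_ge0 ?ltW.
apply: (@le_trans _ _ (\int[m]_(r in A) (2 ^- n ^+ p)%:E)%E).
  apply: ge0_le_integral => //; [by move=> r /AI; rewrite /I /= in_itv/= andbT; exact: f0|exact: mf|].
  move=> r; rewrite /A /= in_itv/= => /andP[h _]; rewrite lee_fin exprVn.
  have h1 : 2 ^+ n <= 1 + r / x.
    have : 2 ^+ n <= r / x by rewrite ler_pdivlMr.
    lra.
  have q1 : 0 < 1 + r / x by have := pw n; lra.
  rewrite lef_pV2 ?posrE ?exprn_gt0//; apply: lerXn2r => //; rewrite nnegrE; exact: ltW.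
rewrite integral_cst//.
have q0 : 0 <= 2 ^- n ^+ p :> R by rewrite exprn_ge0// invr_ge0 ltW.
apply: (@le_trans _ _ ((2 ^- n ^+ p)%:E * ((D ^+ n.+1)%:E * V x))%E).
  apply: lee_wpmul2l => //; apply: le_trans (doubling_iter n.+1 x0).
  apply: le_measure; rewrite ?inE// => r; rewrite /A /= !in_itv/= => /andP[h ->].
  by rewrite andbT; apply: le_trans h; rewrite mulr_ge0 ?ltW.
rewrite muleA -EFinM; apply: lee_wpmul2r => //; rewrite lee_fin.
have -> : 2 ^- n ^+ p * D ^+ n.+1 = D * (D / 2 ^+ p) ^+ n.
  by rewrite exprS expr_div_n -!exprVn -!exprM mulnC; ring.
rewrite ler_wpM2l//; first lra.
rewrite -(exprVn 2 n); apply: lerXn2r; rewrite ?nnegrE ?invr_ge0//.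
  by apply: divr_ge0; [lra|exact: ltW].
by rewrite ler_pdivrMr// ler_pdivlMl.
Qed.

End doubling_measures.

(** * Dilations and the layer cake formula *)


Lemma set0P_dec T (A : set T) : A = set0 \/ A !=set0.
Proof. by have [->|/set0P] := eqVneq A set0; [left|right]. Qed.

Section layer_cake.
Context {R : realType}.
Notation mR := (measurableTypeR R).
Notation mu := (@lebesgue_measure R).
Variable m : {sigma_finite_measure set mR -> \bar R}.

Notation I := (`[0%R, +oo[%classic : set mR).

Lemma layer_cake (h : mR -> \bar R) : measurable_fun setT h -> (forall r, (0 <= h r)%E) ->
  (\int[m]_(r in I) h r = \int[mu]_(a in I) m ([set r | (a%:E < h r)%E] `&` I))%E.
Proof.
move=> mh h0.
have mI : measurable I by exact: measurable_itv.
pose S : set (mR * mR) := [set p | (p.2%:E < h p.1)%E].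
have mS : measurable S.
  have := @measurable_lte _ _ _ setT measurableT (fun p : mR * mR => p.2%:E) (fun p : mR * mR => h p.1).
  rewrite setTI; apply; last exact: measurableT_comp mh _.
  by apply/measurable_EFinP.
have m1 : measurable_fun setT (fun p : mR * mR => (\1_S p : R)%:E).
  by apply/measurable_EFinP; exact: measurable_indic.
have p1 (p : mR * mR) : (0 <= (\1_S p : R)%:E)%E by rewrite lee_fin.
have := tonelli_rect m mu mI mI m1 p1; rewrite /=.
have -> : (\int[m]_(r in I) \int[mu]_(a in I) (\1_S (r, a) : R)%:E = \int[m]_(r in I) h r)%E.
  apply: eq_integral => r _.
  rewrite (_ : (fun a : mR => (\1_S (r, a) : R)%:E) = (fun a => (\1_([set a : mR | (a%:E < h r)%E]) a)%:E)); last first.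
    by apply/funext => a; rewrite !indicE; congr (_%:R%:E); apply/idP/idP; rewrite !inE.
  have mA : measurable [set a : mR | (a%:E < h r)%E].
    have -> : [set a : mR | (a%:E < h r)%E] = xsection S r.
      by apply/seteqP; split=> a; rewrite /xsection /= inE.
    exact: measurable_xsection.
  rewrite integral_indic//.
  have := h0 r; case: (h r) => [c|_|//].
    rewrite lee_fin => c0.
    have -> : [set a : mR | (a%:E < c%:E)%E] `&` I = `[0, c[%classic.
      by apply/seteqP; split=> a; rewrite /= !in_itv/= lte_fin ?andbT; [case=> ? ?; apply/andP|case/andP].
    transitivity (lebesgue_measure (`[0%R, c[%classic : set R)) => //.
    rewrite lebesgue_measure_itv/= lte_fin; case: ltP => [_|c1]; first by rewrite -EFinD subr0.
    by congr EFin; apply/eqP; rewrite eq_le c0 c1.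
  have -> : [set a : mR | (a%:E < +oo)%E] `&` I = I.
    by apply/seteqP; split=> a; rewrite /= ?ltry; [case|].
  transitivity (lebesgue_measure (`[0%R, +oo[%classic : set R)) => //.
  by rewrite lebesgue_measure_itv/= ?ltry.
move=> ->; apply: eq_integral => a _.
rewrite (_ : (fun r : mR => (\1_S (r, a) : R)%:E) = (fun r => (\1_([set r : mR | (a%:E < h r)%E]) r)%:E)); last first.
  by apply/funext => r; rewrite !indicE; congr (_%:R%:E); apply/idP/idP; rewrite !inE.
rewrite integral_indic//.
have -> : [set r : mR | (a%:E < h r)%E] = ysection S a.
  by apply/seteqP; split=> r; rewrite /ysection /= inE.
exact: measurable_ysection.
Qed.

(** For decreasing [M], the inequality between the masses of initial segments
   passes to integrals, since the superlevel sets of [M] are initial segments.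
   The slack between [e] and [e / 2] absorbs their endpoints. *)
Lemma integral_dilation_le (M : mR -> \bar R) (l K e : R) : measurable_fun setT M ->
  (forall r, (0 <= M r)%E) -> (forall x y : R, 0 < x -> x < y -> (M y <= M x)%E) ->
  0 < l -> 0 <= K -> 0 < e ->
  (forall s, 0 < s -> (initial_mass m (l * s) <= K%:E * initial_mass m s)%E) ->
  (\int[m]_(r in I) M (r / l + e)%R <= K%:E * \int[m]_(r in I) M (r + e / 2)%R)%E.
Proof.
move=> mM M0 Mmono l0 K0 e0 hK.
have mI : measurable I by exact: measurable_itv.
have m1 : measurable_fun setT (fun r : mR => M (r / l + e)).
  apply: measurableT_comp mM _; apply: measurable_funD => //; exact: measurable_funM.
have m2 : measurable_fun setT (fun r : mR => M (r + e / 2)).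
  by apply: measurableT_comp mM _; apply: measurable_funD.
rewrite (layer_cake m1) ?(layer_cake m2)//.
pose A (h : mR -> \bar R) a : set mR := [set r | (a%:E < h r)%E] `&` I.
have mA h a : measurable_fun setT h -> measurable (A h a).
  move=> mh; apply: measurableI => //.
  have := @measurable_lte _ _ _ setT measurableT (fun p : mR => a%:E) h.
  by rewrite setTI; apply.
have mmA h : measurable_fun setT h -> measurable_fun setT (fun a : mR => m (A h a)).
  move=> mh.
  pose S : set (mR * mR) := [set p | (p.2%:E < h p.1)%E] `&` (I `*` setT).
  have mS : measurable S.
    apply: measurableI; last exact: measurableX.
    have := @measurable_lte _ _ _ setT measurableT (fun p : mR * mR => p.2%:E) (fun p : mR * mR => h p.1).
    rewrite setTI; apply; last exact: measurableT_comp mh _.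
    by apply/measurable_EFinP.
  have := @measurable_fun_ysection _ _ _ _ _ m S mS.
  congr measurable_fun; apply/funext => a /=; congr (m _).
  by apply/seteqP; split=> r; rewrite /ysection /A /S /= inE /=; [case=> ? []|case].
rewrite -ge0_integralZl//; last exact: measurable_funTS (mmA _ m2).
apply: ge0_le_integral => //.
- exact: measurable_funTS (mmA _ m1).
- by apply: measurable_funeM; exact: measurable_funTS (mmA _ m2).
move=> a _; rewrite -/(A (fun r => M (r / l + e)) a) -/(A (fun r => M (r + e / 2)) a).
have step (r r' : R) : 0 <= r -> 0 <= r' -> r' < r / l + e / 2 -> (a%:E < M (r / l + e)%R)%E ->
    (a%:E < M (r' + e / 2)%R)%E.
  move=> r0 r0' hr; move/lt_le_trans; apply; apply: Mmono; lra.
pose E := A (fun r => M (r / l + e)) a; rewrite -/E.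
have mE : measurable E by exact: mA.
have [E0|[b0 Eb0]] := set0P_dec E.
  by rewrite E0 measure0 mule_ge0.
pose B : set R := [set r / l | r in E].
have B0 : B !=set0 by exists (b0 / l), b0.
have Epos r : E r -> 0 <= r by rewrite /E /A /= in_itv/= andbT => -[].
have [ubB|nubB] := pselect (has_ubound B).
  pose s := sup B + e / 4.
  have supB r : E r -> r / l <= sup B by move=> Er; apply: ub_le_sup => //; exists r.
  have s0 : 0 < s.
    have := supB _ Eb0; have : 0 <= b0 / l by apply: divr_ge0; [exact: Epos|exact: ltW].
    rewrite /s; lra.
  have e4 : 0 < e / 4 by rewrite divr_gt0.
  have [_ [r Er <-] hr] := sup_adherent e4 (conj B0 ubB).
  apply: (@le_trans _ _ (initial_mass m (l * s))).
    apply: le_measure; rewrite ?inE// => r' Er'; rewrite /= in_itv/= (Epos _ Er')/=.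
    by rewrite -ltr_pdivrMl// mulrC (le_lt_trans (supB _ Er'))// /s ltrDl.
  apply: le_trans (hK s s0) _; rewrite lee_wpmul2l//.
  apply: le_measure; rewrite ?inE//; first exact: mA.
  move=> r'; rewrite /= in_itv/= => /andP[r0' r's]; split; last by rewrite /= in_itv/= r0'.
  move: (Er) => [/= Mr _]; apply: (step r) => //; first exact: Epos.
  by move: r's; rewrite /s; lra.
have A2I : A (fun r => M (r + e / 2)) a = I.
  apply/seteqP; split=> r'; first by case.
  move=> hr'; split=> //; move: hr'; rewrite /= in_itv/= andbT => r0'.
  have [r Er hr] : exists2 r, E r & r' < r / l.
    apply: contrapT => hno; apply: nubB; exists r' => _ [r Er <-].
    by rewrite leNgt; apply/negP => h; apply: hno; exists r.
  move: (Er) => [/= Mr _]; apply: (step r) => //; first exact: Epos.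
  lra.
rewrite A2I; apply: (@le_trans _ _ (m I)); first by apply: le_measure; rewrite ?inE// => r [].
pose F n : set mR := `[0%R, (l * n.+1%:R)%R[%classic.
have IF : I = \bigcup_n F n.
  apply/seteqP; split=> r; rewrite /= in_itv/= andbT.
    move=> r0; exists (Num.bound (r / l)) => //; rewrite /F /= in_itv/= r0 /=.
    rewrite -ltr_pdivrMl// mulrC; apply: lt_trans (archi_boundP _) _; first by rewrite divr_ge0// ltW.
    by rewrite ltr_nat.
  by move=> [n _]; rewrite /F /= in_itv/= => /andP[].
have mF n : measurable (F n) by exact: measurable_itv.
have cv : m \o F @ \oo --> m (\bigcup_n F n).
  apply: nondecreasing_cvg_mu => //; first by rewrite -IF.
  apply/nondecreasing_seqP => n; apply/subsetPset; rewrite /F; apply: subset_itvl.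
  by rewrite bnd_simp ler_wpM2l ?(ltW l0)// ler_nat.
rewrite {1}IF -(cvg_lim _ cv)//; apply: lime_le; first by apply: cvgP cv.
apply: nearW => n; apply: le_trans (hK n.+1%:R _) _; first by rewrite ltr0n.
rewrite lee_wpmul2l//; apply: le_measure; rewrite ?inE//.
by move=> r; rewrite /= !in_itv/= andbT => /andP[].
Qed.

End layer_cake.

(** * Norm estimates in the Zen space *)


Section zen_estimates.
Context {R : realType}.
Notation mR := (measurableTypeR R).
Notation mu := (@lebesgue_measure R).
Variable m : {sigma_finite_measure set mR -> \bar R}.
Variable D : R.
Implicit Types (f g : R[i] -> R[i]) (t r x s : R).

Notation V := (initial_mass m).
Notation I := (`[0%R, +oo[%classic : set mR).

Hypothesis Vfin : forall x, (V x < +oo)%E.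
Hypothesis Vpos : forall x, 0 < x -> (0 < V x)%E.
Hypothesis Vdbl : forall x, 0 < x -> (V (2 * x)%R <= D%:E * V x)%E.

Let mI : measurable I. Proof. exact: measurable_itv. Qed.

Let Ipos r : I r -> 0 <= r. Proof. by rewrite /= in_itv/= andbT. Qed.

Lemma decay_exponent : exists2 p, (0 < p)%N & 2 * D <= 2 ^+ p.
Proof.
have D1 := doubling_const_ge1 Vfin Vpos Vdbl.
exists (Num.bound (2 * D)).+1 => //.
have : 2 * D < (Num.bound (2 * D))%:R by apply: archi_boundP; lra.
move/ltW/le_trans; apply; rewrite -natrX ler_nat; set B := Num.bound _.
have h : (B < 2 ^ B)%N by exact: ltn_expl.
by rewrite expnS mul2n -addnn (leq_trans (ltnW h))// leq_addr.
Qed.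

Lemma fineV_gt0 x : 0 < x -> 0 < fine (V x).
Proof. by move=> x0; rewrite fine_gt0// Vpos//= Vfin. Qed.

Lemma fineVK x : (fine (V x))%:E = V x.
Proof. by rewrite fineK//; exact: V_fin_num. Qed.

Lemma fineV_mono x y : x <= y -> fine (V x) <= fine (V y).
Proof. by move=> xy; rewrite -lee_fin !fineVK; exact: V_mono. Qed.

Let measurable_expN t : measurable_fun setT (fun r : mR => expR (- (2 * r * t))).
Proof.
apply: measurableT_comp (@measurable_expR R) _.
rewrite (_ : (fun r : mR => - (2 * r * t)) = (fun r => (- (2 * t)) * r)).
  exact: measurable_funM.
by apply/funext => r; ring.
Qed.

(** The exponential is bounded below on [[0, 1/t)], and above by a power decay
   that is integrable by [integral_power_decay]. *)
Lemma weight_bounds : exists c1 c2, [/\ 0 < c1, 0 < c2 & forall t, 0 < t ->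
  c1 * fine (V t^-1) <= zen_weight m t <= c2 * fine (V t^-1)].
Proof.
have D1 := doubling_const_ge1 Vfin Vpos Vdbl.
have [p p0 hp] := decay_exponent.
have pi0 := @pi_gt0 R.
pose c2 := 2 * pi * (p%:R ^+ p * (1 + 2 * D)).
exists (2 * pi * expR (- 2)), c2; split.
- by rewrite !mulr_gt0// expR_gt0.
- by rewrite !mulr_gt0 ?exprn_gt0 ?ltr0n//; lra.
move=> t t0; have ti : 0 < t^-1 by rewrite invr_gt0.
pose J := (\int[m]_(r in I) (expR (- (2 * r * t)))%:E)%E.
have -> : zen_weight m t = 2 * pi * fine J by [].
have e0 (r : mR) : I r -> (0 <= (expR (- (2 * r * t)))%:E)%E by rewrite lee_fin expR_ge0.
have me (E : set mR) : measurable_fun E (fun r : mR => (expR (- (2 * r * t)))%:E).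
  by apply/measurable_EFinP; exact: measurable_funTS.
have low : ((expR (- 2) * fine (V t^-1))%:E <= J)%E.
  apply: (@le_trans _ _ (\int[m]_(r in `[0%R, (t^-1)%R[) (expR (- 2))%:E)%E).
    by rewrite integral_cst// EFinM fineVK.
  apply: (@le_trans _ _ (\int[m]_(r in `[0%R, (t^-1)%R[) (expR (- (2 * r * t)))%:E)%E).
    apply: ge0_le_integral => //.
    move=> r; rewrite /= in_itv/= => /andP[r0 rt]; rewrite lee_fin ler_expR lerN2.
    have : r * t <= 1 by rewrite -ler_pdivlMr// mul1r ltW.
    lra.
  apply: ge0_subset_integral => //; apply: subset_itvl; by rewrite bnd_simp.
have up : (J <= (p%:R ^+ p * (1 + 2 * D) * fine (V t^-1))%:E)%E.
  have h := integral_power_decay Vfin Vpos Vdbl ti hp.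
  have pp : (0 <= (p%:R ^+ p : R)%:E)%E by rewrite lee_fin exprn_ge0.
  apply: (@le_trans _ _ ((p%:R ^+ p)%:E * \int[m]_(r in I) ((1 + r / t^-1) ^- p)%R%:E)%E); last first.
    by apply: le_trans (lee_wpmul2l pp h) _; rewrite -mulrA EFinM EFinM fineVK.
  have mk : measurable_fun I (fun r : mR => ((1 + r / t^-1) ^- p)%:E).
    apply/measurable_EFinP.
    have -> : (fun r : mR => (1 + r / t^-1) ^- p) = (fun r => ((1 + r * t)^-1) ^+ p).
      by apply/funext => r; rewrite invrK exprVn.
    apply: measurable_funX; apply: subspace_continuous_measurable_fun => //.
    apply/continuous_within_itvcyP; split.
      move=> r; rewrite in_itv/= andbT => r0; apply: cvgV.
        by rewrite gt_eqF// addr_gt0// mulr_gt0.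
      by apply: cvgD; [exact: cvg_cst|apply: cvgM; [exact: cvg_id|exact: cvg_cst]].
    apply: cvg_at_right_filter; apply: cvgV; first by rewrite mul0r addr0 oner_eq0.
    by apply: cvgD; [exact: cvg_cst|apply: cvgM; [exact: cvg_id|exact: cvg_cst]].
  have k0 (r : mR) : I r -> (0 <= ((1 + r / t^-1) ^- p)%R%:E)%E.
    by move=> /Ipos r0; rewrite lee_fin invr_ge0 exprn_ge0// addr_ge0// divr_ge0// ltW.
  rewrite -ge0_integralZl//.
  apply: ge0_le_integral => //; first exact: measurable_funeM.
  move=> r /Ipos r0; rewrite -EFinM lee_fin invrK.
  have rt : 0 <= r * t by rewrite mulr_ge0// ltW.
  rewrite expRN -ler_pdivrMl ?exprn_gt0 ?ltr0n// -invfM lef_pV2 ?posrE ?expR_gt0//; first last.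
  - by rewrite exprn_gt0//; lra.
  - by rewrite mulr_gt0 ?expR_gt0// exprn_gt0// ltr0n.
  (* [1 + y <= exp y] at [y = r t / p], raised to the power [p] *)
  have pn0 : (0 : R) < p%:R by rewrite ltr0n.
  apply: (@le_trans _ _ ((p%:R * (1 + r * t / p%:R)) ^+ p)).
    have y0 : 0 <= p%:R * (1 + r * t / p%:R) by rewrite mulr_ge0 ?addr_ge0 ?divr_ge0.
    apply: lerXn2r; rewrite ?nnegrE ?addr_ge0//.
    rewrite mulrDr mulr1 [p%:R * (_ / _)]mulrC divfK ?gt_eqF// lerD2r.
    by rewrite ler1n.
  rewrite exprMn ler_wpM2l ?exprn_ge0//.
  apply: (@le_trans _ _ (expR (r * t / p%:R) ^+ p)).
    by apply: lerXn2r; rewrite ?nnegrE ?expR_ge0 ?addr_ge0 ?divr_ge0// expR_ge1Dx.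
  rewrite -expRM_natl ler_expR mulrC divfK ?gt_eqF//; lra.
have Jfin : J \is a fin_num.
  by rewrite ge0_fin_numE; [exact: le_lt_trans up (ltry _)|exact: integral_ge0].
rewrite -(fineK Jfin) !lee_fin in low up.
rewrite /c2 -!mulrA; apply/andP; split.
  by rewrite !ler_wpM2l// ltW.
by rewrite !ler_wpM2l ?(ltW pi0)// mulrA.
Qed.

(** The squared norm, with the planar integral replaced by iterated ones. *)
Definition zen_sq f : \bar R :=
  ereal_sup [set (\int[m]_(r in `[0%R, +oo[) line_sqint f (r + eps)%R)%E | eps in `]0%R, +oo[%classic].

Lemma zen_sq_ge f eps : 0 < eps -> (\int[m]_(r in I) line_sqint f (r + eps)%R <= zen_sq f)%E.
Proof. by move=> e0; apply: ereal_sup_ubound; exists eps => //=; rewrite in_itv/= e0. Qed.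

Lemma zen_sq_le f c : (forall eps, 0 < eps -> (\int[m]_(r in I) line_sqint f (r + eps)%R <= c)%E) ->
  (zen_sq f <= c)%E.
Proof. by move=> h; apply: ge_ereal_sup => _ [eps /= /[!in_itv]/= /andP[e0 _] <-]; exact: h. Qed.

Lemma zen_sq_ge0 f : (0 <= zen_sq f)%E.
Proof.
apply: le_trans (zen_sq_ge f ltr01); apply: integral_ge0 => r _; exact: line_sqint_ge0.
Qed.

Let mM f : hol0 f -> measurable_fun setT (line_sqint f : mR -> \bar R).
Proof. by move=> hf; exact: (@measurable_line_sqint R f hf). Qed.

Let mMe f eps : hol0 f -> measurable_fun setT (fun r : mR => line_sqint f (r + eps)).
Proof. by move=> hf; apply: measurableT_comp (mM hf) _; exact: measurable_funD. Qed.

(** Averaging the norm over the shifts [eps] in an interval of length [3 d], Tonelli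
   produces for each [r] in [[0, d)] the integral over the whole strip. *)
Lemma zen_strip f d x0 : hol0 f -> 0 < d -> 3 * d <= x0 ->
  (V d * \int[mu]_(s in `[(x0 - d)%R, (x0 + d)%R]) line_sqint f s <= (3 * d)%:E * zen_sq f)%E.
Proof.
move=> hf d0 dx.
pose J : set mR := `[(x0 - d)%R, (x0 + d)%R]%classic.
pose J' : set mR := `[(x0 - 2 * d)%R, (x0 + d)%R]%classic.
pose E : set mR := `[0%R, d[%classic.
have mJ : measurable J by exact: measurable_itv.
have mJ' : measurable J' by exact: measurable_itv.
have mE : measurable E by exact: measurable_itv.
have M0 x : (0 <= line_sqint f x)%E by exact: line_sqint_ge0.
pose Phi (p : mR * mR) := line_sqint f (p.1 + p.2).
have mPhi : measurable_fun setT Phi.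
  by apply: measurableT_comp (mM hf) _; exact: measurable_funD.
have Phi0 p : (0 <= Phi p)%E by exact: M0.
have c0 : (0 <= \int[mu]_(s in J) line_sqint f s)%E by apply: integral_ge0 => s _; exact: M0.
have -> : (V d * \int[mu]_(s in J) line_sqint f s = \int[m]_(r in E) \int[mu]_(s in J) line_sqint f s)%E.
  by rewrite integral_cst// muleC.
apply: (@le_trans _ _ (\int[m]_(r in E) \int[mu]_(e in J') Phi (r, e))%E).
  apply: ge0_le_integral; [exact: mE|by move=> r _; exact: c0|exact: measurable_cst| |].
  - apply: measurable_funTS.
    have := measurable_fun_fubini_tonelli_F (m2 := mu) (Phi \_ (setT `*` J')).
    have -> : fubini_F mu (Phi \_ (setT `*` J')) = (fun r => \int[mu]_(e in J') Phi (r, e))%E.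
      apply/funext => r; rewrite /fubini_F [RHS]integral_mkcond.
      apply: eq_integral => e _; rewrite !patchE.
      by rewrite (_ : ((r, e) \in _) = (e \in J'))//; apply/idP/idP; rewrite !inE /= => -[].
    apply.
      by apply: measurable_erestrict => //; exact: measurableX.
    by move=> p; apply: erestrict_ge0 => q _; exact: Phi0.
  move=> r; rewrite /E /= in_itv/= => /andP[r0 rd].
  rewrite integral_mkcond -(@lebesgue_shift R r 1 _ (normr1 _)); last 2 first.
  - exact: measurable_erestrict (mM hf).
  - by move=> x; apply: erestrict_ge0 => y _; exact: M0.
  rewrite [leRHS]integral_mkcond; apply: ge0_le_integral => //.
  - by move=> e _; apply: erestrict_ge0 => y _; exact: M0.
  - have mm := measurable_erestrict mJ (mM hf).
    apply: measurableT_comp mm _; apply: measurable_funD => //; exact: measurable_funM.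
  - have ms : measurable_fun setT (fun e : mR => r + e : mR) by exact: measurable_funD.
    exact: measurable_erestrict mJ' (measurableT_comp (mM hf) ms).
  move=> e _; rewrite !patchE mul1r; case: ifPn => [eJ|_]; last first.
    by case: ifP => // _; exact: M0.
  rewrite ifT//; move: eJ; rewrite !inE /J /J' /= !in_itv/=; lra.
rewrite tonelli_rect//.
apply: (@le_trans _ _ (\int[mu]_(e in J') zen_sq f)%E).
  apply: ge0_le_integral => //.
  - by move=> e _; apply: integral_ge0 => r _; exact: Phi0.
  - apply: measurable_funTS.
    have := measurable_fun_fubini_tonelli_G (m1 := m) (Phi \_ (E `*` setT)).
    have -> : fubini_G m (Phi \_ (E `*` setT)) = (fun e => \int[m]_(r in E) Phi (r, e))%E.
      apply/funext => e; rewrite /fubini_G [RHS]integral_mkcond.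
      apply: eq_integral => r _; rewrite !patchE.
      by rewrite (_ : ((r, e) \in _) = (r \in E))//; apply/idP/idP; rewrite !inE /= => -[].
    apply.
      by apply: measurable_erestrict => //; exact: measurableX.
    by move=> p; apply: erestrict_ge0 => q _; exact: Phi0.
  move=> e; rewrite /J' /= in_itv/= => /andP[he _].
  have e0 : 0 < e by lra.
  apply: le_trans (zen_sq_ge f e0).
  apply: ge0_subset_integral => //.
  - exact: measurable_funTS (mMe e hf).
  - by apply: subset_itvl; rewrite bnd_simp.
have z0 := zen_sq_ge0 f.
have lJ : mu J' = (3 * d)%:E.
  transitivity (lebesgue_measure (`[(x0 - 2 * d)%R, (x0 + d)%R]%classic : set R)) => //.
  rewrite lebesgue_measure_itv/= lte_fin ifT; last by lra.
  by rewrite -EFinD; congr EFin; ring.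
by rewrite integral_cst// muleC -lJ.
Qed.

Lemma zen_bounded_right f : hol0 f -> (zen_sq f < +oo)%E -> bounded_right f.
Proof.
move=> hf fz x x0; pose d := x / 3.
have d0 : 0 < d by rewrite divr_gt0.
have Vd := fineV_gt0 d0.
have zfin : zen_sq f \is a fin_num by rewrite ge0_fin_numE ?zen_sq_ge0.
pose I0 := 3 * d * fine (zen_sq f) / fine (V d).
exists (2 + 4 * I0 / d ^+ 2) => -[u v] /= hu.
apply: bounded_by_strip => //; first by rewrite /d; lra.
have := @zen_strip f d u hf d0 ltac:(rewrite /d; lra).
rewrite -fineVK -(fineK zfin) -EFinM.
set J := (\int[mu]_(s in _) _)%E.
have : (0 <= J)%E by apply: integral_ge0 => s _; exact: line_sqint_ge0.
case: J => [c c0|_|//]; last by rewrite gt0_muley ?lte_fin.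
by rewrite -EFinM !lee_fin /I0 ler_pdivlMr// mulrC.
Qed.

(** Line integrals decrease, so the one at [x] bounds from below all those that
   the norm collects over [[0, x / 2)] with the shift [x / 2]. *)
Lemma zen_line f x : hol0 f -> (zen_sq f < +oo)%E -> 0 < x ->
  (V (x / 2)%R * line_sqint f x <= zen_sq f)%E.
Proof.
move=> hf fz x0; have hb := zen_bounded_right hf fz.
have x2 : 0 < x / 2 by rewrite divr_gt0.
apply: le_trans (zen_sq_ge f x2).
apply: (@le_trans _ _ (\int[m]_(r in `[0%R, (x / 2)%R[) line_sqint f (r + x / 2)%R)%E); last first.
  apply: ge0_subset_integral => //.
  - exact: measurable_funTS (mMe _ hf).
  - by move=> r _; exact: line_sqint_ge0.
  - by apply: subset_itvl; rewrite bnd_simp.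
apply: (@le_trans _ _ (\int[m]_(r in `[0%R, (x / 2)%R[) line_sqint f x)%E).
  by rewrite integral_cst// muleC.
apply: ge0_le_integral => //.
- by move=> r _; exact: line_sqint_ge0.
- exact: measurable_funTS (mMe _ hf).
move=> r; rewrite /= in_itv/= => /andP[r0 rx].
by apply: line_sqint_mono => //; lra.
Qed.

(** Half of the distance to the boundary goes to [point_le_line_sqint], a quarter
   to [zen_line]. *)
Definition point_const x := (pi * (x / 2) * fine (V (x / 4)))^-1.

Lemma point_const_gt0 x : 0 < x -> 0 < point_const x.
Proof.
by move=> x0; rewrite invr_gt0 !mulr_gt0 ?pi_gt0 ?divr_gt0// fineV_gt0// divr_gt0.
Qed.

Lemma zen_point f x z : hol0 f -> (zen_sq f < +oo)%E -> 0 < x -> x <= complex.Re z ->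
  normc (f z) ^+ 2 <= point_const x * fine (zen_sq f).
Proof.
case: z => u v hf fz x0 /= xu; have u0 : 0 < u by exact: lt_le_trans xu.
have hb := zen_bounded_right hf fz.
have zfin : zen_sq f \is a fin_num by rewrite ge0_fin_numE ?zen_sq_ge0.
have u2 : 0 < u / 2 by rewrite divr_gt0.
have h1 := zen_line hf fz u2.
have h2 := point_le_line_sqint v hf hb u2 u2.
have eu : u / 2 + u / 2 = u by field.
rewrite eu in h2.
have V0 : (0 <= V (u / 2 / 2)%R)%E by exact: measure_ge0.
have := le_trans (lee_wpmul2l V0 h2) h1.
rewrite -(fineK zfin) -fineVK -EFinM lee_fin => h.
rewrite /point_const mulrC ler_pdivlMr; last first.
  by rewrite !mulr_gt0 ?pi_gt0 ?divr_gt0// fineV_gt0// divr_gt0.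
apply: le_trans h.
have -> : u / 2 / 2 = u / 4 by field.
have vv : fine (V (x / 4)) <= fine (V (u / 4)) by apply: fineV_mono; lra.
have := fineV_gt0 (_ : 0 < x / 4); have pi0 := @pi_gt0 R.
have N0 := sqr_ge0 (normc (f (u +i* v))).
move=> /(_ ltac:(by rewrite divr_gt0)) vx.
set N := normc _ ^+ 2 in N0 *; set v1 := fine _ in vv vx *; set v2 := fine _ in vv *.
have h3 : x / 2 * v1 <= u / 2 * v2 by apply: ler_pM => //; lra.
have pN : 0 <= pi * N by rewrite mulr_ge0// ltW.
by have := ler_wpM2l pN h3; lra.
Qed.

End zen_estimates.

(** * The Zen space as a normed space *)


Section geometric_limits.
Context {R : realType}.

Lemma cvg_geometric0 (c q : R) : 0 <= q < 1 -> c * q ^+ n @[n --> \oo] --> (0 : R).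
Proof.
move=> /andP[q0 q1]; rewrite -(mulr0 c); apply: cvgM; first exact: cvg_cst.
by apply: cvg_expr; rewrite ger0_norm.
Qed.

Lemma real_geometric_limit (a : nat -> R) c q : 0 <= q < 1 ->
  (forall n, `|a n.+1 - a n| <= c * q ^+ n) ->
  exists l, forall n, `|l - a n| <= c * q ^+ n / (1 - q).
Proof.
move=> q01 ha; have [q0 q1] := andP q01; have q1' : 0 < 1 - q by rewrite subr_gt0.
pose e n := c * q ^+ n / (1 - q).
have eS n : e n - e n.+1 = c * q ^+ n by rewrite /e exprS; field; rewrite gt_eqF.
have e0 n : 0 <= e n.
  apply: divr_ge0; [exact: le_trans (normr_ge0 _) (ha n)|exact: ltW].
(* [a - e] increases and [a + e] decreases *)
have inc n k : a n - e n <= a (k + n)%N - e (k + n)%N.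
  elim: k => // k ih; apply: le_trans ih _.
  have := ha (k + n)%N; have := eS (k + n)%N; rewrite addSn ler_norml => h /andP[h1 _]; lra.
have dec n k : a (k + n)%N + e (k + n)%N <= a n + e n.
  elim: k => // k ih; apply: le_trans _ ih.
  have := ha (k + n)%N; have := eS (k + n)%N; rewrite addSn ler_norml => h /andP[_ h1]; lra.
pose E := [set a n - e n | n in [set: nat]].
have ub m : ubound E (a m + e m).
  move=> _ [n _ <-]; have := inc n m; have := dec m n; rewrite addnC.
  have := e0 (m + n)%N; lra.
have hE : has_sup E by split; [exists (a 0 - e 0), 0%N|exists (a 0 + e 0); exact: ub].
exists (sup E) => n; rewrite -/(e n) ler_norml.
have h1 : a n - e n <= sup E by apply: sup_upper_bound => //; exists n.
have h2 : sup E <= a n + e n by apply: ge_sup; [case: hE|exact: ub].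
by apply/andP; split; lra.
Qed.

Lemma complex_geometric_limit (a : nat -> R[i]) c q : 0 <= q < 1 ->
  (forall n, normc (a n.+1 - a n) <= c * q ^+ n) ->
  exists l, forall n, normc (l - a n) <= 2 * c / (1 - q) * q ^+ n.
Proof.
move=> q01 ha.
have [u hu] : exists l, forall n, `|l - complex.Re (a n)| <= c * q ^+ n / (1 - q).
  apply: real_geometric_limit => // n; rewrite -ReB.
  exact: le_trans (normc_Re_le _) (ha n).
have [v hv] : exists l, forall n, `|l - complex.Im (a n)| <= c * q ^+ n / (1 - q).
  apply: real_geometric_limit => // n; rewrite -ImB.
  exact: le_trans (normc_Im_le _) (ha n).
exists (u +i* v) => n; apply: le_trans (normc_le_Re_Im _) _.
by rewrite ReB ImB/=; have := hu n; have := hv n; lra.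
Qed.

End geometric_limits.

Section limits_inf_sup.
Context {R : realType}.
Implicit Types (u : nat -> \bar R) (c : \bar R).

Lemma limn_einfE u : limn_einf u = ereal_sup (range (einfs u)).
Proof. by rewrite limn_einf_lim; exact/cvg_lim/cvg_einfs_sup. Qed.

Lemma limn_esupE u : limn_esup u = ereal_inf (range (esups u)).
Proof. by rewrite limn_esup_lim; exact/cvg_lim/cvg_esups_inf. Qed.

Lemma limn_einf_lt u c N : (limn_einf u < c)%E -> exists2 n, (N <= n)%N & (u n < c)%E.
Proof.
rewrite limn_einfE => h; have : (einfs u N < c)%E.
  by apply: le_lt_trans h; apply: ereal_sup_ubound; exists N.
by move=> /ereal_inf_lt[_ [n /= Nn <-] ?]; exists n.
Qed.

Lemma limn_esup_gt u c N : (c < limn_esup u)%E -> exists2 n, (N <= n)%N & (c < u n)%E.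
Proof.
rewrite limn_esupE => h; have : (c < esups u N)%E.
  by apply: lt_le_trans h _; apply: ereal_inf_lbound; exists N.
by move=> /ereal_sup_gt[_ [n /= Nn <-] ?]; exists n.
Qed.

Lemma limn_einf_le u c : (forall n, (u n <= c)%E) -> (limn_einf u <= c)%E.
Proof.
move=> h; rewrite leNgt; apply/negP; rewrite limn_einfE => /ereal_sup_gt[_ [n _ <-]].
rewrite ltNge => /negP; apply; apply: le_trans (h n).
by apply: ereal_inf_lbound; exists n => /=.
Qed.

End limits_inf_sup.

(** The infimum over [t] of the right-hand side is [(a + b) ^ 2], approached at
   [t = (b + k) / (a + k)] as [k] tends to [0]; the shift by [k] covers the cases
   where [a] or [b] vanishes. *)
Lemma sqr_le_of_weighted {R : realType} (a b c : R) : 0 <= a -> 0 <= b ->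
  (forall t, 0 < t -> c <= (1 + t) * a ^+ 2 + (1 + t^-1) * b ^+ 2) -> c <= (a + b) ^+ 2.
Proof.
move=> a0 b0 hc.
apply/ler_addgt0Pr => e e0.
pose k := e / (2 * (a + b + 1)).
have k0 : 0 < k by rewrite divr_gt0//; lra.
have ak : 0 < a + k by lra.
have bk : 0 < b + k by lra.
have := hc _ (divr_gt0 bk ak).
move=> /le_trans; apply.
have h1 : (1 + (b + k) / (a + k)) * a ^+ 2 <= (a + b + 2 * k) * a.
  have -> : 1 + (b + k) / (a + k) = (a + b + 2 * k) / (a + k) by field; rewrite gt_eqF.
  rewrite -[leLHS]mulrA ler_wpM2l//; first lra.
  by rewrite mulrC ler_pdivrMr// expr2 ler_wpM2l//; lra.
have h2 : (1 + ((b + k) / (a + k))^-1) * b ^+ 2 <= (a + b + 2 * k) * b.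
  have -> : 1 + ((b + k) / (a + k))^-1 = (a + b + 2 * k) / (b + k).
    by field; rewrite !gt_eqF.
  rewrite -[leLHS]mulrA ler_wpM2l//; first lra.
  by rewrite mulrC ler_pdivrMr// expr2 ler_wpM2l//; lra.
have h3 : k * (2 * (a + b + 1)) = e by rewrite /k divfK// gt_eqF//; lra.
nra.
Qed.

Section zen_seminorm.
Context {R : realType}.
Notation mR := (measurableTypeR R).
Notation mu := (@lebesgue_measure R).
Variable m : {sigma_finite_measure set mR -> \bar R}.
Implicit Types (f g h : R[i] -> R[i]) (t r x s eps : R).

Notation V := (initial_mass m).
Notation I := (`[0%R, +oo[%classic : set mR).

Let mI : measurable I. Proof. exact: measurable_itv. Qed.

Let Ipos r : I r -> 0 <= r. Proof. by rewrite /= in_itv/= andbT. Qed.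

Let mMe f eps : hol0 f -> measurable_fun setT (fun r : mR => line_sqint f (r + eps)).
Proof.
by move=> hf; apply: measurableT_comp (measurable_line_sqint hf) _; exact: measurable_funD.
Qed.

Lemma hol0_cst0 : hol0 (fun=> 0 : R[i]).
Proof. by split => // z _; exact: cdiff_cst. Qed.

Lemma hol0D f g : hol0 f -> hol0 g -> hol0 (fun z => f z + g z).
Proof.
move=> [f1 f2] [g1 g2]; split=> z hz; first by apply: cdiffD; [exact: f1|exact: g1].
by rewrite f2// g2// addr0.
Qed.

Lemma hol0B f g : hol0 f -> hol0 g -> hol0 (fun z => f z - g z).
Proof.
move=> [f1 f2] [g1 g2]; split=> z hz; first by apply: cdiffB; [exact: f1|exact: g1].
by rewrite f2// g2// subrr.
Qed.

Lemma hol0Z c f : hol0 f -> hol0 (fun z => c * f z).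
Proof.
move=> [f1 f2]; split=> z hz; last by rewrite f2// mulr0.
by apply: cdiffM; [exact: cdiff_cst|exact: f1].
Qed.

Lemma line_sqint_comb f g h a b x : hol0 f -> hol0 g -> hol0 h -> 0 <= a -> 0 <= b -> 0 < x ->
  (forall z, 0 < complex.Re z ->
    normc (h z) ^+ 2 <= a * normc (f z) ^+ 2 + b * normc (g z) ^+ 2) ->
  (line_sqint h x <= a%:E * line_sqint f x + b%:E * line_sqint g x)%E.
Proof.
move=> hf hg hh a0 b0 x0 hle.
have mf : measurable_fun setT (fun y : mR => sqmod f (x, y)) := measurable_sqmod_line x hf.
have mg : measurable_fun setT (fun y : mR => sqmod g (x, y)) := measurable_sqmod_line x hg.
have mh : measurable_fun setT (fun y : mR => sqmod h (x, y)) := measurable_sqmod_line x hh.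
have ef : (a%:E * line_sqint f x = \int[mu]_y (a%:E * sqmod f (x, y)))%E.
  by rewrite ge0_integralZl// => y _; exact: sqmod_ge0.
have eg : (b%:E * line_sqint g x = \int[mu]_y (b%:E * sqmod g (x, y)))%E.
  by rewrite ge0_integralZl// => y _; exact: sqmod_ge0.
have p0 (c : R) k y : 0 <= c -> (0 <= c%:E * sqmod k (x, y))%E.
  by move=> c0; rewrite mule_ge0 ?sqmod_ge0.
have e : (\int[mu]_y (a%:E * sqmod f (x, y) + b%:E * sqmod g (x, y)) =
    \int[mu]_y (a%:E * sqmod f (x, y)) + \int[mu]_y (b%:E * sqmod g (x, y)))%E.
  apply: ge0_integralD => //; try (by move=> y _; apply: p0); exact: measurable_funeM.
rewrite ef eg -e; apply: ge0_le_integral => //.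
- by move=> y _; exact: sqmod_ge0.
- by apply: emeasurable_funD; exact: measurable_funeM.
- by move=> y _; rewrite /sqmod -!EFinM -EFinD lee_fin; exact: hle.
Qed.

Lemma measurable_sqmod_shift f eps : hol0 f ->
  measurable_fun setT (fun p : mR * mR => sqmod f ((p.1 + eps)%R, p.2)).
Proof.
move=> hf; apply: measurableT_comp (measurable_sqmod hf) _.
apply/measurable_fun_pairP; split; last exact: measurable_snd.
by apply: measurable_funD => //; exact: measurable_fst.
Qed.

Lemma zen_sq_prod f eps : hol0 f ->
  (\int[m \x mu]_(p in I `*` setT) sqmod f ((p.1 + eps)%R, p.2) =
   \int[m]_(r in I) line_sqint f (r + eps)%R)%E.
Proof.
move=> hf; apply: (tonelli_rect_prod m mu (f := fun p => sqmod f ((p.1 + eps)%R, p.2))) => //.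
- exact: measurable_sqmod_shift.
- by move=> p; exact: sqmod_ge0.
Qed.

(** Homogeneity and the triangle inequality are both instances of this. *)
Lemma zen_sq_comb f g h a b : hol0 f -> hol0 g -> hol0 h -> 0 <= a -> 0 <= b ->
  (forall z, 0 < complex.Re z ->
    normc (h z) ^+ 2 <= a * normc (f z) ^+ 2 + b * normc (g z) ^+ 2) ->
  (zen_sq m h <= a%:E * zen_sq m f + b%:E * zen_sq m g)%E.
Proof.
move=> hf hg hh a0 b0 hle; apply: zen_sq_le => eps e0.
have mf : measurable_fun I (fun r : mR => line_sqint f (r + eps)) := measurable_funTS (mMe eps hf).
have mg : measurable_fun I (fun r : mR => line_sqint g (r + eps)) := measurable_funTS (mMe eps hg).
have mh : measurable_fun I (fun r : mR => line_sqint h (r + eps)) := measurable_funTS (mMe eps hh).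
have p0 (c : R) k r : 0 <= c -> (0 <= c%:E * line_sqint k r)%E.
  by move=> c0; rewrite mule_ge0 ?line_sqint_ge0.
apply: (@le_trans _ _ (\int[m]_(r in I)
   (a%:E * line_sqint f (r + eps)%R + b%:E * line_sqint g (r + eps)%R))%E).
  apply: ge0_le_integral => //.
  - by move=> r _; exact: line_sqint_ge0.
  - by apply: emeasurable_funD; exact: measurable_funeM.
  - move=> r /Ipos r0; apply: line_sqint_comb => //; lra.
have e : (\int[m]_(r in I) (a%:E * line_sqint f (r + eps)%R + b%:E * line_sqint g (r + eps)%R) =
    \int[m]_(r in I) (a%:E * line_sqint f (r + eps)%R) +
    \int[m]_(r in I) (b%:E * line_sqint g (r + eps)%R))%E.
  apply: ge0_integralD => //; try (by move=> r _; apply: p0); exact: measurable_funeM.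
rewrite e ge0_integralZl//; last by move=> r _; exact: line_sqint_ge0.
rewrite ge0_integralZl//; last by move=> r _; exact: line_sqint_ge0.
by apply: leeD; apply: lee_wpmul2l => //; exact: zen_sq_ge.
Qed.

Definition zen_fin f := hol0 f /\ (zen_sq m f < +oo)%E.
Definition zen_root f := Num.sqrt (fine (zen_sq m f)).

Lemma zen_fin_num f : zen_fin f -> zen_sq m f \is a fin_num.
Proof. by move=> [_ h]; rewrite ge0_fin_numE ?zen_sq_ge0. Qed.

Lemma zen_root_ge0 f : 0 <= zen_root f. Proof. exact: sqrtr_ge0. Qed.

Lemma zen_sq_root f : zen_fin f -> zen_sq m f = ((zen_root f) ^+ 2)%:E.
Proof.
by move=> hf; rewrite sqr_sqrtr ?fineK ?zen_fin_num// fine_ge0// zen_sq_ge0.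
Qed.

Lemma zen_root_le f c : 0 <= c -> (zen_sq m f <= (c ^+ 2)%:E)%E -> zen_root f <= c.
Proof.
move=> c0 h; rewrite -(ler_pXn2r (n := 2))// ?nnegrE ?zen_root_ge0//.
rewrite sqr_sqrtr ?fine_ge0 ?zen_sq_ge0//; rewrite -lee_fin fineK//.
by rewrite ge0_fin_numE ?zen_sq_ge0//; exact: le_lt_trans h (ltry _).
Qed.

Lemma zen_finZ c f : zen_fin f -> zen_fin (fun z => c * f z) /\
  zen_root (fun z => c * f z) <= normc c * zen_root f.
Proof.
move=> hf; have [h0 _] := hf; have hc := hol0Z c h0.
have h : (zen_sq m (fun z => c * f z)%R <= ((normc c * zen_root f) ^+ 2)%:E)%E.
  have := @zen_sq_comb f f _ (normc c ^+ 2) 0 h0 h0 hc (sqr_ge0 _) (lexx _).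
  rewrite mul0e adde0 exprMn EFinM (zen_sq_root hf); apply.
  by move=> z _; rewrite mul0r addr0 normcM exprMn.
split; first by split => //; exact: le_lt_trans h (ltry _).
by apply: zen_root_le => //; rewrite mulr_ge0 ?normc_ge0 ?zen_root_ge0.
Qed.

(** Minkowski's inequality, from the family of quadratic inequalities
   [|u + v|^2 <= (1 + t) |u|^2 + (1 + t^-1) |v|^2]. *)
Lemma zen_finD f g : zen_fin f -> zen_fin g -> zen_fin (fun z => f z + g z) /\
  zen_root (fun z => f z + g z) <= zen_root f + zen_root g.
Proof.
move=> hf hg; have [f0 _] := hf; have [g0 _] := hg; have fg0 := hol0D f0 g0.
set a := zen_root f; set b := zen_root g.
have a0 : 0 <= a by exact: zen_root_ge0.
have b0 : 0 <= b by exact: zen_root_ge0.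
have key t : 0 < t -> (zen_sq m (fun z => f z + g z)%R <=
    ((1 + t) * a ^+ 2 + (1 + t^-1) * b ^+ 2)%:E)%E.
  move=> t0; have ti : 0 < t^-1 by rewrite invr_gt0.
  have t1 : 0 <= 1 + t by lra.
  have t2 : 0 <= 1 + t^-1 by lra.
  have := @zen_sq_comb f g _ _ _ f0 g0 fg0 t1 t2.
  rewrite (zen_sq_root hf) (zen_sq_root hg) -!EFinM -EFinD; apply.
  move=> z _; set u := normc (f z); set v := normc (g z).
  apply: (@le_trans _ _ ((u + v) ^+ 2)).
    by rewrite ler_pXn2r ?nnegrE ?addr_ge0 ?normc_ge0//; exact: le_normcD.
  have : 0 <= t * (u - t^-1 * v) ^+ 2 by rewrite mulr_ge0 ?sqr_ge0// ltW.
  have -> : t * (u - t^-1 * v) ^+ 2 = t * u ^+ 2 + t^-1 * v ^+ 2 - 2 * u * v.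
    by field; rewrite gt_eqF.
  lra.
have fin : zen_fin (fun z => f z + g z).
  by split => //; exact: le_lt_trans (key 1 ltr01) (ltry _).
split; first exact: fin.
apply: zen_root_le; first exact: (addr_ge0 a0 b0).
rewrite (zen_sq_root fin) lee_fin; set c := zen_root _.
apply: sqr_le_of_weighted a0 b0 _ => t t0.
by have := key t t0; rewrite (zen_sq_root fin) lee_fin.
Qed.

Lemma zen_finB f g : zen_fin f -> zen_fin g -> zen_fin (fun z => f z - g z) /\
  zen_root (fun z => f z - g z) <= zen_root f + zen_root g.
Proof.
move=> hf hg; have [h1 h2] := zen_finZ (-1) hg; have [h3 h4] := zen_finD hf h1.
have e : (fun z => f z + -1 * g z) = (fun z => f z - g z).
  by apply/funext => z; rewrite mulN1r.
rewrite e in h3 h4; split; first exact: h3.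
apply: le_trans h4 _; rewrite lerD2l; apply: le_trans h2 _.
by rewrite normcN normc1 mul1r lexx.
Qed.

(** Fatou's lemma, applied on the half-plane for each shift [eps]. *)
Lemma zen_sq_lim (u : nat -> R[i] -> R[i]) f c : (forall n, hol0 (u n)) -> hol0 f ->
  (forall z, 0 < complex.Re z -> normc (u n z) @[n --> \oo] --> normc (f z)) ->
  (forall n, (zen_sq m (u n) <= c)%E) -> (zen_sq m f <= c)%E.
Proof.
move=> hu hf hlim hc; apply: zen_sq_le => eps e0.
rewrite -zen_sq_prod//.
pose F (g : R[i] -> R[i]) (p : mR * mR) := sqmod g ((p.1 + eps)%R, p.2).
have lim p : (I `*` setT) p -> limn_einf (fun n => F (u n) p) = F f p.
  move=> [/= /Ipos p0 _]; have h : F (u n) p @[n --> \oo] --> F f p.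
    apply: cvg_EFin; first exact: nearW.
    have h := hlim ((p.1 + eps) +i* p.2) (ltr_wpDl p0 e0).
    exact: (cvgM h h).
  by have [-> _] := cvg_limn_einf_sup h.
have mIT : measurable (I `*` [set: mR]) by exact: measurableX.
have mF g : hol0 g -> measurable_fun (I `*` [set: mR]) (F g).
  by move=> hg; exact: measurable_funTS (measurable_sqmod_shift eps hg).
have -> : (\int[m \x mu]_(p in I `*` setT) F f p =
    \int[m \x mu]_(p in I `*` setT) limn_einf (fun n => F (u n) p))%E.
  by apply: eq_integral => p; rewrite inE => /lim ->.
apply: le_trans (@fatou _ _ _ (m \x mu)%E _ mIT (fun n => F (u n)) _ _) _.
- by move=> n; exact: mF.
- by move=> n p _; exact: sqmod_ge0.
apply: limn_einf_le => n; rewrite zen_sq_prod//.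
exact: le_trans (zen_sq_ge _ _ e0) (hc n).
Qed.

End zen_seminorm.

(** * Completeness of the Zen space *)


Lemma geometric_small {R : realType} (C e q : R) : 0 <= q < 1 -> 0 < e ->
  exists N, forall n, (N <= n)%N -> C * q ^+ n <= e.
Proof.
move=> q01 e0; have /cvgr_dist_le/(_ e e0)[N _ hN] := cvg_geometric0 C q01.
by exists N => n /hN; rewrite /= sub0r normrN => /(le_trans (ler_norm _)).
Qed.

Section zen_complete.
Context {R : realType}.
Notation mR := (measurableTypeR R).
Variable m : {sigma_finite_measure set mR -> \bar R}.
Variable D : R.
Implicit Types (f g h : R[i] -> R[i]) (t r x : R).

Notation V := (initial_mass m).

Hypothesis Vfin : forall x, (V x < +oo)%E.
Hypothesis Vpos : forall x, 0 < x -> (0 < V x)%E.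
Hypothesis Vdbl : forall x, 0 < x -> (V (2 * x)%R <= D%:E * V x)%E.

Definition point_bound x := Num.sqrt (point_const m x).

Lemma zen_point_root f x z : zen_fin m f -> 0 < x -> x <= complex.Re z ->
  normc (f z) <= point_bound x * zen_root m f.
Proof.
move=> hf x0 xz; have [h0 h1] := hf.
have := zen_point Vfin Vpos h0 h1 x0 xz; rewrite (zen_sq_root hf) /=.
have pc := ltW (point_const_gt0 Vfin Vpos x0) => h.
have r0 := zen_root_ge0 m f.
rewrite -(ler_pXn2r (n := 2)) ?nnegrE ?normc_ge0//; last exact: (mulr_ge0 (sqrtr_ge0 _) r0).
by rewrite exprMn sqr_sqrtr.
Qed.

Lemma zen_lipschitz f x y z : zen_fin m f -> 0 < x ->
  2 * x <= complex.Re y -> 2 * x <= complex.Re z ->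
  normc (f y - f z) <= 4 * point_bound x / x * zen_root m f * normc (y - z).
Proof.
move=> hf x0 hy hz; have [[h1 h2] _] := hf.
have h := @lipschitz_right R f 0 x (point_bound x * zen_root m f) x x0 h1
  (fun z => zen_point_root hf x0) x0 y z.
have e : x + x = 2 * x by ring.
rewrite e in h; apply: le_trans (h hy hz) _.
by rewrite le_eqVlt; apply/orP; left; apply/eqP; ring.
Qed.

(** A sequence with geometrically small increments converges: point
   evaluations are bounded, which produces the limit function; differences of
   nearby terms are uniformly Lipschitz, which makes the limit holomorphic;
   Fatou's lemma bounds its norm. *)
Lemma zen_complete (u : nat -> R[i] -> R[i]) c q : 0 <= q < 1 ->
  (forall n, zen_fin m (u n)) ->
  (forall n, zen_root m (fun z => u n.+1 z - u n z) <= c * q ^+ n) ->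
  exists2 f, zen_fin m f & forall n, zen_root m (fun z => f z - u n z) <= c * q ^+ n / (1 - q).
Proof.
move=> q01 hu hc; have [q0 q1] := andP q01.
have q1' : 0 < 1 - q by rewrite subr_gt0.
have hd n : zen_fin m (fun z => u n.+1 z - u n z) := (zen_finB (hu n.+1) (hu n)).1.
have c0 : 0 <= c by have := le_trans (zen_root_ge0 _ _) (hc 0%N); rewrite expr0 mulr1.
have hlim (z : R[i]) : exists l, 0 < complex.Re z -> forall n,
    normc (l - u n z) <= 2 * (point_bound (complex.Re z) * c) / (1 - q) * q ^+ n.
  have [z0|z0] := ltP 0 (complex.Re z); last by exists 0.
  have [l hl] : exists l, forall n,
      normc (l - u n z) <= 2 * (point_bound (complex.Re z) * c) / (1 - q) * q ^+ n.
    apply: complex_geometric_limit => // n.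
    apply: le_trans (zen_point_root (hd n) z0 (lexx _)) _.
    by rewrite -mulrA; apply: ler_wpM2l (hc n); exact: sqrtr_ge0.
  by exists l.
have [f1 hf1] := choice hlim.
pose f z := if 0 < complex.Re z then f1 z else 0.
have flim z : 0 < complex.Re z -> forall n,
    normc (f z - u n z) <= 2 * (point_bound (complex.Re z) * c) / (1 - q) * q ^+ n.
  by move=> z0; rewrite /f z0; exact: hf1.
have tail n k : zen_fin m (fun z => u (k + n)%N z - u n z) /\
    zen_root m (fun z => u (k + n)%N z - u n z) <= c * q ^+ n / (1 - q).
  split; first exact: (zen_finB (hu _) (hu _)).1.
  suff : zen_root m (fun z => u (k + n)%N z - u n z) <= c * q ^+ n * ((1 - q ^+ k) / (1 - q)).
    move/le_trans; apply; apply: ler_wpM2l; first by rewrite mulr_ge0 ?exprn_ge0.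
    rewrite -[leRHS]mul1r ler_wpM2r ?invr_ge0 ?(ltW q1')// gerBl exprn_ge0//.
  elim: k => [|k ih].
    have e : (fun z => u (0 + n)%N z - u n z) = (fun z => 0 * u n z).
      by apply/funext => z; rewrite add0n subrr mul0r.
    rewrite expr0 subrr mul0r mulr0 e.
    by have [_] := zen_finZ 0 (hu n); rewrite normc0 mul0r.
  have [_ h] := zen_finD (hd (k + n)%N) (zen_finB (hu (k + n)%N) (hu n)).1.
  have e : (fun z => u (k + n).+1 z - u (k + n)%N z + (u (k + n)%N z - u n z)) =
           (fun z => u (k.+1 + n)%N z - u n z).
    by apply/funext => z; rewrite addrA subrK addSn.
  rewrite e in h; apply: le_trans h _.
  apply: le_trans (lerD (hc _) ih) _.
  rewrite le_eqVlt; apply/orP; left; apply/eqP; rewrite exprD exprS; field.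
  by rewrite gt_eqF.
have cvgn_norm n z : 0 < complex.Re z ->
    normc (u (k + n)%N z - u n z) @[k --> \oo] --> normc (f z - u n z).
  move=> z0; set C := 2 * (point_bound (complex.Re z) * c) / (1 - q).
  have h0 : C * q ^+ (k + n)%N @[k --> \oo] --> (0 : R).
    by have := @cvg_geometric0 _ C _ q01; rewrite -(cvg_shiftn n).
  apply/cvgrPdist_le => e e0; move/cvgrPdist_le : h0 => /(_ e e0).
  apply: filterS => k; rewrite sub0r normrN => h.
  apply: le_trans _ (le_trans (ler_norm _) h).
  apply: le_trans (flim z z0 (k + n)%N).
  apply: le_trans (le_normc_normc _ _) _.
  by rewrite opprB addrA subrK lexx.
(* the derivatives [l n] of the [u n] at [z] converge as well, by the Lipschitz
   bounds on the increments; their limit is the derivative of [f] *)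
have f0 : hol0 f.
  split => z z0; last by rewrite /f ltNge z0.
  pose x := complex.Re z / 4; have x0 : 0 < x by rewrite divr_gt0.
  pose K := 4 * point_bound x / x; have K0 : 0 <= K.
    by rewrite /K mulr_ge0 ?invr_ge0 ?(ltW x0)// mulr_ge0 ?sqrtr_ge0.
  have lip n s : 2 * x <= complex.Re s ->
      normc (f s - u n s - (f z - u n z)) <= K * (c * q ^+ n / (1 - q)) * normc (s - z).
    move=> hs; have zs : 0 < complex.Re s by apply: lt_le_trans hs; rewrite mulr_gt0.
    have hz : 2 * x <= complex.Re z by rewrite /x; lra.
    apply/ler_addgt0Pr => e e0.
    pose Cs := 2 * (point_bound (complex.Re s) * c) / (1 - q).
    pose Cz := 2 * (point_bound (complex.Re z) * c) / (1 - q).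
    have [N hN] := geometric_small (Cs + Cz) q01 e0.
    have [h1 h2] := tail n N.
    have h3 := hN (N + n)%N (leq_addr _ _).
    have h4 := zen_lipschitz h1 x0 hs hz; rewrite /= -/K in h4.
    have h5 := flim s zs (N + n)%N; have h6 := flim z z0 (N + n)%N.
    rewrite -/Cs -/Cz in h5 h6.
    have -> : f s - u n s - (f z - u n z) = (f s - u (N + n)%N s) - (f z - u (N + n)%N z) +
        (u (N + n)%N s - u n s - (u (N + n)%N z - u n z)) by ring.
    apply: le_trans (le_normcD _ _) _.
    have h7 := le_normcB (f s - u (N + n)%N s) (f z - u (N + n)%N z).
    have h8 : K * zen_root m (fun z => u (N + n)%N z - u n z) * normc (s - z) <=
        K * (c * q ^+ n / (1 - q)) * normc (s - z).
      by apply: (ler_wpM2r (normc_ge0 _)); exact: (ler_wpM2l K0).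
    move: h8 h4 h7 h3 h5 h6; rewrite mulrDl; lra.
  have hl n : exists l, forall e : R, 0 < e -> exists2 d : R, 0 < d & forall s,
      normc (s - z) < d -> normc (u n s - u n z - l * (s - z)) <= e * normc (s - z).
    by apply/cdiffP; have [[h _] _] := hu n; exact: h.
  have [l hln] := choice hl.
  have lS n : normc (l n.+1 - l n) <= K * c * q ^+ n.
    apply/ler_addgt0Pr => e e0; have e2 : 0 < e / 2 by rewrite divr_gt0.
    have [d1 d10 h1] := hln n.+1 _ e2; have [d2 d20 h2] := hln n _ e2.
    have m0 : 0 < Num.min d1 d2 by rewrite lt_min d10 d20.
    pose t := Num.min d1 d2 / 2; have t0 : 0 < t by rewrite divr_gt0.
    have nt : normc (z + t%:C - z) = t by rewrite addrC addKr normc_real gtr0_norm.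
    have td : t < Num.min d1 d2 by rewrite /t ltr_pdivrMr// ltr_pMr// ltr1n.
    have [td1 td2] : t < d1 /\ t < d2 by move: td; rewrite lt_min => /andP[].
    have := h1 (z + t%:C); have := h2 (z + t%:C); rewrite nt => /(_ td2) {}h2 /(_ td1) {}h1.
    have zx : complex.Re z = 4 * x by rewrite /x; field.
    have hz : 2 * x <= complex.Re z by lra.
    have hs : 2 * x <= complex.Re (z + t%:C).
      have -> : complex.Re (z + t%:C) = complex.Re z + t by case: (z).
      lra.
    have h3 := zen_lipschitz (hd n) x0 hs hz; rewrite /= -/K nt in h3.
    have h4 : K * zen_root m (fun z => u n.+1 z - u n z) * t <= K * (c * q ^+ n) * t.
      by apply: (ler_wpM2r (ltW t0)); exact: (ler_wpM2l K0).
    rewrite -(ler_pM2r t0); set w := z + t%:C in h1 h2 h3 nt *.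
    have -> : normc (l n.+1 - l n) * t = normc ((l n.+1 - l n) * (w - z)).
      by rewrite normcM nt.
    have -> : (l n.+1 - l n) * (w - z) =
        (u n w - u n z - l n * (w - z)) - (u n.+1 w - u n.+1 z - l n.+1 * (w - z)) +
        (u n.+1 w - u n w - (u n.+1 z - u n z)) by ring.
    apply: le_trans (le_normcD _ _) _.
    have h5 := le_normcB (u n w - u n z - l n * (w - z)) (u n.+1 w - u n.+1 z - l n.+1 * (w - z)).
    rewrite -(mulrA K) mulrDl.
    have e3 : e / 2 * t + e / 2 * t = e * t by field.
    move: h1 h2 h3 h4 h5 e3; lra.
  have [l0 hl0] := complex_geometric_limit q01 lS.
  apply/cdiffP; exists l0 => e e0; have e2 : 0 < e / 2 by rewrite divr_gt0.
  have [n hn] := geometric_small (3 * (K * c) / (1 - q)) q01 e2.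
  have {}hn := hn n (leqnn n).
  have [d d0 hd0] := hln n _ e2.
  exists (Num.min d (2 * x)); first by rewrite lt_min d0 mulr_gt0.
  move=> s; rewrite lt_min => /andP[sd sx].
  have hs : 2 * x <= complex.Re s.
    have := le_trans (ler_norm _) (normc_Re_le (z - s)).
    rewrite ReB -normcN opprB => h; have : complex.Re z = 4 * x by rewrite /x; field.
    lra.
  have h1 := lip n s hs; have h2 := hd0 s sd; have h3 := hl0 n.
  have -> : f s - f z - l0 * (s - z) = (f s - u n s - (f z - u n z)) +
    (u n s - u n z - l n * (s - z)) - (l0 - l n) * (s - z) by ring.
  apply: le_trans (le_normcB _ _) _; rewrite normcM.
  have h4 := le_normcD (f s - u n s - (f z - u n z)) (u n s - u n z - l n * (s - z)).
  have N0 := normc_ge0 (s - z).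
  have h5 := ler_wpM2r N0 h3; have h6 := ler_wpM2r N0 hn.
  have e3 : e / 2 * normc (s - z) + e / 2 * normc (s - z) = e * normc (s - z) by field.
  have e4 : 3 * (K * c) / (1 - q) * q ^+ n * normc (s - z) =
    K * (c * q ^+ n / (1 - q)) * normc (s - z) + 2 * (K * c) / (1 - q) * q ^+ n * normc (s - z) by ring.
  by move: h1 h2 h4 h5 h6 e3 e4; lra.
have fB n : hol0 (fun z => f z - u n z) by apply: hol0B => //; have [] := hu n.
have fn n : (zen_sq m (fun z => f z - u n z)%R <= ((c * q ^+ n / (1 - q)) ^+ 2)%:E)%E.
  apply: (zen_sq_lim (u := fun k z => u (k + n)%N z - u n z)) => //.
  - by move=> k; have [[]] := tail n k.
  - by move=> z; exact: cvgn_norm.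
  - move=> k; have [h1 h2] := tail n k; rewrite (zen_sq_root h1) lee_fin.
    rewrite ler_pXn2r ?nnegrE ?zen_root_ge0//.
    by rewrite divr_ge0 ?(ltW q1')// mulr_ge0// exprn_ge0.
have fin n : zen_fin m (fun z => f z - u n z).
  by split; [exact: fB|exact: le_lt_trans (fn n) (ltry _)].
exists f.
  have [h _] := zen_finD (fin 0%N) (hu 0%N).
  by rewrite (_ : f = (fun z => f z - u 0%N z + u 0%N z))//; apply/funext => z; rewrite subrK.
move=> n; apply: zen_root_le (fn n).
by rewrite divr_ge0 ?(ltW q1')// mulr_ge0// exprn_ge0.
Qed.

End zen_complete.

(** * Self-maps of the half-plane with a radial limit *)


Section radial_limit.
Context {R : realType}.
Notation mR := (measurableTypeR R).
Notation mu := (@lebesgue_measure R).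
Implicit Types (z w : R[i]) (x y t : R).

Lemma Re_inv_pker w : complex.Re w^-1 = pker (complex.Re w) (complex.Im w).
Proof. by case: w. Qed.

Lemma Re_inv_ge0 w : 0 < complex.Re w -> 0 <= complex.Re w^-1.
Proof. by move=> h; rewrite Re_inv_pker pker_ge0. Qed.

Lemma normcV_le w c : 0 < c -> c <= normc w -> normc w^-1 <= c^-1.
Proof. by move=> c0 h; rewrite normcV lef_pV2 ?posrE//; exact: lt_le_trans h. Qed.

Lemma Re_neq0 w : 0 < complex.Re w -> w != 0.
Proof. by case: w => a b /= a0; rewrite eq_complex /= negb_and gt_eqF. Qed.

Definition radial_limit (Q : R[i] -> R[i]) (lam : R) := forall e, 0 < e ->
  exists A, forall x, A <= x -> 0 < x -> normc (x%:C / Q x%:C - lam%:C) < e.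

Variables (Q : R[i] -> R[i]) (lam : R).
Hypothesis hQ : forall z, 0 < complex.Re z -> cdiff Q z.
Hypothesis Q0 : forall z, 0 < complex.Re z -> 0 < complex.Re (Q z).
Hypothesis hrad : radial_limit Q lam.

Lemma radial_limit_ge0 : 0 <= lam.
Proof.
rewrite leNgt; apply/negP => l0; have l0' : 0 < - lam by lra.
have [A hA] := hrad l0'.
have := hA (`|A| + 1); set x := `|A| + 1 => {}hA.
have x0 : 0 < x by rewrite ltr_wpDl.
have Ax : A <= x by rewrite /x; have := ler_norm A; lra.
have := le_lt_trans (normc_Re_le _) (hA Ax x0); rewrite ReB.
have : 0 <= complex.Re (x%:C / Q x%:C).
  have -> : complex.Re (x%:C / Q x%:C) = x * complex.Re (Q x%:C)^-1.
    by case: (Q _)^-1 => a b /=; rewrite mul0r subr0.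
  by rewrite mulr_ge0 ?(ltW x0)// Re_inv_ge0// Q0.
by rewrite ltr_norml /= => h /andP[_]; lra.
Qed.

(** Translating [Q] by a constant does not change its radial limit. *)
Lemma radial_limit_shift w e (A : R) : 0 < e ->
  exists2 X, A < X & X * complex.Re (Q X%:C - w)^-1 <= lam + e.
Proof.
move=> e0; have l0 := radial_limit_ge0.
have e2 : 0 < e / 2 by rewrite divr_gt0.
have [A' hA'] := hrad e2.
pose B := lam + e / 2; have B0 : 0 < B by rewrite /B; lra.
pose C := 2 * B * (lam + e) * normc w / e.
have C0 : 0 <= C by rewrite /C !mulr_ge0 ?invr_ge0 ?normc_ge0//; lra.
pose X := `|A| + `|A'| + C + 1.
have [X1 X2 X3 X0] : [/\ A < X, A' <= X, C < X & 0 < X].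
  have := ler_norm A; have := ler_norm A'; have := normr_ge0 A; have := normr_ge0 A'.
  by move=> *; split; rewrite /X; lra.
exists X => //; have := hA' X X2 X0.
have Qn : Q X%:C != 0 by apply: Re_neq0; exact: Q0.
have q0 : 0 < normc (Q X%:C) by rewrite normc_gt0.
move=> /ltW h; have h1 : normc (X%:C / Q X%:C) <= B.
  apply: le_trans (le_normc_sub _ lam%:C) _.
  by rewrite normc_real ger0_norm// /B lerD2l.
rewrite normcM normcV normc_real gtr0_norm// ler_pdivrMr// in h1.
have h2 := le_normc_sub (Q X%:C) w.
have h3 : X <= (lam + e) * normc (Q X%:C - w).
  have h4 : X * (e / 2) >= (lam + e) * normc w * B.
    have -> : (lam + e) * normc w * B = C * (e / 2) by rewrite /C; field; rewrite gt_eqF.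
    by rewrite ler_wpM2r//; lra.
  have le0 : 0 <= lam + e by lra.
  rewrite -(ler_pM2r B0).
  have h5 := ler_wpM2l le0 h1; have h6 := ler_wpM2l (mulr_ge0 le0 (ltW B0)) h2.
  have eB : X * B = X * (lam + e) - X * (e / 2) by rewrite /B; field.
  move: h4 h5 h6 eB; lra.
have d0 : 0 < normc (Q X%:C - w) by nra.
have h4 : complex.Re (Q X%:C - w)^-1 <= (normc (Q X%:C - w))^-1.
  by rewrite -normcV; apply: le_trans (ler_norm _) (normc_Re_le _).
apply: le_trans (ler_wpM2l (ltW X0) h4) _.
by rewrite ler_pdivrMr.
Qed.

(** The reciprocal [(Q - w)^-1] has nonnegative real part, is bounded, and decays
   like [lam / X] along the real axis: [Re_le_radial_limit] applies to it. *)
Let shift_bound w c : 0 < c -> (forall z, 0 < complex.Re z -> c <= complex.Re (Q z - w)) ->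
  forall x t q, 0 < x -> 0 < t -> complex.Re (Q ((x + t) +i* q) - w)^-1 <= lam / t.
Proof.
move=> c0 hc; apply: (@Re_le_radial_limit R (fun z => (Q z - w)^-1) 0 lam).
- exact: lexx.
- exact: radial_limit_ge0.
- move=> z z0; apply: cdiffV; last by apply: cdiffB; [exact: hQ|exact: cdiff_cst].
  by apply: Re_neq0; apply: lt_le_trans c0 (hc z z0).
- by move=> z z0; apply: Re_inv_ge0; apply: lt_le_trans c0 (hc z z0).
- move=> x x0; exists c^-1 => z xz; apply: (normcV_le c0).
  apply: le_trans (hc z (lt_le_trans x0 xz)) _.
  by apply: le_trans (ler_norm _) (normc_Re_le _).
- by move=> e A e0; exact: radial_limit_shift.
Qed.

(** If [lam] were zero, [(Q + 1)^-1] would have nonpositive real part by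
   [shift_bound], although [Q + 1] has positive real part. *)
Lemma radial_limit_gt0 : 0 < lam.
Proof.
rewrite lt_neqAle radial_limit_ge0 andbT eq_sym; apply/negP => /eqP l0.
have h z : 0 < complex.Re z -> 1 <= complex.Re (Q z - (-1)).
  by move=> /Q0; rewrite opprK raddfD /=; lra.
have h2 : 0 < complex.Re ((1 + 1 : R) +i* 0) by rewrite /=; lra.
have := @shift_bound (-1) 1 ltr01 h 1 1 0 ltr01 ltr01.
rewrite l0 mul0r leNgt => /negP; apply.
rewrite Re_inv_pker; have := h _ h2; set a := complex.Re _ => a1.
by rewrite /pker divr_gt0 ?pker_den_gt0//; lra.
Qed.

(** Julia's lemma on the half-plane: [shift_bound] for [Q - i tau + e], with [tau]
   the imaginary part of [Q z], evaluated at [z], where the reciprocal is real. *)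
Lemma julia z : 0 < complex.Re z -> complex.Re z <= lam * complex.Re (Q z).
Proof.
case: z => a b /= a0; set w := Q (a +i* b); have u0 : 0 < complex.Re w by exact: Q0.
have l0 := radial_limit_gt0.
have key e x : 0 < e -> 0 < x -> x < a -> a - x <= lam * (complex.Re w + e).
  move=> e0 x0 xa; have t0 : 0 < a - x by rewrite subr_gt0.
  have h z : 0 < complex.Re z -> e <= complex.Re (Q z - ((- e) +i* complex.Im w)).
    by move=> /Q0; rewrite ReB /=; lra.
  have := @shift_bound _ e e0 h x (a - x) b x0 t0.
  rewrite [x + (a - x)]addrC subrK -/w Re_inv_pker ReB ImB /= subrr opprK /pker expr0n /= addr0 expr2.
  have ue : 0 < complex.Re w + e by lra.
  rewrite invfM mulrA divff ?gt_eqF// mul1r.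
  by rewrite -[leRHS]invrK lef_pV2 ?posrE ?invr_gt0 ?divr_gt0// invf_div ler_pdivrMr// mulrC.
apply/ler_addgt0Pr => e e0.
pose d := Num.min (a / 2) (e / 2).
have d0 : 0 < d by rewrite lt_min !divr_gt0.
have [d1 d2] : d <= a / 2 /\ d <= e / 2 by rewrite /d !ge_min !lexx orbT.
have el : 0 < e / (2 * lam) by rewrite divr_gt0// mulr_gt0.
have := key _ d el d0 ltac:(lra).
have -> : lam * (complex.Re w + e / (2 * lam)) = lam * complex.Re w + e / 2.
  by field; rewrite gt_eqF.
lra.
Qed.

(** The kernel is the real part of [(Q - (d + i q))^-1], which is positive for
   [Re z > lam * d] by [julia]: this is [mass_le_radial_limit]. *)
Lemma pker_mass d x q : 0 < d -> lam * d < x ->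
  (\int[mu]_y (pker (complex.Re (Q (x +i* y)) - d) (q - complex.Im (Q (x +i* y))))%:E <=
   (pi * lam)%:E)%E.
Proof.
move=> d0 dx; have l0 := radial_limit_gt0.
have ld : 0 <= lam * d by rewrite mulr_ge0// ltW.
have pos c z : lam * d < c -> c <= complex.Re z -> c / lam - d <= complex.Re (Q z - (d +i* q)).
  move=> hc cz; have z0 : 0 < complex.Re z by apply: lt_le_trans cz; exact: le_lt_trans hc.
  have := julia z0; rewrite ReB /= lerD2r ler_pdivrMr// mulrC; exact: le_trans.
have c0 c : lam * d < c -> 0 < c / lam - d by rewrite subr_gt0 ltr_pdivlMr// mulrC.
have := @mass_le_radial_limit R (fun z => (Q z - (d +i* q))^-1) (lam * d) lam ld (ltW l0)
  _ _ _ _ x dx.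
rewrite (_ : (fun y => _) = (fun y =>
  (pker (complex.Re (Q (x +i* y)) - d) (q - complex.Im (Q (x +i* y))))%:E)).
  apply.
  - move=> z hz; have z0 : 0 < complex.Re z by exact: le_lt_trans hz.
    apply: cdiffV; last by apply: cdiffB; [exact: hQ|exact: cdiff_cst].
    by apply: Re_neq0; apply: lt_le_trans (c0 _ hz) (pos _ _ hz (lexx _)).
  - move=> z hz; apply: Re_inv_ge0.
    by apply: lt_le_trans (c0 _ hz) (pos _ _ hz (lexx _)).
  - move=> c hc; exists (c / lam - d)^-1 => z cz; apply: normcV_le; first exact: c0.
    apply: le_trans (pos _ _ hc cz) _.
    by apply: le_trans (ler_norm _) (normc_Re_le _).
  - by move=> e A e0; exact: radial_limit_shift.
apply/funext => y; rewrite Re_inv_pker ReB ImB /=; congr EFin.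
by rewrite -[LHS]pkerN opprB.
Qed.

End radial_limit.

(** * Composition operators: the upper bound *)


Section composition.
Context {R : realType}.
Notation mR := (measurableTypeR R).
Notation mu := (@lebesgue_measure R).
Implicit Types (z w : R[i]) (x y t : R) (F Q : R[i] -> R[i]).

Lemma measurable_pker_pair (u v : mR -> R) : (forall y, rcont u y) -> (forall y, rcont v y) ->
  (forall y, 0 < u y) ->
  measurable_fun setT (fun p : mR * mR => pker (u p.1) (p.2 - v p.1)).
Proof.
move=> cu cv u0.
have mu1 : measurable_fun setT (fun p : mR * mR => u p.1).
  exact: measurableT_comp (rcont_measurable cu) measurable_fst.
have mv1 : measurable_fun setT (fun p : mR * mR => p.2 - v p.1).
  apply: measurable_funB; first exact: measurable_snd.
  exact: measurableT_comp (rcont_measurable cv) measurable_fst.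
have md : measurable_fun setT (fun p : mR * mR => u p.1 ^+ 2 + (p.2 - v p.1) ^+ 2).
  by apply: measurable_funD; apply: measurable_funX.
have -> : (fun p : mR * mR => pker (u p.1) (p.2 - v p.1)) =
    (fun p => u p.1 * expR (- ln (u p.1 ^+ 2 + (p.2 - v p.1) ^+ 2))).
  apply/funext => p; rewrite /pker; congr (_ * _).
  by rewrite expRN lnK// posrE pker_den_gt0.
apply: measurable_funM => //.
apply: measurableT_comp (@measurable_expR R) _.
apply: measurable_funN; exact: measurableT_comp (@measurable_ln R) md.
Qed.

(** Extended by zero, like the functions to which it is applied. *)
Definition comp0 F Q z := if 0 < complex.Re z then F (Q z) else 0.

Variables (Q : R[i] -> R[i]) (lam : R).
Hypothesis hQ : forall z, 0 < complex.Re z -> cdiff Q z.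
Hypothesis Q0 : forall z, 0 < complex.Re z -> 0 < complex.Re (Q z).

Lemma hol0_comp0 F : hol0 F -> hol0 (comp0 F Q).
Proof.
move=> [h1 h2]; split=> z z0; last by rewrite /comp0 ltNge z0.
apply: (@cdiff_near _ (fun s => F (Q s)) _ _ (complex.Re z)) => //; last first.
  by apply: cdiff_comp; [exact: hQ|apply: h1; exact: Q0].
move=> s hs; rewrite /comp0 ifT//.
have := le_trans (ler_norm _) (normc_Re_le (z - s)); rewrite ReB -normcN opprB; lra.
Qed.

Hypothesis hrad : radial_limit Q lam.

(** Poisson's formula for [|F|^2] on the line of abscissa [d], evaluated along
   the image of the line of abscissa [x]. *)
Lemma line_sqint_comp F d x : hol0 F -> bounded_right F -> 0 < d -> lam * d < x ->
  (line_sqint (comp0 F Q) x <= lam%:E * line_sqint F d)%E.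
Proof.
move=> hF bF d0 dx; have l0 := radial_limit_gt0 hQ Q0 hrad.
have x0 : 0 < x by apply: le_lt_trans dx; rewrite mulr_ge0// ltW.
have pi0 := @pi_gt0 R.
have hG := hol0_comp0 hF.
pose u y := complex.Re (Q (x +i* y)) - d; pose v y := complex.Im (Q (x +i* y)).
have u0 y : 0 < u y.
  have h : 0 < complex.Re (x +i* y) by [].
  have := julia hQ Q0 hrad h; rewrite /= => hJ.
  by rewrite subr_gt0 -(ltr_pM2l l0); exact: lt_le_trans dx hJ.
have cu y : rcont u y.
  apply: cvgB; last exact: cvg_cst.
  by apply: ccont_Re_vert; apply/cdiff_ccont/hQ.
have cv y : rcont v y by apply: ccont_Im_vert; apply/cdiff_ccont/hQ.
have mF : measurable_fun setT (fun s : mR => sqmod F (d, s)) := measurable_sqmod_line d hF.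
have mG : measurable_fun setT (fun y : mR => sqmod (comp0 F Q) (x, y)) := measurable_sqmod_line x hG.
pose k (p : mR * mR) := pker (u p.1) (p.2 - v p.1).
have mk : measurable_fun setT k by exact: measurable_pker_pair.
have k0 p : 0 <= k p by exact: pker_ge0.
pose Phi p := ((k p)%:E * sqmod F (d, p.2))%E.
have Phi0 p : (0 <= Phi p)%E by rewrite mule_ge0 ?sqmod_ge0// lee_fin.
have mPhi : measurable_fun setT Phi.
  apply: emeasurable_funM; first exact/measurable_EFinP.
  exact: measurableT_comp mF measurable_snd.
rewrite -(@lee_pmul2l _ pi%:E) ?fin_numE// ?lte_fin//.
rewrite -ge0_integralZl//; last 2 first.
- by move=> y _; exact: sqmod_ge0.
- by rewrite lee_fin ltW.
apply: (@le_trans _ _ (\int[mu]_y \int[mu]_s Phi (y, s))%E).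
  apply: ge0_le_integral => //.
  - by move=> y _; rewrite mule_ge0 ?sqmod_ge0// lee_fin ltW.
  - exact: measurable_funeM.
  - exact: measurable_fun_fubini_tonelli_F.
  move=> y _; rewrite /sqmod /comp0 /= x0 -EFinM.
  have := poisson_line_sqint (v y) hF bF d0 (u0 y).
  have -> : ((d + u y) +i* v y) = Q (x +i* y).
    by rewrite /u /v addrC subrK; case: (Q _).
  by [].
rewrite (tonelli_rect mu mu (f := Phi) measurableT measurableT mPhi Phi0).
rewrite muleA -EFinM /line_sqint -ge0_integralZl//; last 2 first.
- by move=> y _; exact: sqmod_ge0.
- by rewrite lee_fin mulr_ge0// ltW.
apply: ge0_le_integral => //.
- by move=> y _; exact: integral_ge0.
- exact: measurable_fun_fubini_tonelli_G.
- exact: measurable_funeM.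
move=> s _; rewrite /Phi /=.
under eq_integral do rewrite muleC.
rewrite ge0_integralZl//; last 3 first.
- by apply/measurable_EFinP; exact: measurableT_comp mk (measurable_pair2 _).
- by move=> y _; rewrite lee_fin.
- exact: sqmod_ge0.
rewrite muleC; apply: lee_wpmul2r; first exact: sqmod_ge0.
exact: (pker_mass hQ Q0 hrad s d0 dx).
Qed.

Variables (m : {sigma_finite_measure set mR -> \bar R}) (K : R).
Notation V := (initial_mass m).
Hypothesis Vfin : forall x, (V x < +oo)%E.
Hypothesis Vpos : forall x, 0 < x -> (0 < V x)%E.
Hypothesis K0 : 0 <= K.
Hypothesis VK : forall s, 0 < s -> (V (lam * s)%R <= K%:E * V s)%E.

(** Line by line the composition loses a factor [lam] and a dilation by [lam];
   [integral_dilation_le] undoes the dilation at the cost of [K]. *)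
Lemma zen_sq_comp F : hol0 F -> (zen_sq m F < +oo)%E ->
  (zen_sq m (comp0 F Q) <= (lam * K)%:E * zen_sq m F)%E.
Proof.
move=> hF fF; have l0 := radial_limit_gt0 hQ Q0 hrad.
have bF := zen_bounded_right Vfin Vpos hF fF.
have hG := hol0_comp0 hF.
have mM : measurable_fun setT (line_sqint F : mR -> \bar R) by exact: measurable_line_sqint.
apply: zen_sq_le => eps eps0; pose e := eps / (2 * lam).
have e0 : 0 < e by rewrite divr_gt0// mulr_gt0.
have me : measurable_fun setT (fun r : mR => line_sqint F (r / lam + e)).
  apply: measurableT_comp mM _; apply: measurable_funD => //; exact: measurable_funM.
apply: (@le_trans _ _ (\int[m]_(r in `[0%R, +oo[) (lam%:E * line_sqint F (r / lam + e)%R))%E).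
  apply: ge0_le_integral => //.
  - by move=> r _; exact: line_sqint_ge0.
  - apply: measurable_funTS; apply: measurableT_comp (measurable_line_sqint hG) _.
    exact: measurable_funD.
  - by apply: measurable_funTS; exact: measurable_funeM.
  move=> r; rewrite /= in_itv/= andbT => r0; apply: line_sqint_comp => //.
    by rewrite ltr_wpDl// divr_ge0// ltW.
  have -> : lam * (r / lam + e) = r + eps / 2 by rewrite /e; field; rewrite gt_eqF.
  lra.
rewrite ge0_integralZl//; last 3 first.
- exact: measurable_funTS.
- by move=> r _; exact: line_sqint_ge0.
- by rewrite lee_fin ltW.
rewrite EFinM -muleA; apply: lee_wpmul2l; first by rewrite lee_fin ltW.
apply: le_trans (@integral_dilation_le R m (line_sqint F) lam K e mM _ _ l0 K0 e0 VK) _.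
- by move=> r; exact: line_sqint_ge0.
- by move=> x y x0 xy; exact: line_sqint_mono.
apply: lee_wpmul2l; first by rewrite lee_fin.
by apply: zen_sq_ge; rewrite divr_gt0.
Qed.

End composition.

(** * Iterates *)


Section iterates.
Context {R : realType}.
Implicit Types (z w : R[i]) (x y t : R).

(** Iteration from the real axis stays in the sector of half-angle [pi / 4], here
   described by [|Im z| <= Re z]. *)
Definition sector_limit (P : R[i] -> R[i]) (L : R) := forall e : R, 0 < e ->
  exists A : R, forall z, 0 < complex.Re z -> `|complex.Im z| <= complex.Re z ->
    A <= normc z -> normc (z / P z - L%:C) < e.

Variables (P : R[i] -> R[i]) (L : R).
Hypothesis hP : forall z, 0 < complex.Re z -> cdiff P z.
Hypothesis P0 : forall z, 0 < complex.Re z -> 0 < complex.Re (P z).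
Hypothesis hsec : sector_limit P L.

Lemma sector_radial_limit : radial_limit P L.
Proof.
move=> e e0; have [A hA] := hsec e0; exists A => x Ax x0.
by apply: hA; rewrite ?normc_real /= ?normr0 ?gtr0_norm// ltW.
Qed.

Lemma iter_pos n z : 0 < complex.Re z -> 0 < complex.Re (iter n P z).
Proof. by move=> z0; elim: n => //= n; exact: P0. Qed.

Lemma iter_cdiff n z : 0 < complex.Re z -> cdiff (iter n P) z.
Proof.
move=> z0; elim: n => [|n ih]; first exact: cdiff_id.
by apply: (cdiff_comp ih); apply: hP; exact: iter_pos.
Qed.

(** Along the real axis the iterates stay in a sector and tend to infinity, so
   that the ratios [P^k x / P^(k+1) x] multiply up in the limit. *)
Lemma iter_radial_limit n : radial_limit (iter n P) (L ^+ n).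
Proof.
have L0 : 0 < L := radial_limit_gt0 hP P0 sector_radial_limit.
elim: n => [|n ih] e e0.
  exists 0 => x _ x0; rewrite [iter 0 P _]/(x%:C) divff; last exact: Re_neq0.
  by rewrite expr0 subrr normc0.
set l := L ^+ n in ih; have l0 : 0 < l by rewrite exprn_gt0.
pose e1 := Num.min 1 (e / (4 * l)).
have e10 : 0 < e1 by rewrite lt_min ltr01/= divr_gt0// mulr_gt0.
have [e11 e1l] : e1 <= 1 /\ e1 <= e / (4 * l) by rewrite /e1 !ge_min !lexx orbT.
pose e2 := Num.min (l / 4) (e / (4 * (L + 1))).
have L1 : 0 < 4 * (L + 1) by rewrite mulr_gt0//; lra.
have e20 : 0 < e2 by rewrite lt_min !divr_gt0.
have [e2l e2e] : e2 <= l / 4 /\ e2 <= e / (4 * (L + 1)) by rewrite /e2 !ge_min !lexx orbT.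
have [A1 hA1] := hsec e10; have [A2 hA2] := ih e2 e20.
exists (Num.max A2 (2 * l * A1)) => x; rewrite ge_max => /andP[xA2 xA1] x0.
have x0' : 0 < complex.Re x%:C by [].
have := hA2 x xA2 x0; set z := iter n P x%:C; set rho := x%:C / z => hrho.
have z0 : 0 < complex.Re z by exact: iter_pos.
have zn : z != 0 by exact: Re_neq0.
have wn : P z != 0 by apply: Re_neq0; exact: P0.
have ez : rho * z = x%:C by rewrite /rho divfK.
have := le_lt_trans (normc_Re_le _) hrho; have := le_lt_trans (normc_Im_le _) hrho.
rewrite ReB ImB /= subr0 => hb; rewrite ltr_norml => /andP[ha _].
have rho_le : normc rho <= 2 * l.
  apply: le_trans (le_normc_sub rho l%:C) _; rewrite normc_real gtr0_norm//; lra.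
have zA : A1 <= normc z.
  have : normc rho * normc z = x by rewrite -normcM ez normc_real gtr0_norm.
  have h : normc rho * normc z <= 2 * l * normc z by rewrite ler_wpM2r ?normc_ge0.
  move=> h2; rewrite h2 in h; rewrite -(@ler_pM2l _ (2 * l)) ?mulr_gt0//.
  exact: le_trans xA1 h.
have sect : `|complex.Im z| <= complex.Re z.
  move: ez hb ha z0; case: (z) => u v; case: (rho) => a b [] /= _ hv hb ha u0.
  have a0 : 0 < a by lra.
  have ba : `|b| <= a by lra.
  have : a * `|v| = `|b| * u.
    by rewrite -{1}(gtr0_norm a0) -{1}(gtr0_norm u0) -!normrM -[RHS]normrN; congr (`|_|); lra.
  move=> hh; rewrite -(ler_pM2l a0) hh; exact: (ler_wpM2r (ltW u0)).
have hs := hA1 z z0 sect zA; set sig := z / P z in hs.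
have -> : x%:C / iter n.+1 P x%:C = rho * sig.
  by rewrite /rho /sig iterS -/z mulrA divfK.
have -> : rho * sig - (L ^+ n.+1)%:C = (rho - l%:C) * sig + l%:C * (sig - L%:C).
  by rewrite exprSr -/l rmorphM; ring.
apply: le_lt_trans (le_normcD _ _) _; rewrite (normcM (rho - l%:C)) (normcM l%:C) normc_real (gtr0_norm l0).
have sle : normc sig <= L + 1.
  apply: le_trans (le_normc_sub sig L%:C) _; rewrite normc_real gtr0_norm//.
  by have := ltW hs; lra.
have h1 : normc (rho - l%:C) * normc sig <= e / 4.
  apply: le_trans (ler_pM (normc_ge0 _) (normc_ge0 _) (le_trans (ltW hrho) e2e) sle) _.
  rewrite le_eqVlt; apply/orP; left; apply/eqP; field.
  by rewrite gt_eqF//; lra.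
have h2 : l * normc (sig - L%:C) <= e / 4.
  apply: le_trans (ler_wpM2l (ltW l0) (le_trans (ltW hs) e1l)) _.
  by rewrite le_eqVlt; apply/orP; left; apply/eqP; field; rewrite gt_eqF.
by apply: le_lt_trans (lerD h1 h2) _; lra.
Qed.

End iterates.

(** * Composition operators: the lower bound *)


Section test_function.
Context {R : realType}.
Notation mR := (measurableTypeR R).
Notation mu := (@lebesgue_measure R).
Variable m : {sigma_finite_measure set mR -> \bar R}.
Variable D : R.
Implicit Types (z w : R[i]) (x y t : R) (F Q : R[i] -> R[i]).

Notation V := (initial_mass m).
Notation I := (`[0%R, +oo[%classic : set mR).

Hypothesis Vfin : forall x, (V x < +oo)%E.
Hypothesis Vpos : forall x, 0 < x -> (0 < V x)%E.
Hypothesis Vdbl : forall x, 0 < x -> (V (2 * x)%R <= D%:E * V x)%E.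

Definition inverse_power x j z := if 0 < complex.Re z then (z + x%:C) ^- j.+1 else 0.

Lemma hol0_inverse_power x j : 0 < x -> hol0 (inverse_power x j).
Proof.
move=> x0; split=> z z0; last by rewrite /inverse_power ltNge z0.
apply: (@cdiff_near _ (fun s => ((s + x%:C) ^+ j.+1)^-1) _ _ (complex.Re z)) => //; last first.
  apply: cdiffV; last by apply: cdiffX; apply: cdiffD; [exact: cdiff_id|exact: cdiff_cst].
  by rewrite expf_neq0//; apply: Re_neq0; rewrite raddfD/= addr_gt0.
move=> s hs; rewrite /inverse_power ifT//.
have := le_trans (ler_norm _) (normc_Re_le (z - s)); rewrite ReB -normcN opprB; lra.
Qed.

Lemma line_sqint_inverse_power x j s : 0 < x -> 0 < s ->
  (line_sqint (inverse_power x j) s <= (pi * (s + x) ^- (2 * j).+1)%:E)%E.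
Proof.
move=> x0 s0; set t := s + x; have t0 : 0 < t by rewrite addr_gt0.
have hF := hol0_inverse_power j x0.
have mF : measurable_fun setT (fun y : mR => sqmod (inverse_power x j) (s, y)) := measurable_sqmod_line s hF.
have c0 : 0 <= t ^- (2 * j).+1 by rewrite invr_ge0 exprn_ge0// ltW.
have pk0 y : [set: mR] y -> (0 <= (pker t (y - 0))%:E)%E by rewrite lee_fin pker_ge0.
have mk : measurable_fun setT (fun y : mR => (pker t (y - 0))%:E).
  apply/measurable_EFinP; apply: measurableT_comp (measurable_pker t0) _; exact: measurable_funB.
rewrite mulrC EFinM -(integral_pker 0 t0) -ge0_integralZl//.
apply: ge0_le_integral => //; first by move=> y _; exact: sqmod_ge0.
  exact: measurable_funeM.
move=> y _; rewrite subr0 /sqmod /inverse_power /= s0 -EFinM lee_fin.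
have -> : normc (((s +i* y) + x%:C) ^- j.+1) ^+ 2 = ((t ^+ 2 + y ^+ 2)^-1) ^+ j.+1.
  rewrite normcV normcX !exprVn exprAC sqr_normc_Re_Im/= addr0.
  by [].
have den := pker_den_gt0 y t0; rewrite /pker.
have h : (t ^+ 2 + y ^+ 2)^-1 <= (t ^+ 2)^-1.
  by rewrite lef_pV2 ?posrE ?exprn_gt0// lerDl sqr_ge0.
set w := (t ^+ 2 + y ^+ 2)^-1 in h *; have w0 : 0 <= w by rewrite invr_ge0 ltW.
have -> : t ^- (2 * j).+1 * (t * w) = (t ^+ 2)^-1 ^+ j * w.
  rewrite exprVn -exprM exprS; have : t ^+ (2 * j) != 0 by rewrite expf_neq0// gt_eqF.
  clearbody w; move: (t ^+ (2 * j)) => a a0; field.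
  by rewrite a0 gt_eqF.
by rewrite exprSr ler_wpM2r// lerXn2r ?nnegrE ?invr_ge0 ?exprn_ge0// ltW.
Qed.

Lemma zen_sq_inverse_power x j p : 0 < x -> 2 * D <= 2 ^+ p -> (p <= (2 * j).+1)%N ->
  (zen_sq m (inverse_power x j) <= (pi * x ^- (2 * j).+1 * (1 + 2 * D))%:E * V x)%E.
Proof.
move=> x0 hp pq; set q := (2 * j).+1 in pq *.
have hq : 2 * D <= 2 ^+ q by apply: le_trans hp _; rewrite ler_eXn2l// ltr1n.
have hF := hol0_inverse_power j x0.
have pi0 := @pi_gt0 R.
have c0 : 0 <= pi * x ^- q by rewrite mulr_ge0 ?invr_ge0 ?exprn_ge0// ltW.
have f0 r : 0 <= r -> 0 <= (1 + r / x) ^- q.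
  by move=> r0; rewrite invr_ge0 exprn_ge0// addr_ge0// divr_ge0// ltW.
have mf : measurable_fun I (fun r : mR => ((1 + r / x) ^- q)%:E).
  apply/measurable_EFinP.
  have -> : (fun r : mR => (1 + r / x) ^- q) = (fun r => ((1 + r / x)^-1) ^+ q).
    by apply/funext => r; rewrite exprVn.
  apply: measurable_funX; apply: subspace_continuous_measurable_fun => //.
  have cD (r : R) : (1 + s / x) @[s --> r] --> (1 + r / x : R).
    by apply: cvgD; [exact: cvg_cst|apply: cvgM; [exact: cvg_id|exact: cvg_cst]].
  apply/continuous_within_itvcyP; split.
    move=> r; rewrite in_itv/= andbT => r0; apply: cvgV; last exact: cD.
    by rewrite gt_eqF// addr_gt0// divr_gt0.
  apply: cvg_at_right_filter; apply: cvgV; last exact: cD.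
  by rewrite mul0r addr0 oner_eq0.
apply: zen_sq_le => eps e0.
apply: (@le_trans _ _ (\int[m]_(r in I) ((pi * x ^- q)%:E * ((1 + r / x) ^- q)%R%:E))%E).
  apply: ge0_le_integral => //.
  - by move=> r _; exact: line_sqint_ge0.
  - apply: measurable_funTS; apply: measurableT_comp (measurable_line_sqint hF) _.
    exact: measurable_funD.
  - exact: measurable_funeM.
  move=> r; rewrite /= in_itv/= andbT => r0; have re : 0 < r + eps by rewrite ltr_wpDl.
  apply: le_trans (line_sqint_inverse_power j x0 re) _.
  rewrite -EFinM lee_fin -/q -mulrA ler_wpM2l ?(ltW pi0)// -invfM -exprMn.
  have rx : 0 <= r / x by rewrite divr_ge0// ltW.
  have -> : x * (1 + r / x) = r + x by field; rewrite gt_eqF.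
  have a1 : 0 < r + x by rewrite ltr_wpDl.
  have a2 : 0 < r + eps + x by rewrite addr_gt0.
  rewrite lef_pV2 ?posrE ?exprn_gt0//.
  apply: lerXn2r; rewrite ?nnegrE; lra.
rewrite ge0_integralZl//; last by move=> r /=; rewrite in_itv/= andbT lee_fin; exact: f0.
rewrite [X in (_ <= X)%E](_ : _ = (pi * x ^- q)%:E * ((1 + 2 * D)%:E * V x))%E; last first.
  by rewrite muleA -EFinM.
apply: lee_wpmul2l; first by rewrite lee_fin.
exact: integral_power_decay.
Qed.

Let cancel_common_factors (lam x X c p v B d v' : R) :
  0 < lam -> 0 < x -> 0 < X -> 0 < c -> 0 < p -> 0 < v ->
  c^-1 * (x * X)^-1 <= (p * (lam * x / 2) * v)^-1 * (B * (p * X^-1 * d * v')) ->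
  lam * v <= c * (2 * d) * B * v'.
Proof.
move=> l0 x0 X0 c0 p0 v0 h.
have k0 : 0 < 2 * c * (x * X) * (lam * v) / 2 by rewrite !(divr_gt0, mulr_gt0)// ltr0n.
have -> : lam * v = 2 * c * (x * X) * (lam * v) / 2 * (c^-1 * (x * X)^-1).
  by field; rewrite !gt_eqF.
apply: le_trans (ler_wpM2l (ltW k0) h) _.
by rewrite le_eqVlt; apply/orP; left; apply/eqP; field; rewrite !gt_eqF.
Qed.

(** Testing on [(z + x / lam)^(-k)] at the point [x]: any bound on the norm of
   the composition by [Q] dominates the growth of the measure at scale [x]. *)
Lemma composition_norm_ge : exists2 C, 0 < C & forall Q lam B, 0 <= B ->
  (forall z, 0 < complex.Re z -> cdiff Q z) ->
  (forall z, 0 < complex.Re z -> 0 < complex.Re (Q z)) ->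
  radial_limit Q lam ->
  (forall F, zen_fin m F -> (zen_sq m (comp0 F Q) <= B%:E * zen_sq m F)%E) ->
  exists2 x, 0 < x & lam * fine (V x) <= C * B * fine (V (x / lam)).
Proof.
have D1 := doubling_const_ge1 Vfin Vpos Vdbl.
have [p p0 hp] := decay_exponent Vfin Vpos Vdbl.
exists (D ^+ 2 * (3 ^+ (2 * p).+2 * (2 * (1 + 2 * D)))).
  have D0 : 0 < D by lra.
  have D2 : 0 < 1 + 2 * D by lra.
  exact: mulr_gt0 (exprn_gt0 _ D0) (mulr_gt0 (exprn_gt0 _ (ltr0n _ 3)) (mulr_gt0 (ltr0n _ 2) D2)).
move=> Q lam B B0 hQ Q0 hrad hB.
have l0 := radial_limit_gt0 hQ Q0 hrad.
have l2 : 0 < lam / 2 by rewrite divr_gt0.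
have [A hA] := hrad _ l2; pose x := `|A| + 1.
have x0 : 0 < x by rewrite ltr_wpDl.
have Ax : A <= x by rewrite /x; have := ler_norm A; lra.
exists x => //; have := hA x Ax x0.
pose x' := x / lam; have x'0 : 0 < x' by rewrite divr_gt0.
set w := Q x%:C; have w0 : 0 < complex.Re w by exact: Q0.
have wn : w != 0 by exact: Re_neq0.
have nw0 : 0 < normc w by rewrite normc_gt0.
move=> h; have h1 : lam / 2 <= normc (x%:C / w).
  have := le_normc_sub lam%:C (x%:C / w); rewrite normc_real gtr0_norm//.
  by rewrite -[normc (lam%:C - _)]normcN opprB; lra.
have h2 : normc w <= 2 * x'.
  move: h1; rewrite normcM normcV normc_real gtr0_norm// ler_pdivlMr// => h1.
  rewrite /x' mulrA ler_pdivlMr//; lra.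
have h3 : normc (w + x'%:C) <= 3 * x'.
  by apply: le_trans (le_normcD _ _) _; rewrite normc_real gtr0_norm//; lra.
pose F := inverse_power x' p.
have hF : hol0 F by exact: hol0_inverse_power.
have hz := zen_sq_inverse_power x'0 hp (_ : (p <= (2 * p).+1)%N).
have {}hz : (zen_sq m F <= (pi * x' ^- (2 * p).+1 * (1 + 2 * D) * fine (V x'))%:E)%E.
  rewrite EFinM fineVK//; apply: hz.
  by rewrite mul2n -addnn leqW// leq_addr.
have fF : zen_fin m F by split => //; exact: le_lt_trans hz (ltry _).
have hG := hol0_comp0 hQ Q0 hF.
have zG := hB F fF.
have zfin := zen_fin_num fF.
rewrite -(fineK zfin) lee_fin in hz; rewrite -(fineK zfin) -EFinM in zG.
have fG : (zen_sq m (comp0 F Q) < +oo)%E by exact: le_lt_trans zG (ltry _).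
have xx : x <= complex.Re x%:C by [].
have := zen_point Vfin Vpos hG fG x0 xx.
have zG' : fine (zen_sq m (comp0 F Q)) <= B * fine (zen_sq m F).
  rewrite -lee_fin fineK; first exact: zG.
  by rewrite ge0_fin_numE; [exact: fG|exact: zen_sq_ge0].
have pc := point_const_gt0 Vfin Vpos x0.
move=> /le_trans /(_ (ler_wpM2l (ltW pc) (le_trans zG' (ler_wpM2l B0 hz)))).
rewrite /comp0 /= x0 -/w /F /inverse_power w0 normcV normcX -exprVn -exprM.
have x4 : 0 < x / 4 by rewrite divr_gt0.
have v4 := fineV_gt0 Vfin Vpos x4.
have vx : fine (V x) <= D ^+ 2 * fine (V (x / 4)).
  have := doubling_iter Vfin Vpos Vdbl 2 x4.
  have -> : 2 ^+ 2 * (x / 4) = x by field.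
  rewrite -(fineVK Vfin x) -(fineVK Vfin (x / 4)) -EFinM lee_fin; exact: id.
have n0 : 0 < normc (w + x'%:C).
  by rewrite normc_gt0; apply: Re_neq0; rewrite raddfD/= addr_gt0.
have x3 : 0 < 3 * x' by apply: mulr_gt0.
have hk : (3 * x') ^- (2 * p).+2 <= (normc (w + x'%:C))^-1 ^+ (p.+1 * 2).
  rewrite exprVn lef_pV2 ?posrE ?exprn_gt0//.
  by rewrite mulnC mulnS; apply: lerXn2r; rewrite ?nnegrE ?normc_ge0// ltW.
move=> /(le_trans hk) ; rewrite /point_const exprMn invfM.
set v := fine (V (x / 4)) in v4 vx *; set v' := fine (V x').
set q := (2 * p).+1; have pi0 := @pi_gt0 R.
have n3 : (0 : R) < 3 ^+ q.+1 by rewrite exprn_gt0.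
have xq : 0 < x' ^+ q by rewrite exprn_gt0.
move=> hfin.
have key : lam * v <= 3 ^+ q.+1 * (2 * (1 + 2 * D)) * B * v'.
  apply: (@cancel_common_factors lam x' (x' ^+ q) (3 ^+ q.+1) pi v B (1 + 2 * D)) => //.
  by rewrite -exprS [lam * x']mulrC /x' divfK ?gt_eqF.
have := ler_wpM2l (ltW l0) vx; have D2 : 0 <= D ^+ 2 by rewrite sqr_ge0.
have := ler_wpM2l D2 key; rewrite -/x' -/v'.
have -> : D ^+ 2 * (lam * v) = lam * (D ^+ 2 * v) by ring.
have -> : D ^+ 2 * (3 ^+ q.+1 * (2 * (1 + 2 * D)) * B * v') =
  D ^+ 2 * (3 ^+ q.+1 * (2 * (1 + 2 * D))) * B * v' by ring.
by move=> h5 h6; exact: le_trans h6 h5.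
Qed.

End test_function.

(** * Norm bounds in terms of the weight *)


Section weights.
Context {R : realType}.
Notation mR := (measurableTypeR R).
Variable m : {sigma_finite_measure set mR -> \bar R}.
Variable D : R.
Implicit Types (F Q : R[i] -> R[i]) (t x : R).

Notation V := (initial_mass m).
Notation w := (zen_weight m).

Hypothesis Vfin : forall x, (V x < +oo)%E.
Hypothesis Vpos : forall x, 0 < x -> (0 < V x)%E.
Hypothesis Vdbl : forall x, 0 < x -> (V (2 * x)%R <= D%:E * V x)%E.

Lemma zen_weight_gt0 t : 0 < t -> 0 < w t.
Proof.
move=> t0; have [c1 [c2 [c10 _ hw]]] := weight_bounds Vfin Vpos Vdbl.
have /andP[h _] := hw t t0; apply: lt_le_trans h; apply: mulr_gt0 => //.
by apply: fineV_gt0 => //; rewrite invr_gt0.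
Qed.

(** A bound on the ratios of weights is a bound on [V (lam s) / V s], with
   [t = 1 / (lam s)]. *)
Lemma composition_norm_le_weight : exists2 C, 0 < C & forall Q lam S,
  (forall z, 0 < complex.Re z -> cdiff Q z) ->
  (forall z, 0 < complex.Re z -> 0 < complex.Re (Q z)) ->
  radial_limit Q lam ->
  (forall t, 0 < t -> w t / w (lam * t) <= S) ->
  forall F, zen_fin m F -> (zen_sq m (comp0 F Q) <= (C * lam * S)%:E * zen_sq m F)%E.
Proof.
have [c1 [c2 [c10 c20 hw]]] := weight_bounds Vfin Vpos Vdbl.
exists (c2 / c1); first by rewrite divr_gt0.
move=> Q lam S hQ Q0 hrad hS F [hF fF].
have l0 := radial_limit_gt0 hQ Q0 hrad.
have S0 : 0 <= S.
  apply: le_trans (hS 1 ltr01); rewrite mulr1.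
  exact: ltW (divr_gt0 (zen_weight_gt0 ltr01) (zen_weight_gt0 l0)).
have K0 : 0 <= c2 / c1 * S by rewrite mulr_ge0// divr_ge0// ltW.
rewrite (_ : c2 / c1 * lam * S = lam * (c2 / c1 * S)); last by ring.
apply: (zen_sq_comp hQ Q0 hrad Vfin Vpos K0) => // s s0.
have ls0 : 0 < lam * s by rewrite mulr_gt0.
pose t := (lam * s)^-1; have t0 : 0 < t by rewrite invr_gt0.
have lt0 : 0 < lam * t by rewrite mulr_gt0.
have := hS t t0; rewrite ler_pdivrMr ?zen_weight_gt0// => h.
have /andP[h1 _] := hw _ t0; have /andP[_ h2] := hw _ lt0.
have e1 : t^-1 = lam * s by rewrite invrK.
have e2 : (lam * t)^-1 = s by rewrite invfM e1 mulKf// gt_eqF.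
rewrite e1 in h1; rewrite e2 in h2.
rewrite -(fineVK Vfin (lam * s)) -(fineVK Vfin s) -EFinM lee_fin.
rewrite -(ler_pM2l c10); apply: le_trans h1 _; apply: le_trans h _.
apply: le_trans (ler_wpM2l S0 h2) _.
by rewrite le_eqVlt; apply/orP; left; apply/eqP; field; rewrite gt_eqF.
Qed.

Lemma composition_norm_ge_weight : exists2 C, 0 < C & forall Q lam B, 0 <= B ->
  (forall z, 0 < complex.Re z -> cdiff Q z) ->
  (forall z, 0 < complex.Re z -> 0 < complex.Re (Q z)) ->
  radial_limit Q lam ->
  (forall F, zen_fin m F -> (zen_sq m (comp0 F Q) <= B%:E * zen_sq m F)%E) ->
  exists2 t, 0 < t & lam * (w t / w (lam * t)) <= C * B.
Proof.
have [c1 [c2 [c10 c20 hw]]] := weight_bounds Vfin Vpos Vdbl.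
have [C C0 hC] := composition_norm_ge Vfin Vpos Vdbl.
exists (c2 / c1 * C); first by rewrite mulr_gt0// divr_gt0.
move=> Q lam B B0 hQ Q0 hrad hB; have l0 := radial_limit_gt0 hQ Q0 hrad.
have [x x0 hx] := hC Q lam B B0 hQ Q0 hrad hB.
have t0 : 0 < x^-1 by rewrite invr_gt0.
have lt0 : 0 < lam * x^-1 by rewrite mulr_gt0.
exists x^-1 => //; have /andP[_ h1] := hw _ t0; have /andP[h2 _] := hw _ lt0.
rewrite invrK in h1; rewrite invfM invrK [lam^-1 * x]mulrC in h2.
rewrite mulrA ler_pdivrMr ?zen_weight_gt0//.
apply: le_trans (ler_wpM2l (ltW l0) h1) _.
have CB0 : 0 <= c2 / c1 * C * B 
  by apply: mulr_ge0 => //; apply: ltW; rewrite mulr_gt0// divr_gt0.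
apply: le_trans _ (ler_wpM2l CB0 h2).
have := ler_wpM2l (ltW c20) hx.
have -> : c2 * (lam * fine (V x)) = lam * (c2 * fine (V x)) by ring.
have -> : c2 / c1 * C * B * (c1 * fine (V (x / lam))) = c2 * (C * B * fine (V (x / lam))).
  by field; rewrite gt_eqF.
exact: id.
Qed.

(** As [L ^ (- n) <= 2 ^ (j n)] for a fixed [j], doubling [j n] times compares the
   two masses. *)
Lemma weight_ratio_ge L : 0 < L -> exists c k, [/\ 0 < c, 0 < k &
  forall n t, 0 < t -> c * k ^+ n <= w t / w (L ^+ n * t)].
Proof.
move=> L0; have [c1 [c2 [c10 c20 hw]]] := weight_bounds Vfin Vpos Vdbl.
have D1 := doubling_const_ge1 Vfin Vpos Vdbl; have D0 : 0 < D by lra.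
pose j := Num.bound L^-1.
have hj : L^-1 <= 2 ^+ j.
  apply: le_trans (ltW (archi_boundP _)) _; first by rewrite invr_ge0 ltW.
  by rewrite -natrX ler_nat ltnW// ltn_expl.
have Dj : 0 < D ^+ j by rewrite exprn_gt0.
exists (c1 / c2), (D ^+ j)^-1; split; rewrite ?divr_gt0 ?invr_gt0//.
move=> n t t0; have Ln : 0 < L ^+ n by rewrite exprn_gt0.
have lt0 : 0 < L ^+ n * t by rewrite mulr_gt0.
have ti0 : 0 < t^-1 by rewrite invr_gt0.
have /andP[h1 _] := hw _ t0; have /andP[_ h2] := hw _ lt0.
rewrite ler_pdivlMr ?zen_weight_gt0//; apply: le_trans h1.
have cD : 0 <= c1 / c2 * (D ^+ j)^-1 ^+ n.
  by apply: ltW; rewrite mulr_gt0 ?divr_gt0// exprn_gt0// invr_gt0.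
apply: le_trans (ler_wpM2l cD h2) _.
have vv : fine (V (L ^+ n * t)^-1) <= (D ^+ j) ^+ n * fine (V t^-1).
  apply: (@le_trans _ _ (fine (V (2 ^+ (j * n) * t^-1)))).
    apply: fineV_mono => //; rewrite invfM ler_wpM2r ?(ltW ti0)// exprM -exprVn.
    by apply: lerXn2r; rewrite ?nnegrE ?invr_ge0 ?exprn_ge0// ltW.
  have := doubling_iter Vfin Vpos Vdbl (j * n) ti0.
  rewrite -(fineVK Vfin (2 ^+ (j * n) * t^-1)) -(fineVK Vfin t^-1) -EFinM lee_fin (exprM D).
  exact: id.
have Djn : 0 < (D ^+ j) ^+ n by rewrite exprn_gt0.
rewrite exprVn; have k0 : 0 <= c1 / ((D ^+ j) ^+ n) by apply: ltW; rewrite divr_gt0.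
have := ler_wpM2l k0 vv.
have -> : c1 / (D ^+ j) ^+ n * ((D ^+ j) ^+ n * fine (V t^-1)) = c1 * fine (V t^-1).
  by field; rewrite gt_eqF.
have -> : c1 / c2 / (D ^+ j) ^+ n * (c2 * fine (V (L ^+ n * t)^-1)) =
  c1 / (D ^+ j) ^+ n * fine (V (L ^+ n * t)^-1) by field; rewrite !gt_eqF.
exact: id.
Qed.

End weights.

(** * Functions on the half-plane and their extension by zero *)


Section transfer.
Context {R : realType}.
Notation mR := (measurableTypeR R).
Implicit Types (F G : halfplane R -> R[i]) (t x : R) (z : R[i]).

Lemma ext0E F (z : halfplane R) : ext0 F (val z) = F z.
Proof. by rewrite /ext0 valK. Qed.

Lemma ext0_out F z : complex.Re z <= 0 -> ext0 F z = 0.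
Proof. by move=> z0; rewrite /ext0 insubF//= ltNge z0. Qed.

Lemma ext0_in F z (z0 : 0 < complex.Re z) : ext0 F z = F (Sub z z0).
Proof. by rewrite /ext0 insubT. Qed.

Lemma ext0L (a : R[i]) F G : ext0 (a *: F + G) = fun z => a * ext0 F z + ext0 G z.
Proof.
apply/funext => z; have [z0|z0] := ltP 0 (complex.Re z); first by rewrite !ext0_in.
by rewrite !ext0_out// mulr0 addr0.
Qed.

Lemma ext0_restrict f : hol0 f -> ext0 (fun z : halfplane R => f (val z)) = f.
Proof.
move=> [_ h]; apply/funext => z; have [z0|z0] := ltP 0 (complex.Re z); first by rewrite ext0_in.
by rewrite ext0_out// h.
Qed.

Lemma analyticP F : analytic F <-> hol0 (ext0 F).
Proof.
split=> [h|[h _] [z z0]]; last exact: (h z z0).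
split=> z z0; last exact: ext0_out.
exact: (h (Sub z z0)).
Qed.

Variable m : {sigma_finite_measure set mR -> \bar R}.

Lemma zen_sqnormE F : analytic F -> zen_sqnorm m F = zen_sq m (ext0 F).
Proof.
move=> /analyticP hF; congr ereal_sup; apply/seteqP.
split=> _ [eps he <-]; exists eps => //; first by rewrite -zen_sq_prod.
by rewrite -zen_sq_prod.
Qed.

Lemma zen_spaceP F : zen_space m F <-> zen_fin m (ext0 F).
Proof.
split=> [[h1 h2]|[h1 h2]]; first by split; [exact/analyticP|rewrite -zen_sqnormE].
by have h := (analyticP F).2 h1; split => //; rewrite zen_sqnormE.
Qed.

Lemma zen_normE F : zen_space m F -> zen_norm m F = zen_root m (ext0 F).
Proof. by move=> [hF _]; rewrite /zen_norm zen_sqnormE. Qed.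

Notation H := (zen_space m).
Notation N := (zen_norm m).

Lemma zen_spaceL (a : R[i]) F G : H F -> H G -> H (a *: F + G).
Proof.
move=> /zen_spaceP hF /zen_spaceP hG; apply/zen_spaceP; rewrite ext0L.
have [h1 _] := zen_finZ a hF; exact: (zen_finD h1 hG).1.
Qed.

Lemma zen_space0 : H 0.
Proof.
have e : ext0 (0 : halfplane R -> R[i]) = fun=> 0.
  apply/funext => z; have [z0|z0] := ltP 0 (complex.Re z); first by rewrite ext0_in.
  by rewrite ext0_out.
apply/zen_spaceP; rewrite e; split; first exact: hol0_cst0.
have := @zen_sq_comb R m _ _ _ 0 0 hol0_cst0 hol0_cst0 hol0_cst0 (lexx _) (lexx _).
move=> h; apply: (le_lt_trans (h _)) => //; last by rewrite !mul0e adde0.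
by move=> z _; rewrite normc0 expr0n/= !mul0r addr0.
Qed.

Lemma zen_norm_ge0 F : 0 <= N F. Proof. exact: sqrtr_ge0. Qed.

Lemma zen_spaceZ (a : R[i]) F : H F -> H (a *: F).
Proof. by move=> hF; rewrite -[_ *: _]addr0; exact: zen_spaceL hF zen_space0. Qed.

Lemma zen_spaceB F G : H F -> H G -> H (F - G).
Proof. by move=> hF hG; rewrite addrC -scaleN1r; exact: zen_spaceL. Qed.

Lemma ext0Z (a : R[i]) F : ext0 (a *: F) = fun z => a * ext0 F z.
Proof.
apply/funext => z; have [z0|z0] := ltP 0 (complex.Re z); first by rewrite !ext0_in.
by rewrite !ext0_out// mulr0.
Qed.

Lemma ext0B F G : ext0 (F - G) = fun z => ext0 F z - ext0 G z.
Proof.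
apply/funext => z; have [z0|z0] := ltP 0 (complex.Re z); first by rewrite !ext0_in.
by rewrite !ext0_out// subr0.
Qed.

Lemma ext0D F G : ext0 (F + G) = fun z => ext0 F z + ext0 G z.
Proof.
apply/funext => z; have [z0|z0] := ltP 0 (complex.Re z); first by rewrite !ext0_in.
by rewrite !ext0_out// addr0.
Qed.

Lemma zen_normD F G : H F -> H G -> N (F + G) <= N F + N G.
Proof.
move=> hF hG; have hFG : H (F + G) by rewrite -[F]scale1r; exact: zen_spaceL.
rewrite !zen_normE// ext0D.
by move: hF hG => /zen_spaceP hF /zen_spaceP hG; exact: (zen_finD hF hG).2.
Qed.

Lemma zen_normZ (a : R[i]) F : H F -> N (a *: F) = normc a * N F.
Proof.
have le (b : R[i]) G : H G -> N (b *: G) <= normc b * N G.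
  move=> hG; rewrite (zen_normE hG) (zen_normE (zen_spaceZ b hG)).
  by rewrite ext0Z; move: hG => /zen_spaceP hG; exact: (zen_finZ b hG).2.
move=> hF; apply/eqP; rewrite eq_le le//=.
have [->|a0] := eqVneq a 0; first by rewrite normc0 mul0r zen_norm_ge0.
have na : 0 < normc a by rewrite normc_gt0.
rewrite -ler_pdivlMl// -normcV; apply: le_trans _ (le a^-1 _ (zen_spaceZ a hF)).
by rewrite scalerA (mulVf a0) scale1r lexx.
Qed.

Variable D : R.
Hypothesis Vfin : forall x, (initial_mass m x < +oo)%E.
Hypothesis Vpos : forall x, 0 < x -> (0 < initial_mass m x)%E.
Hypothesis Vdbl : forall x, 0 < x -> (initial_mass m (2 * x)%R <= D%:E * initial_mass m x)%E.

Lemma zen_norm_eq0 F : H F -> N F = 0 -> F = 0.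
Proof.
move=> hF; rewrite zen_normE// => h; apply/funext => -[z z0].
move: hF => /zen_spaceP hF.
have := zen_point_root Vfin Vpos hF z0 (lexx _); rewrite h mulr0 ext0_in => n0.
apply/eqP; rewrite -normc_eq0 eq_le normc_ge0 andbT.
by rewrite /= in n0.
Qed.

Lemma zen_norm_complete (u : nat -> halfplane R -> R[i]) c q : 0 <= q < 1 ->
  (forall n, H (u n)) -> (forall n, N (u n.+1 - u n) <= c * q ^+ n) ->
  exists2 F, H F & forall n, N (F - u n) <= c * q ^+ n / (1 - q).
Proof.
move=> q01 hu hc.
have hu' n : zen_fin m (ext0 (u n)) by exact/zen_spaceP.
have hc' n : zen_root m (fun z => ext0 (u n.+1) z - ext0 (u n) z) <= c * q ^+ n.
  by rewrite -ext0B -zen_normE; [exact: hc|exact: zen_spaceB].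
have [f hf hfn] := zen_complete (u := fun n => ext0 (u n)) Vfin Vpos q01 hu' hc'.
pose F (z : halfplane R) := f (val z).
have eF : ext0 F = f by apply: ext0_restrict; have [] := hf.
have hF : H F by apply/zen_spaceP; rewrite eF.
exists F; first exact: hF.
move=> n; rewrite zen_normE; last exact: zen_spaceB.
by rewrite ext0B eF; exact: hfn.
Qed.

End transfer.

(** * The spectral radius *)


Lemma powR_root_exp {R : realType} (b : R) n : (0 < n)%N -> 0 <= b ->
  (b ^+ n) `^ (n%:R^-1) = b.
Proof.
move=> n0 b0; rewrite -powR_mulrn// -powRrM mulfV ?powRr1//.
by rewrite pnatr_eq0 -lt0n.
Qed.

Lemma root_lt_le_exp {R : realType} (s : \bar R) (b : R) n : (0 < n)%N -> (0 <= s)%E -> 0 <= b ->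
  (s `^ (n%:R^-1) < b%:E)%E -> (s <= (b ^+ n)%:E)%E.
Proof.
move=> n0 s0 b0; have n1 : (n%:R^-1 : R) != 0 by rewrite invr_eq0 pnatr_eq0 -lt0n.
case: s s0 => [s| |//]; last by rewrite poweRyr.
rewrite poweR_EFin !lte_fin !lee_fin => s0; apply: contraTT; rewrite -!ltNge -leNgt => /ltW h.
rewrite -[leLHS](powR_root_exp n0 b0); apply: ge0_ler_powR; rewrite ?nnegrE ?exprn_ge0//.
Qed.

Lemma lt_root_exp_le {R : realType} (s : \bar R) (b : R) n : (0 < n)%N -> (0 <= s)%E -> 0 <= b ->
  (b%:E < s `^ (n%:R^-1))%E -> ((b ^+ n)%:E <= s)%E.
Proof.
move=> n0 s0 b0; case: s s0 => [s| |//]; last by move=> _ _; exact: leey.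
rewrite poweR_EFin !lte_fin !lee_fin => s0; apply: contraTT; rewrite -!ltNge -leNgt => /ltW h.
rewrite -[leRHS](powR_root_exp n0 b0); apply: ge0_ler_powR; rewrite ?nnegrE ?exprn_ge0//.
Qed.

Section spectral_bounds.
Context {R : realType}.
Notation mR := (measurableTypeR R).
Variable m : {sigma_finite_measure set mR -> \bar R}.
Variable D : R.
Implicit Types (F G : halfplane R -> R[i]) (t x b : R) (z l : R[i]).

Notation w := (zen_weight m).
Notation H := (zen_space m).
Notation N := (zen_norm m).

Hypothesis Vfin : forall x, (initial_mass m x < +oo)%E.
Hypothesis Vpos : forall x, 0 < x -> (0 < initial_mass m x)%E.
Hypothesis Vdbl : forall x, 0 < x -> (initial_mass m (2 * x)%R <= D%:E * initial_mass m x)%E.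

Variables (phi : halfplane R -> halfplane R) (L : R).
Hypothesis hphi : analytic (fun z : halfplane R => val (phi z)).
Hypothesis hL : angular_lim_infty (fun z : halfplane R => val z / val (phi z)) L%:C.

Notation T := (composition_operator phi).
Hypothesis hbd : bounded_operator H N T.

Let P := ext0 (fun z : halfplane R => val (phi z)).

Let PE (z : halfplane R) : P (val z) = val (phi z). Proof. exact: ext0E. Qed.

Let hP z : 0 < complex.Re z -> cdiff P z.
Proof. by have [h _] := (analyticP _).1 hphi; exact: h. Qed.

Let P0 z : 0 < complex.Re z -> 0 < complex.Re (P z).
Proof. by move=> z0; rewrite /P ext0_in; exact: valP (phi _). Qed.

Let hsec : sector_limit P L.
Proof.
move=> e e0; have [|A hA] := hL (_ : pi / 4 < pi / 2) e0.
  by rewrite ltr_pM2l ?pi_gt0// ltf_pV2 ?posrE// ltr_nat.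
exists A => z z0 hs zA; pose z' : halfplane R := Sub z z0.
have := hA z'; rewrite -(PE z') /z' SubK; apply => //.
rewrite /arg SubK -atan1 ler_norml -atanN.
have h : -1 <= complex.Im z / complex.Re z <= 1.
  by rewrite ler_pdivlMr// ler_pdivrMr// mulN1r mul1r -ler_norml.
by have /andP[h1 h2] := h; rewrite !le_atan.
Qed.

Let L0 : 0 < L. Proof. exact: radial_limit_gt0 hP P0 (sector_radial_limit hsec). Qed.

Let iterP n (z : halfplane R) : iter n P (val z) = val (iter n phi z).
Proof. by elim: n => //= n ->; exact: PE. Qed.

Let iterT n F : iter n T F = F \o iter n phi.
Proof.
elim: n F => // n ih F; rewrite iterS ih; apply/funext => z.
by rewrite /composition_operator /= -iterSr.
Qed.

Let ext0_iterT n F : ext0 (iter n T F) = comp0 (ext0 F) (iter n P).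
Proof.
apply/funext => z; rewrite /comp0; have [z0|z0] := ltP 0 (complex.Re z); last exact: ext0_out.
by rewrite ext0_in iterT /= -[z in RHS](SubK (halfplane R) z0) iterP ext0E.
Qed.

Let iter_facts n : [/\ forall z, 0 < complex.Re z -> cdiff (iter n P) z,
  forall z, 0 < complex.Re z -> 0 < complex.Re (iter n P z) &
  radial_limit (iter n P) (L ^+ n)].
Proof.
split; [exact: iter_cdiff|exact: iter_pos|exact: iter_radial_limit].
Qed.

Let iter_space n F : H F -> H (iter n T F).
Proof.
have N0 G : H G -> 0 <= N G by move=> _; exact: zen_norm_ge0.
have [h _ _] := bounded_operator_iter (zen_space0 m) (@zen_spaceL _ m) N0 n hbd.
exact: h.
Qed.

(** Along the given [n] the squared norm of [T ^ n] is [O((L b) ^ n)], which is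
   eventually smaller than [|l| ^ (2 n)]. *)
Lemma resolvent_of_weight_ratio l b : 0 < b -> L * b < normc l ^+ 2 ->
  (forall n0, exists2 n, (n0 <= n)%N & forall t, 0 < t -> w t / w (L ^+ n * t) <= b ^+ n) ->
  resolvent_set H N T l.
Proof.
move=> b0 bl hb; have Lb : 0 < L * b by rewrite mulr_gt0.
have nl2 : 0 < normc l ^+ 2 by exact: lt_trans bl.
have nl : 0 < normc l.
  by rewrite lt_neqAle normc_ge0 andbT eq_sym; apply: contraTneq nl2 => ->; rewrite expr0n ltxx.
have l0 : l != 0 by rewrite -normc_gt0.
have [C C0 hC] := composition_norm_le_weight Vfin Vpos Vdbl.
pose q := L * b / normc l ^+ 2.
have q01 : 0 <= q < 1 by rewrite divr_ge0 ?(ltW Lb) ?(ltW nl2)//= ltr_pdivrMr// mul1r.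
have i4 : (0 : R) < 4^-1 by rewrite invr_gt0.
have [n0 hn0] := geometric_small C q01 i4.
have [n nn0 hn] := hb n0; have {}hn0 := hn0 n nn0.
have N0 G : H G -> 0 <= N G by move=> _; exact: zen_norm_ge0.
have h2 : 0 <= (2 : R)^-1 < 1 by apply/andP; split; lra.
apply: (resolvent_of_small_power (zen_space0 m) (@zen_spaceL _ m) N0 (@zen_normD _ m)
  (@zen_normZ _ m) hbd (zen_norm_eq0 Vfin Vpos) (zen_norm_complete Vfin Vpos) h2 l0 (n := n)).
move=> F hF; have hTF := iter_space n hF.
rewrite (zen_normE hF) (zen_normE hTF) ext0_iterT.
have [h1' h2' h3'] := iter_facts n; have hF' := (zen_spaceP m F).1 hF.
have r0 := zen_root_ge0 m (ext0 F).
apply: zen_root_le.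
  by rewrite mulr_ge0// mulr_ge0 ?exprn_ge0 ?normc_ge0// ltW// invr_gt0.
apply: le_trans (hC _ _ _ h1' h2' h3' hn _ hF') _.
rewrite (zen_sq_root hF') -EFinM lee_fin 2!exprMn ler_wpM2r ?sqr_ge0//.
have -> : C * L ^+ n * b ^+ n = C * q ^+ n * (normc l ^+ 2) ^+ n.
  by rewrite -!mulrA -!exprMn divfK// gt_eqF.
rewrite [(normc l ^+ n) ^+ 2]exprAC (_ : 2^-1 ^+ 2 = 4^-1); last by field.
by rewrite ler_wpM2r// exprn_ge0// ltW.
Qed.

(** The squared norm of [T ^ n] is [O(r ^ (2 n))] and at least of order
   [(L b) ^ n] for infinitely many [n]. *)
Lemma weight_ratio_of_resolvent r b c : 0 < r -> 0 < b -> 0 < c ->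
  (forall l, r <= normc l -> resolvent_set H N T l) ->
  (forall n0, exists2 n, (n0 <= n)%N & forall t, 0 < t -> c * b ^+ n <= w t / w (L ^+ n * t)) ->
  L * b <= r ^+ 2.
Proof.
move=> r0 b0 c0 hres hb; rewrite leNgt; apply/negP => rb.
have Lb : 0 < L * b by rewrite mulr_gt0.
have N0 G : H G -> 0 <= N G by move=> _; exact: zen_norm_ge0.
have [C1 C10 hC1] := resolvent_power_growth (zen_space0 m) (@zen_spaceL _ m) N0
  (@zen_normD _ m) (@zen_normZ _ m) hbd r0 hres.
have [C C0 hC] := composition_norm_ge_weight Vfin Vpos Vdbl.
pose q := r ^+ 2 / (L * b).
have q01 : 0 <= q < 1 by rewrite divr_ge0 ?sqr_ge0 ?(ltW Lb)//= ltr_pdivrMr// mul1r.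
have c2 : 0 < c / 2 by rewrite divr_gt0.
have [n0 hn0] := geometric_small (C * C1 ^+ 2) q01 c2.
have [n nn0 hn] := hb n0; have {}hn0 := hn0 n nn0.
have [h1' h2' h3'] := iter_facts n.
have B0 : 0 <= (C1 * r ^+ n) ^+ 2 by exact: sqr_ge0.
have [|t t0 ht] := hC _ _ _ B0 h1' h2' h3'.
  move=> f hf; pose F (z : halfplane R) := f (val z).
  have eF : ext0 F = f by apply: ext0_restrict; have [] := hf.
  have hF : H F by apply/zen_spaceP; rewrite eF.
  have hTF := iter_space n hF; have := hC1 n F hF.
  rewrite (zen_normE hF) (zen_normE hTF) ext0_iterT eF => h.
  have hG : zen_fin m (comp0 f (iter n P)).
    by rewrite -eF -ext0_iterT; exact/zen_spaceP.
  rewrite (zen_sq_root hf) (zen_sq_root hG) -EFinM lee_fin -exprMn.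
  by apply: lerXn2r h; rewrite nnegrE ?mulr_ge0 ?exprn_ge0 ?zen_root_ge0// ltW.
have Ln : 0 < L ^+ n by rewrite exprn_gt0.
have := le_trans (ler_wpM2l (ltW Ln) (hn t t0)) ht.
have -> : L ^+ n * (c * b ^+ n) = c * (L * b) ^+ n by rewrite exprMn; ring.
have -> : C * (C1 * r ^+ n) ^+ 2 = C * C1 ^+ 2 * q ^+ n * (L * b) ^+ n.
  by rewrite -mulrA -[q ^+ n * _]exprMn /q divfK ?gt_eqF// exprMn exprAC mulrA.
rewrite ler_pM2r ?exprn_gt0//; lra.
Qed.

(** With empty spectrum, [weight_ratio_of_resolvent] would apply to arbitrarily
   small [r], against the geometric lower bound on the ratios. *)
Lemma spectrum_neq0 : spectrum H N T !=set0.
Proof.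
have [c [k [c0 k0 hck]]] := weight_ratio_ge Vfin Vpos Vdbl L0.
apply: contrapT => hE; have Lk : 0 < L * k / 2 by rewrite divr_gt0// mulr_gt0.
have hres l : resolvent_set H N T l.
  by apply: contrapT => hl; apply: hE; exists l.
have r0 : 0 < Num.sqrt (L * k / 2) by rewrite sqrtr_gt0.
have := weight_ratio_of_resolvent r0 k0 c0 (fun l _ => hres l)
  (fun n0 => ex_intro2 _ _ n0 (leqnn n0) (hck n0)).
rewrite sqr_sqrtr ?(ltW Lk)//.
have : 0 < L * k by rewrite mulr_gt0.
lra.
Qed.

Notation rho := (spectral_radius H N T).
Notation ratio n := [set (w t / w (L ^+ n * t))%:E | t in `]0%R, +oo[%classic].

Let ratio_gt0 n t : 0 < t -> 0 < w t / w (L ^+ n * t).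
Proof.
move=> t0; apply: divr_gt0; apply: (zen_weight_gt0 Vfin Vpos Vdbl) => //.
by rewrite mulr_gt0// exprn_gt0.
Qed.

Let inf_ratio_ge0 n : (0 <= ereal_inf (ratio n))%E.
Proof.
apply: le_ereal_inf_tmp => _ [t /= t0 <-]; rewrite in_itv/= andbT in t0.
by rewrite lee_fin ltW// ratio_gt0.
Qed.

Let sup_ratio_ge0 n : (0 <= ereal_sup (ratio n))%E.
Proof.
apply: (@le_trans _ _ (w 1 / w (L ^+ n * 1))%:E); first by rewrite lee_fin ltW// ratio_gt0.
by apply: ereal_sup_ubound; exists 1 => //=; rewrite in_itv/= ltr01.
Qed.

Lemma spectral_radius_ge0 : (0 <= rho)%E.
Proof.
have [l hl] := spectrum_neq0; apply: (@le_trans _ _ (normc l)%:E).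
  by rewrite lee_fin normc_ge0.
by apply: ereal_sup_ubound; exists l.
Qed.

Lemma spectral_radius_sqr_le :
  (rho ^+ 2 <= L%:E * limn_einf (fun n => ereal_sup (ratio n) `^ (n%:R^-1)))%E.
Proof.
set u := fun n => _; have u0 n : (0 <= u n)%E by exact: poweR_ge0.
have a0 : (0 <= limn_einf u)%E.
  rewrite leNgt; apply/negP => /(limn_einf_lt 0)[n _].
  by rewrite ltNge u0.
have key l b : spectrum H N T l -> (limn_einf u < b%:E)%E -> normc l ^+ 2 <= L * b.
  move=> hl hb; rewrite leNgt; apply/negP => lb; apply: hl.
  have b0 : 0 < b by rewrite -lte_fin; exact: le_lt_trans hb.
  apply: (resolvent_of_weight_ratio b0 lb) => n0.
  have [n nn0 hn] := limn_einf_lt (maxn 1 n0) hb.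
  move: nn0; rewrite geq_max => /andP[n1 nn0]; exists n => // t t0.
  have := root_lt_le_exp n1 (sup_ratio_ge0 n) (ltW b0) hn.
  rewrite -lee_fin; apply: le_trans; apply: ereal_sup_ubound.
  by exists t => //=; rewrite in_itv/= t0.
case: (limn_einf u) a0 key => [a|_ _|//]; last first.
  by rewrite gt0_muley ?lte_fin// leey.
rewrite lee_fin => a0 key; have La : 0 <= L * a by rewrite mulr_ge0// ltW.
have hl l : spectrum H N T l -> normc l <= Num.sqrt (L * a).
  move=> hl; rewrite -(ler_pXn2r (n := 2))// ?nnegrE ?normc_ge0 ?sqrtr_ge0// sqr_sqrtr//.
  apply/ler_addgt0Pr => e e0; have eL : 0 < e / L by rewrite divr_gt0.
  have := key l (a + e / L) hl; rewrite lte_fin ltrDl eL => /(_ isT).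
  by rewrite mulrDr [L * (e / L)]mulrC divfK ?gt_eqF.
have h : (rho <= (Num.sqrt (L * a))%:E)%E.
  by apply: ge_ereal_sup => _ [l hl' <-]; rewrite lee_fin; exact: hl.
have r0 := spectral_radius_ge0.
rewrite -EFinM -(sqr_sqrtr La) expr2 EFinM.
by apply: lee_pmul.
Qed.

Lemma le_spectral_radius_sqr :
  (L%:E * limn_esup (fun n => ereal_inf (ratio n) `^ (n%:R^-1)) <= rho ^+ 2)%E.
Proof.
set u := fun n => _.
have r0 := spectral_radius_ge0.
have rsup l : spectrum H N T l -> ((normc l)%:E <= rho)%E.
  by move=> hl; apply: ereal_sup_ubound; exists l.
case: rho r0 rsup => [s|_ _|//]; last by rewrite expe2 mulyy leey.
rewrite lee_fin => s0 rsup.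
have key b r : 0 < b -> s < r -> (b%:E < limn_esup u)%E -> L * b <= r ^+ 2.
  move=> b0 sr hb; have r0 : 0 < r by exact: le_lt_trans sr.
  apply: (weight_ratio_of_resolvent r0 b0 ltr01).
    move=> l rl; apply: contrapT => hl; have := rsup l hl.
    by rewrite lee_fin leNgt (lt_le_trans sr rl).
  move=> n0; have [n nn0 hn] := limn_esup_gt (maxn 1 n0) hb.
  move: nn0; rewrite geq_max => /andP[n1 nn0]; exists n => // t t0.
  have := lt_root_exp_le n1 (inf_ratio_ge0 n) (ltW b0) hn.
  rewrite mul1r -lee_fin => /le_trans; apply; apply: ereal_inf_lbound.
  by exists t => //=; rewrite in_itv/= t0.
have key2 b : (b%:E < limn_esup u)%E -> L * b <= s ^+ 2.
  move=> hb; have [b0|b0] := ltP 0 b; last first.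
    by apply: le_trans (sqr_ge0 s); rewrite mulr_ge0_le0// ltW.
  rewrite leNgt; apply/negP => sb; have Lb : 0 <= L * b by rewrite mulr_ge0// ltW.
  have sq0 := sqrtr_ge0 (L * b); have sqE := sqr_sqrtr Lb.
  set k := Num.sqrt _ in sq0 sqE.
  have sk : s < k by rewrite -(ltr_pXn2r (n := 2))// ?nnegrE// sqE.
  have := key b ((s + k) / 2) b0 ltac:(lra) hb; rewrite -sqE.
  rewrite ler_pXn2r ?nnegrE//; lra.
rewrite expe2 -EFinM -expr2; case: (limn_esup u) key2 => [a| |] key2.
- rewrite -EFinM lee_fin; apply/ler_addgt0Pr => e e0.
  have eL : 0 < e / L by rewrite divr_gt0.
  have := key2 (a - e / L); rewrite lte_fin ltrBlDr ltrDl eL => /(_ isT).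
  by rewrite mulrBr [L * (e / L)]mulrC divfK ?gt_eqF// lerBlDr.
- exfalso; have := key2 (s ^+ 2 / L + 1) (ltry _); rewrite mulrDr [L * (_ / L)]mulrC divfK ?gt_eqF//.
  by have := L0; lra.
- by rewrite gt0_muleNy ?lte_fin// leNye.
Qed.

End spectral_bounds.

Theorem corollary2p2 (R : realType)
  (nu : {measure set (measurableTypeR R) -> \bar R})
  (hreg : regular_on_halfline nu) (hdbl : doubling nu)
  (phi : halfplane R -> halfplane R)
  (hphi : analytic (fun z => val (phi z)))
  (hbd : bounded_operator (zen_space nu) (zen_norm nu) (composition_operator phi))
  (L : R)
  (hL : angular_lim_infty (fun z => val z / val (phi z)) L%:C) :
  let w := zen_weight nu in
  let rho := spectral_radius (zen_space nu) (zen_norm nu) (composition_operator phi) in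
  (L%:E *
     limn_esup (fun n : nat =>
       ereal_inf [set (w t / w (L ^+ n * t))%:E | t in `]0%R, +oo[%classic]
         `^ (n%:R^-1))
   <= rho ^+ 2)%E /\
  (rho ^+ 2 <=
   L%:E *
     limn_einf (fun n : nat =>
       ereal_sup [set (w t / w (L ^+ n * t))%:E | t in `]0%R, +oo[%classic]
         `^ (n%:R^-1)))%E.
Proof.
have [_ hcpt _ _] := hreg; have [hpos hsup] := hdbl.
have sf : sigma_finite setT nu.
  exists (fun n : nat => `[- n%:R, n%:R]%classic); last first.
    by move=> n; split; [exact: measurable_itv|exact/hcpt/segment_compact].
  apply/esym; rewrite -subTset => x _; exists (Num.bound `|x|) => //=.
  by rewrite in_itv/= -ler_norml ltW// archi_boundP.
(* sigma-finiteness gives access to Tonelli's theorem *)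
pose H1 := isSFinite.Build _ _ _ _ (sfinite_measure_sigma_finite sf).
pose H2 := isSigmaFinite.Build _ _ _ _ sf.
pose m := HB.pack_for (SigmaFiniteMeasure.type (measurableTypeR R) R) (Measure.sort nu) H1 H2.
have Vfin x : (initial_mass m x < +oo)%E.
  apply: le_lt_trans (hcpt `[0%R, x]%classic _); last exact: segment_compact.
  apply: le_measure; rewrite ?inE; try exact: measurable_itv.
  by apply: subset_itvl; rewrite bnd_simp.
have Vpos x : 0 < x -> (0 < initial_mass m x)%E := hpos x.
set s := ereal_sup _ in hsup.
have s_ge t : 0 < t -> (initial_mass m (2 * t)%R / initial_mass m t <= s)%E.
  by move=> t0; apply: ereal_sup_ubound; exists t => //=; rewrite in_itv/= t0.
have Vdbl x : 0 < x -> (initial_mass m (2 * x)%R <= (fine s)%:E * initial_mass m x)%E.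
  move=> x0; have V0 : initial_mass m x \is a fin_num by exact: V_fin_num.
  have fV : 0 < fine (initial_mass m x) by exact: fineV_gt0.
  have := s_ge x x0; rewrite -(fineK V0) => hx.
  have s0 : (0 <= s)%E by apply: le_trans hx; rewrite mule_ge0// inve_ge0 lee_fin ltW.
  have sfin : s \is a fin_num by rewrite ge0_fin_numE.
  by move: hx; rewrite -{1}(fineK sfin) inver gt_eqF// lee_pdivrMr.
by split; [exact: (le_spectral_radius_sqr Vfin Vpos Vdbl hphi hL hbd)|
           exact: (spectral_radius_sqr_le Vfin Vpos Vdbl hphi hL hbd)].
Qed.
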